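(* Let $X$ be an infinite-dimensional complex Banach space, $T\in L(X)$ and $1\le i\le 9$. Then: (i) $\sigma_{\mathbf{gD}\mathcal M\mathbf R_i}(T)\subset\sigma_{\mathbf R_i}(T)$; (ii) $\sigma_{\mathbf{gD}\mathcal M\mathbf R_i}(T)$ is compact; (iii) $\mathrm{int}\,\sigma_{\mathbf{gD}\mathcal M\mathbf R_i}(T)=\mathrm{int}\,\sigma_{\mathbf R_i}(T)$; (iv) $\partial\sigma_{\mathbf{gD}\mathcal M\mathbf R_i}(T)\subset\partial\sigma_{\mathbf R_i}(T)$; (v) $\sigma_{\mathbf{BR}_i}(T)\setminus\sigma_{\mathbf{gD}\mathcal M\mathbf R_i}(T)=(\mathrm{iso}\,\sigma_{\mathbf{BR}_i}(T))\setminus\sigma_{\mathbf{gK}\mathcal M}(T)$; (vi) the set $\sigma_{\mathbf{BR}_i}(T)\setminus\sigma_{\mathbf{gD}\mathcal M\mathbf R_i}(T)$ consists of at most countably many points.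
   Context: $L(X)$ is the algebra of bounded linear operators on $X$; $N(T)$, $R(T)$ are kernel and range; for $K\subset\mathbb C$, $\mathrm{int}\,K$, $\partial K$, $\mathrm{acc}\,K$ are the interior, boundary and set of accumulation points, and $\mathrm{iso}\,K=K\setminus\mathrm{acc}\,K$; $\mathbb N_0$ denotes the non-negative integers. $(M,N)\in Red(T)$ means that $M,N$ are closed $T$-invariant subspaces with $X=M\oplus N$; $T_M$, $T_N$ are the restrictions of $T$ viewed as operators on $M$, $N$. All operator classes below are defined in the same way for operators on any Banach space. $T$ is Kato if $R(T)$ is closed and $N(T)\subset R(T^n)$ for every $n\in\mathbb N$. An operator is meromorphic if every non-zero point of its spectrum is a pole of its resolvent. $T$ admits a generalized Kato-meromorphic decomposition if there is $(M,N)\in Red(T)$ with $T_M$ Kato and $T_N$ meromorphic. Classes $\mathbf R_i$: $\mathbf R_1$ = bounded below operators; $\mathbf R_2$ = surjective operators; $\mathbf R_3$ = invertible operators; $\mathbf R_4$ = upper semi-Fredholm operators (finite-dimensional kernel, closed range); $\mathbf R_5$ = lower semi-Fredholm operators (range of finite codimension); $\mathbf R_6$ = Fredholm operators; $\mathbf R_7$ = upper semi-Weyl operators (upper semi-Fredholm with index $\le 0$); $\mathbf R_8$ = lower semi-Weyl operators (lower semi-Fredholm with index $\ge 0$); $\mathbf R_9$ = Weyl operators (Fredholm of index $0$). The index is $\dim N(T)-\mathrm{codim}\,R(T)$. $T\in\mathbf{BR}_i$ means that there is $n\in\mathbb N_0$ such that $R(T^n)$ is closed and the restriction $T_n:R(T^n)\to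 R(T^n)$ of $T$ belongs to $\mathbf R_i$. It is known that $\mathbf{BR}_1$, $\mathbf{BR}_2$, $\mathbf{BR}_3$ are the classes of left Drazin, right Drazin and Drazin invertible operators respectively. $T\in\mathbf{gD}\mathcal M\mathbf R_i$ means that there is $(M,N)\in Red(T)$ with $T_M\in\mathbf R_i$ and $T_N$ meromorphic. For a class $\mathbf C$ among $\mathbf R_i,\mathbf{BR}_i,\mathbf{gD}\mathcal M\mathbf R_i$, $\sigma_{\mathbf C}(T)=\{\lambda\in\mathbb C:T-\lambda I\notin\mathbf C\}$; $\sigma_{\mathbf{gK}\mathcal M}(T)=\{\lambda\in\mathbb C:T-\lambda I\text{ does not admit a generalized Kato-meromorphic decomposition}\}$. *)

(* Defs.v *)
From HB Require Import structures.
From mathcomp Require Import all_boot all_order all_algebra.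
From mathcomp Require Import complex.
From mathcomp Require Import all_classical all_reals all_analysis.

Set Implicit Arguments.
Unset Strict Implicit.
Unset Printing Implicit Defensive.

Import Order.TTheory GRing.Theory Num.Theory.
Import numFieldNormedType.Exports.

Local Open Scope classical_set_scope.
Local Open Scope ring_scope.

Section ClosedSubspace.
Context {K : numFieldType} {X : completeNormedModType K}.

Record closedSubspace := ClosedSubspace {
  csub_set : set X ;
  csub_submod : submod_closed (mem csub_set) ;
  csub_closed : closed csub_set }.

(* The library's [set_type] already carries a uniform structure that is not
   derived from a norm, hence this separate subtype. *)
Record csub_type (M : closedSubspace) := CSub {
  csub_val : X ;
  csub_valP : csub_val \in csub_set M }.

End ClosedSubspace.

Arguments closedSubspace {K} X.

Section ClosedSubspaceBanach.
Context {K : numFieldType} {X : completeNormedModType K}.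
Variable M : closedSubspace X.

HB.instance Definition _ := [isSub for @csub_val K X M].
HB.instance Definition _ := [Choice of csub_type M by <:].
HB.instance Definition _ :=
  GRing.SubChoice_isSubLmodule.Build K X _ (csub_type M) (csub_submod M).

Let nrm (x : csub_type M) : K := `|val x|.

Let nrmD x y : nrm (x + y) <= nrm x + nrm y.
Proof. by rewrite /nrm raddfD ler_normD. Qed.

Let nrmZ (l : K) x : nrm (l *: x) = `|l| * nrm x.
Proof. by rewrite /nrm linearZ normrZ. Qed.

Let nrm0 x : nrm x = 0 -> x = 0.
Proof. by move=> /normr0_eq0 x0; apply: val_inj; rewrite x0 raddf0. Qed.

HB.instance Definition _ :=
  Lmodule_isNormed.Build K (csub_type M) nrmD nrmZ nrm0.

Lemma csub_normE (x : csub_type M) : `|x| = `|val x|.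
Proof. by []. Qed.


Lemma csub_complete (F : set_system (csub_type M)) :
  ProperFilter F -> cauchy F -> cvg F.
Proof.
move=> FF Fc.
have valF : ProperFilter (val @ F) by exact: fmap_proper_filter.
have Fv : cauchy (val @ F : set_system X).
  apply/cauchy_ballP => e e0.
  have /cauchy_ballP /(_ e e0) [[/= A B] [FA FB] AB] := Fc.
  exists (val @` A, val @` B) => /=.
    split; rewrite nbhs_filterE /=;
      [apply: filterS FA|apply: filterS FB] => x Ax; by exists x.
  move=> [_ _] /= [[x Ax <-] [y By <-]].
  by have := AB (x, y) (conj Ax By); rewrite /= -!ball_normE.
have /cvg_ex[l Fl] : cvg (val @ F : set_system X) by exact: cauchy_cvg.
have Ml : l \in csub_set M.
  apply/mem_set/(@csub_closed _ _ M) => U /Fl FU.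
  have [x Ux] := filter_ex (FU : F (val @^-1` U)).
  by exists (val x); split=> //; exact/set_mem/(valP x).
apply/cvg_ex; exists (CSub Ml); apply/cvgrPdist_lt => e e0.
by move/cvgrPdist_lt : Fl => /(_ e e0).
Qed.

HB.instance Definition _ :=
  Uniform_isComplete.Build (csub_type M) csub_complete.

End ClosedSubspaceBanach.

Coercion csub_banach (K : numFieldType) (X : completeNormedModType K)
  (M : closedSubspace X) : completeNormedModType K := csub_type M.

Section Operators.
Context {K : numFieldType} {X : completeNormedModType K}.
Implicit Types (T : {linear X -> X}) (M N : closedSubspace X) (V W : set X).

Definition op_kernel T : set X := [set x | T x = 0].

Definition shift_op T (l : K) : {linear X -> X} := T \- (l \*: idfun).

(* n = dim V / W : the classes of e_0, .., e_(n-1) form a basis of V / W *)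
Definition has_qdim V W n := exists e : 'I_n -> X,
  (forall i, V (e i)) /\
  forall x, V x -> exists! c : 'rV[K]_n, W (x - \sum_i c 0 i *: e i).

Definition qdim V W : \bar int :=
  if pselect (exists n, has_qdim V W n) is left h
  then (sval (cid h) : int)%:E else +oo%E.

Definition dimension V : \bar int := qdim V [set 0].

Definition codimension W : \bar int := qdim [set: X] W.

(* meaningful only when one of the two terms is finite *)
Definition op_index T : \bar int :=
  (dimension (op_kernel T) - codimension (range T))%E.

Definition is_inverse T (S : {linear X -> X}) :=
  [/\ continuous S, cancel T S & cancel S T].

Definition bounded_below T := exists2 c : K, 0 < c & forall x, c * `|x| <= `|T x|.

Definition surjective_op T := range T = [set: X].

Definition invertible T := exists S, is_inverse T S.

Definition upper_semi_Fredholm T :=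
  (dimension (op_kernel T) < +oo)%E /\ closed (range T).

Definition lower_semi_Fredholm T := (codimension (range T) < +oo)%E.

Definition Fredholm T := upper_semi_Fredholm T /\ lower_semi_Fredholm T.

Definition upper_semi_Weyl T := upper_semi_Fredholm T /\ (op_index T <= 0)%E.

Definition lower_semi_Weyl T := lower_semi_Fredholm T /\ (0 <= op_index T)%E.

Definition Weyl T := Fredholm T /\ op_index T = 0%E.

Definition Rcls (i : nat) T : Prop :=
  match i with
  | 1 => bounded_below T
  | 2 => surjective_op T
  | 3 => invertible T
  | 4 => upper_semi_Fredholm T
  | 5 => lower_semi_Fredholm T
  | 6 => Fredholm T
  | 7 => upper_semi_Weyl T
  | 8 => lower_semi_Weyl T
  | 9 => Weyl T
  | _ => False
  end.

Definition sigma (C : {linear X -> X} -> Prop) T : set K :=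
  [set l | ~ C (shift_op T l)].

Definition spectrum := sigma invertible.

Definition Kato T :=
  closed (range T) /\ forall n, op_kernel T `<=` range (iter n T).

(* convergence in operator norm *)
Definition op_cvg (S : nat -> X -> X) (L : X -> X) :=
  forall e : K, 0 < e ->
    \forall n \near \oo, forall x, `|S n x - L x| <= e * `|x|.

(* In a punctured disc around l0 the resolvent exists and is the sum of a
   Laurent series whose lowest term is A_0 (l - l0)^(-m), A_0 != 0, m >= 1. *)
Definition resolvent_pole T (l0 : K) :=
  exists (m : nat) (A : nat -> {linear X -> X}) (r : K),
  [/\ (0 < m)%N, 0 < r, (forall k, continuous (A k)),
      (exists x, A 0%N x <> 0) &
      forall l, 0 < `|l - l0| < r ->
        exists2 S : {linear X -> X}, is_inverse (shift_op T l) S &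
          op_cvg (fun n x => \sum_(k < n) (l - l0) ^ (k%:Z - m%:Z) *: A k x) S].

Definition meromorphic T :=
  forall l, spectrum T l -> l <> 0 -> resolvent_pole T l.

Definition invariant_csub T M := forall x, csub_set M x -> csub_set M (T x).

Definition topological_sum M N :=
  csub_set M `&` csub_set N = [set 0] /\
  forall x, exists y z, [/\ csub_set M y, csub_set N z & x = y + z].

End Operators.

Section Restriction.
Context {K : numFieldType} {X : completeNormedModType K}.
Variables (T : {linear X -> X}) (M : closedSubspace X) (h : invariant_csub T M).

Definition restr (x : M) : M :=
  CSub (mem_set (h (set_mem (valP x)))).

Lemma restr_linear : linear restr.
Proof. by move=> a x y; apply: val_inj; rewrite /= !linearP. Qed.

HB.instance Definition _ := GRing.isLinear.Build K M M _ restr restr_linear.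

End Restriction.

Section DecomposedClasses.
Context {K : numFieldType} {X : completeNormedModType K}.
Implicit Types (T : {linear X -> X}).

(* A closed subspace M with M = R(T^n) exists exactly when R(T^n) is closed. *)
Definition BR (i : nat) T :=
  exists (n : nat) (M : closedSubspace X) (h : invariant_csub T M),
    csub_set M = range (iter n T) /\ Rcls i (restr h).

Definition gDMR (i : nat) T :=
  exists (M N : closedSubspace X) (hM : invariant_csub T M) (hN : invariant_csub T N),
    [/\ topological_sum M N, Rcls i (restr hM) & meromorphic (restr hN)].

Definition gKM T :=
  exists (M N : closedSubspace X) (hM : invariant_csub T M) (hN : invariant_csub T N),
    [/\ topological_sum M N, Kato (restr hM) & meromorphic (restr hN)].

End DecomposedClasses.

Definition boundary {U : topologicalType} (A : set U) : set U :=
  closure A `\` interior A.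

Definition iso {U : topologicalType} (A : set U) : set U :=
  A `\` limit_point A.

Definition infinite_dimensional {K : numFieldType}
  (X : completeNormedModType K) := dimension [set: X] = +oo%E.

(* Main.v *)
Require Import Defs.
From HB Require Import structures.
From mathcomp Require Import all_boot all_order all_algebra.
From mathcomp Require Import complex.
From mathcomp Require Import all_classical all_reals all_analysis.
From mathcomp Require Import ring lra.

Set Implicit Arguments.
Unset Strict Implicit.
Unset Printing Implicit Defensive.

Import Order.TTheory GRing.Theory Num.Theory.
Import numFieldNormedType.Exports.

Local Open Scope classical_set_scope.
Local Open Scope ring_scope.
Local Open Scope complex_scope.

(**
Membership in R_i of an operator with closed range depends only on its nullity
and deficiency.  By Kato's decomposition an operator of class R_i is the sum of
a Kato operator of class R_i and a finite-dimensional nilpotent one; moving the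
nilpotent part into the meromorphic summand, A in gDMR_i becomes A = A_M + A_N
with A_M Kato of class R_i and A_N meromorphic.  For small l the nullity and
the deficiency of A_M - l do not depend on l, and for l <> 0 the operator
A_N - l is invertible or has a pole at 0, hence is Drazin invertible.  So
A - l is in gDMR_i for all small l and in BR_i for all small l <> 0, and as
invertible A_N - l occur with l arbitrarily small, so do A - l in R_i.
Conversely let A = A_M + A_N with A_M Kato, A_N meromorphic and A - l in BR_i
for all small l <> 0.  Choose l with A_N - l bijective: then R((A - l)^k) is
R((A_M - l)^k) + N, and since the nullity and deficiency of a Kato operator do
not change when it is restricted to the range of a power, A_M - l and hence A_M
are in R_i.
*)

(** Every decomposition changes the space on which an operator acts. Hence nullity, deficiency and
    the Kato property are defined for a linear map of [X] on a subset [V] ([nul_ge], [def_ge],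
    [kato_on]), and subtypes matter only where a class R_i, [Kato] or meromorphy is read off.
    Dimensions occur as lower bounds by n: infinite values need no separate treatment, and an index
    inequality becomes an implication for all n. The open mapping theorem is proved once, for an
    abstract [gauge]; closed ranges, ranges of finite codimension and bounded projections are its
    three instances. Stability rests on a modulus [5 * C] that serves a whole disc: for each n the
    admissible step is then uniform, so finitely many steps lead from 0 to m. Moving a nilpotent
    part into the meromorphic summand keeps the poles, because near a non-zero point the resolvent
    of a nilpotent operator is a convergent power series, which is added to the Laurent series.
    Countability follows from (v), since the isolated points of any subset of the plane are
    countable. *)

Module Lmod.
Section Lmod.
Context {K : pzRingType} {V : lmodType K}.

(** Syntax for reflecting linear identities: vectors are atoms and scalars stay in [K], so that an
    identity between vectors splits into one scalar identity per atom. *)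
Inductive term := Var of nat | Zero | Add of term & term | Opp of term
  | Scale of K & term | Natmul of term & nat.

Fixpoint eval (env : seq V) t : V :=
  match t with
  | Var i => nth 0 env i
  | Zero => 0
  | Add t u => eval env t + eval env u
  | Opp t => - eval env t
  | Scale a t => a *: eval env t
  | Natmul t n => eval env t *+ n
  end.

(** Atoms are compared by [Nat.eqb], which [lmod_reduce] unfolds, so that coefficients at concrete
    indices compute to plain ring expressions. *)
Fixpoint coef t i : K :=
  match t with
  | Var j => if Nat.eqb i j then 1 else 0
  | Zero => 0
  | Add t u => coef t i + coef u i
  | Opp t => - coef t i
  | Scale a t => a * coef t i
  | Natmul t n => coef t i *+ n
  end.

Lemma evalE env t : eval env t = \sum_(i < size env) coef t i *: env`_i.
Proof.
elim: t => [j||t IHt u IHu|t IHt|a t IHt|t IHt n] /=; rewrite ?IHt ?IHu.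
(* A variable beyond the environment evaluates to the default 0, in agreement with a sum none of
   whose indices matches it. *)
- case: (ltnP j (size env)) => jn; last first.
    rewrite nth_default // big1 // => i _; case: PeanoNat.Nat.eqb_spec => [ij|_].
      by have := ltn_ord i; rewrite ij ltnNge jn.
    by rewrite scale0r.
  rewrite (bigD1 (Ordinal jn)) //= PeanoNat.Nat.eqb_refl scale1r big1 ?addr0 // => i ij.
  case: PeanoNat.Nat.eqb_spec => [eij|_]; last by rewrite scale0r.
  by case/eqP: ij; exact: val_inj.
- by rewrite big1 // => i _; rewrite scale0r.
- by rewrite -big_split; apply: eq_bigr => i _; rewrite scalerDl.
- by rewrite -sumrN; apply: eq_bigr => i _; rewrite scaleNr.
- by rewrite scaler_sumr; apply: eq_bigr => i _; rewrite scalerA.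
- by rewrite -sumrMnl; apply: eq_bigr => i _; rewrite scalerMnl.
Qed.

Fixpoint same t u n := if n is n'.+1 then coef t n' = coef u n' /\ same t u n' else True.

Lemma sameP env t u : same t u (size env) -> eval env t = eval env u.
Proof.
move=> tu; rewrite !evalE; apply: eq_bigr => i _; congr (_ *: _).
elim: (size env) i tu => [[]//|n IHn] i /= [tun tu].
have [ni|] := ltnP i n; first exact: (IHn (Ordinal ni)).
by move=> ni; have -> : nat_of_ord i = n by apply/eqP; rewrite eqn_leq ni -ltnS ltn_ord.
Qed.

End Lmod.
End Lmod.

(* vectors are compared up to conversion, as they may carry different
   canonical instances *)
Ltac lmod_index x env :=
  match env with
  | ?y :: _ => let _ := match constr:(Set) with _ => unify x y end in constr:(O)
  | _ :: ?env' => let n := lmod_index x env' in constr:(S n)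
  end.

Ltac lmod_mem x env :=
  match env with
  | ?y :: _ => let _ := match constr:(Set) with _ => unify x y end in constr:(true)
  | _ :: ?env' => lmod_mem x env'
  | _ => constr:(false)
  end.

Ltac lmod_vars t env :=
  lazymatch t with
  | (?a + ?b)%R => let env := lmod_vars a env in lmod_vars b env
  | (- ?a)%R => lmod_vars a env
  | (_ *: ?a)%R => lmod_vars a env
  | (?a *+ _)%R => lmod_vars a env
  | 0%R => env
  | _ => lazymatch lmod_mem t env with
         | true => env
         | false => constr:(t :: env)
         end
  end.

Ltac lmod_reify K t env :=
  lazymatch t with
  | (?a + ?b)%R => let a := lmod_reify K a env in let b := lmod_reify K b env in
                   constr:(@Lmod.Add K a b)
  | (- ?a)%R => let a := lmod_reify K a env in constr:(@Lmod.Opp K a)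
  | (?k *: ?a)%R => let a := lmod_reify K a env in constr:(@Lmod.Scale K k a)
  | (?a *+ ?n)%R => let a := lmod_reify K a env in constr:(@Lmod.Natmul K a n)
  | 0%R => constr:(@Lmod.Zero K)
  | _ => let i := lmod_index t env in constr:(@Lmod.Var K i)
  end.

(* leaves one scalar goal per vector of type V *)
Ltac lmod_reduce V :=
  lazymatch type of V with ?F ?K =>
  lazymatch goal with
  | |- ?t = ?u =>
    let env := lmod_vars t (@nil (GRing.Lmodule.sort V)) in
    let env := lmod_vars u env in
    let rt := lmod_reify K t env in
    let ru := lmod_reify K u env in
    refine (@Lmod.sameP K V env rt ru _); cbv beta iota zeta delta [Lmod.same Lmod.coef size Nat.eqb];
    repeat split
  end end.
Ltac lmod V := lmod_reduce V; try ring.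

(** * Real-valued norms and sequences *)

Section RealNorm.
Context {R : realType}.
Implicit Type V : normedModType R[i].

(** Norms take values in [R[i]], where the order is partial. The real part loses nothing, by
    [rnormE], and lands in [R], where [lra] and suprema apply. *)
Definition rnorm (V : normedZmodType R[i]) (x : V) : R := complex.Re `|x|.

Lemma rnormE (V : normedZmodType R[i]) (x : V) : `|x| = (rnorm x)%:C.
Proof. by rewrite /rnorm RRe_real // normr_real. Qed.

Lemma rnorm_ge0 (V : normedZmodType R[i]) (x : V) : 0 <= rnorm x.
Proof. by rewrite -ler0c -rnormE. Qed.

Lemma rnormD (V : normedZmodType R[i]) (x y : V) : rnorm (x + y) <= rnorm x + rnorm y.
Proof. by rewrite -lecR rmorphD /= -!rnormE ler_normD. Qed.

Lemma rnormN (V : normedZmodType R[i]) (x : V) : rnorm (- x) = rnorm x.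
Proof. by rewrite /rnorm normrN. Qed.

Lemma rnormB (V : normedZmodType R[i]) (x y : V) : rnorm (x - y) <= rnorm x + rnorm y.
Proof. by rewrite (le_trans (rnormD _ _)) // rnormN. Qed.

Lemma rnormC (V : normedZmodType R[i]) (x y : V) : rnorm (x - y) = rnorm (y - x).
Proof. by rewrite -rnormN opprB. Qed.

Lemma rnorm0 (V : normedZmodType R[i]) : rnorm (0 : V) = 0.
Proof. by rewrite /rnorm normr0. Qed.

Lemma rnorm_eq0 (V : normedZmodType R[i]) (x : V) : rnorm x = 0 -> x = 0.
Proof. by move=> x0; apply: normr0_eq0; rewrite rnormE x0. Qed.

Lemma rnorm_gt0 (V : normedZmodType R[i]) (x : V) : x <> 0 -> 0 < rnorm x.
Proof.
by move=> x0; rewrite lt_neqAle rnorm_ge0 andbT eq_sym; apply/eqP => /rnorm_eq0.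
Qed.

Lemma rnormZ V (a : R[i]) (x : V) : rnorm (a *: x) = rnorm a * rnorm x.
Proof. by apply: complexI; rewrite rmorphM /= -!rnormE normrZ. Qed.

Lemma rnormM (a b : R[i]) : rnorm (a * b) = rnorm a * rnorm b.
Proof. by apply: complexI; rewrite rmorphM /= -!rnormE normrM. Qed.

Lemma rnormX (a : R[i]) n : rnorm (a ^+ n) = rnorm a ^+ n.
Proof. by apply: complexI; rewrite rmorphXn /= -!rnormE normrX. Qed.

Lemma rnormV (a : R[i]) : rnorm a^-1 = (rnorm a)^-1.
Proof. by apply: complexI; rewrite fmorphV /= -!rnormE normfV. Qed.

Lemma rnorm1 : rnorm (1 : R[i]) = 1.
Proof. by rewrite /rnorm normr1. Qed.

Lemma rnorm_real (a : R) : rnorm a%:C = `|a|.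
Proof. by rewrite /rnorm normc_def /= expr0n addr0 sqrtr_sqr. Qed.

Lemma rnorm_sum (V : normedZmodType R[i]) I (r : seq I) (P : pred I) (F : I -> V) :
  rnorm (\sum_(i <- r | P i) F i) <= \sum_(i <- r | P i) rnorm (F i).
Proof.
elim/big_rec2: _ => [|i y x _ yx]; first by rewrite rnorm0.
by rewrite (le_trans (rnormD _ _)) // lerD2l.
Qed.

Lemma rnorm_tri (V : normedZmodType R[i]) (z x y : V) :
  rnorm (x - y) <= rnorm (x - z) + rnorm (z - y).
Proof. by rewrite (le_trans _ (rnormD _ _)) // addrA subrK. Qed.

Lemma le_rnorm_dist (V : normedZmodType R[i]) (x y : V) : rnorm x <= rnorm y + rnorm (x - y).
Proof. by rewrite (le_trans _ (rnormD _ _)) // addrCA subrr addr0. Qed.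

Lemma rnorm_Re (a : R[i]) : `|complex.Re a| <= rnorm a.
Proof. by rewrite -lecR -rnormE normc_ge_Re. Qed.

Lemma rnorm_Im (a : R[i]) : `|complex.Im a| <= rnorm a.
Proof.
have := rnorm_Re (a * 'i); rewrite ReiNIm normrN rnormM.
suff -> : rnorm ('i : R[i]) = 1 by rewrite mulr1.
by rewrite /rnorm normc_def /= expr0n add0r expr1n sqrtr1.
Qed.

Lemma rnorm_i : rnorm ('i : R[i]) = 1.
Proof. by rewrite /rnorm normc_def /= expr0n add0r expr1n sqrtr1. Qed.

Lemma rnorm_ReIm (a : R[i]) : rnorm a <= `|complex.Re a| + `|complex.Im a|.
Proof.
rewrite {1}[a]complexE (le_trans (rnormD _ _)) // rnormM rnorm_i mul1r.
by rewrite !rnorm_real.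
Qed.

End RealNorm.

(** * Sequential limits and completeness *)

Section Sequences.
Context {R : realType}.

(** Stated over a [normedZmodType], so that the same notion serves for vectors and for scalars in
    [R[i]]. *)
Definition seqcvg (V : normedZmodType R[i]) (u : nat -> V) (x : V) :=
  forall e : R, 0 < e -> exists N, forall n, (N <= n)%N -> rnorm (u n - x) < e.

Definition seqcauchy (V : normedZmodType R[i]) (u : nat -> V) :=
  forall e : R, 0 < e -> exists N, forall m n, (N <= m)%N -> (N <= n)%N ->
    rnorm (u m - u n) < e.

Definition seqcomplete (V : normedZmodType R[i]) :=
  forall u : nat -> V, seqcauchy u -> exists x, seqcvg u x.

Lemma lt_eps_le0 (a : R) : (forall e, 0 < e -> a <= e) -> a <= 0.
Proof.
move=> ae; rewrite leNgt; apply/negP => a0.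
have := ae (a / 2); rewrite divr_gt0 // => /(_ isT) h; lra.
Qed.

Lemma seqcvg_unique (V : normedZmodType R[i]) (u : nat -> V) x y :
  seqcvg u x -> seqcvg u y -> x = y.
Proof.
move=> ux uy; apply/subr0_eq/rnorm_eq0/le_anti; rewrite rnorm_ge0 andbT.
apply: lt_eps_le0 => e e0.
have [|N hN] := ux (e / 2); first by rewrite divr_gt0.
have [|M hM] := uy (e / 2); first by rewrite divr_gt0.
have := rnorm_tri (u (N + M)%N) x y; rewrite (rnormC x (u _)).
have := hN (N + M)%N (leq_addr _ _); have := hM (N + M)%N (leq_addl _ _).
move=> h1 h2 h3; lra.
Qed.

Lemma seqcvgD (V : normedZmodType R[i]) (u v : nat -> V) x y :
  seqcvg u x -> seqcvg v y -> seqcvg (fun n => u n + v n) (x + y).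
Proof.
move=> ux vy e e0.
have [|N hN] := ux (e / 2); first by rewrite divr_gt0.
have [|M hM] := vy (e / 2); first by rewrite divr_gt0.
exists (maxn N M) => n; rewrite geq_max => /andP[/hN h1 /hM h2].
rewrite opprD addrACA; have := rnormD (u n - x) (v n - y) => h3; lra.
Qed.

Lemma seqcvg_cst (V : normedZmodType R[i]) (x : V) : seqcvg (fun=> x) x.
Proof. by move=> e e0; exists 0%N => n _; rewrite subrr rnorm0. Qed.

Lemma seqcvg_dominated (V W : normedZmodType R[i]) (u : nat -> V) x (v : nat -> W) y (C : R) :
  (forall n, rnorm (v n - y) <= C * rnorm (u n - x)) -> seqcvg u x -> seqcvg v y.
Proof.
(* Dividing by [|C| + 1] covers every real [C], zero and negative values included. *)
move=> uv ux e e0; have C1 : 0 < `|C| + 1 by rewrite ltr_pwDr.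
have [|N hN] := ux (e / (`|C| + 1)); first by rewrite divr_gt0.
exists N => n /hN; rewrite ltr_pdivlMr // => h; apply: le_lt_trans (uv n) _.
apply: le_lt_trans h; rewrite mulrC ler_wpM2l ?rnorm_ge0 //.
have := ler_norm C => ?; lra.
Qed.

Lemma seqcvgN (V : normedZmodType R[i]) (u : nat -> V) x :
  seqcvg u x -> seqcvg (fun n => - u n) (- x).
Proof.
by apply: (@seqcvg_dominated _ _ _ _ _ _ 1) => n; rewrite mul1r -opprD rnormN.
Qed.

Lemma seqcvgB (V : normedZmodType R[i]) (u v : nat -> V) x y :
  seqcvg u x -> seqcvg v y -> seqcvg (fun n => u n - v n) (x - y).
Proof. by move=> ux /seqcvgN; exact: seqcvgD. Qed.

Lemma seqcvgZ (V : normedModType R[i]) (a : R[i]) (u : nat -> V) x :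
  seqcvg u x -> seqcvg (fun n => a *: u n) (a *: x).
Proof.
by apply: (@seqcvg_dominated _ _ _ _ _ _ (rnorm a)) => n; rewrite -scalerBr rnormZ.
Qed.

Lemma seqcvgZl (V : normedModType R[i]) (a : nat -> R[i]) b (x : V) :
  seqcvg a b -> seqcvg (fun n => a n *: x) (b *: x).
Proof.
by apply: (@seqcvg_dominated _ _ _ _ _ _ (rnorm x)) => n;
   rewrite -scalerBl rnormZ mulrC.
Qed.

Lemma seqcvg_shift (V : normedZmodType R[i]) (u : nat -> V) x k :
  seqcvg u x -> seqcvg (fun n => u (n + k)%N) x.
Proof.
move=> ux e /ux[N hN]; exists N => n Nn; apply: hN.
by rewrite (leq_trans Nn) ?leq_addr.
Qed.

Lemma seqcvg_eq (V : normedZmodType R[i]) (u v : nat -> V) x :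
  (forall n, u n = v n) -> seqcvg u x -> seqcvg v x.
Proof. by move=> uv ux e /ux[N hN]; exists N => n /hN; rewrite uv. Qed.

Lemma seqcvg_sum (V : normedZmodType R[i]) I (r : seq I) (u : I -> nat -> V) (x : I -> V) :
  (forall i, seqcvg (u i) (x i)) ->
  seqcvg (fun n => \sum_(i <- r) u i n) (\sum_(i <- r) x i).
Proof.
move=> ux; elim: r => [|i r IHr].
  by rewrite big_nil; apply: seqcvg_eq (@seqcvg_cst _ 0) => n; rewrite big_nil.
rewrite big_cons; apply: (seqcvg_eq _ (seqcvgD (ux i) IHr)) => n.
by rewrite big_cons.
Qed.

Lemma seqcvg_le (V : normedZmodType R[i]) (u : nat -> V) x (B : R) N :
  seqcvg u x -> (forall n, (N <= n)%N -> rnorm (u n) <= B) -> rnorm x <= B.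
Proof.
move=> ux uB; rewrite -subr_le0; apply: lt_eps_le0 => e /ux[M hM].
have := hM (N + M)%N (leq_addl _ _); have := uB (N + M)%N (leq_addr _ _).
have := le_rnorm_dist x (u (N + M)%N); rewrite rnormC => ? ? ?; lra.
Qed.

Lemma seqcvg_cauchy (V : normedZmodType R[i]) (u : nat -> V) x :
  seqcvg u x -> seqcauchy u.
Proof.
move=> ux e e0; have [|N hN] := ux (e / 2); first by rewrite divr_gt0.
exists N => m n /hN hm /hN hn; have := rnorm_tri x (u m) (u n).
rewrite (rnormC x) => ?; lra.
Qed.

Lemma seqcauchy_dominated (V W : normedZmodType R[i]) (u : nat -> V) (v : nat -> W) (C : R) :
  (forall m n, rnorm (v m - v n) <= C * rnorm (u m - u n)) ->
  seqcauchy u -> seqcauchy v.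
Proof.
move=> uv uc e e0; have C1 : 0 < `|C| + 1 by rewrite ltr_pwDr.
have [|N hN] := uc (e / (`|C| + 1)); first by rewrite divr_gt0.
exists N => m n Nm Nn; have := hN _ _ Nm Nn; rewrite ltr_pdivlMr // => h.
apply: le_lt_trans (uv m n) _.
apply: le_lt_trans h; rewrite mulrC ler_wpM2l ?rnorm_ge0 //.
have := ler_norm C => ?; lra.
Qed.

Lemma seqcauchyP (V : normedModType R[i]) (u : nat -> V) :
  seqcauchy u -> cauchy (u @ \oo).
Proof.
move=> uc; apply/cauchy_ballP => e e0.
have eE : e = (complex.Re e)%:C by rewrite RRe_real // gtr0_real.
have /uc[N hN] : 0 < complex.Re e by rewrite -ltcR -eE.
have uN : (u @ \oo) [set u n | n in [set n | (N <= n)%N]].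
  by exists N => // n /= Nn; exists n.
exists ([set u n | n in [set n | (N <= n)%N]], [set u n | n in [set n | (N <= n)%N]]).
  by [].
move=> [_ _] /= [[m /= Nm <-] [n /= Nn <-]].
by rewrite -ball_normE /= rnormE eE ltcR; exact: hN.
Qed.

Lemma cvg_seqcvg (V : normedModType R[i]) (u : nat -> V) x :
  u @ \oo --> x -> seqcvg u x.
Proof.
move=> /cvgrPdist_lt ux e e0.
have [|N _ hN] := ux e%:C; first by rewrite ltcR.
by exists N => n /hN /=; rewrite rnormE ltcR rnormC.
Qed.

Lemma seqcvg_cvg (V : normedModType R[i]) (u : nat -> V) x :
  seqcvg u x -> u @ \oo --> x.
Proof.
move=> ux; apply/cvgrPdist_lt => e e0.
have eE : e = (complex.Re e)%:C by rewrite RRe_real // gtr0_real.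
have /ux[N hN] : 0 < complex.Re e by rewrite -ltcR -eE.
by exists N => // n /= /hN; rewrite rnormC rnormE eE ltcR.
Qed.

Lemma banach_complete (X : completeNormedModType R[i]) : seqcomplete X.
Proof.
move=> u /seqcauchyP/cauchy_cvg uc; exists (lim (u @ \oo)).
exact: cvg_seqcvg.
Qed.

Lemma real_seq_complete (u : nat -> R) :
  (forall e : R, 0 < e -> exists N, forall m n, (N <= m)%N -> (N <= n)%N ->
    `|u m - u n| < e) ->
  exists x, forall e : R, 0 < e -> exists N, forall n, (N <= n)%N -> `|u n - x| < e.
Proof.
move=> uc; have /cauchy_cvg : cauchy (u @ \oo).
  apply/cauchy_ballP => e /uc[N hN].
  have uN : (u @ \oo) [set u n | n in [set n | (N <= n)%N]].
    by exists N => // n /= Nn; exists n.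
  exists ([set u n | n in [set n | (N <= n)%N]], [set u n | n in [set n | (N <= n)%N]]).
    by [].
  move=> [_ _] /= [[m /= Nm <-] [n /= Nn <-]].
  by rewrite -ball_normE /=; exact: hN.
move=> /cvgrPdist_lt ux; exists (lim (u @ \oo)) => e /ux[N _ hN].
by exists N => n /hN /=; rewrite distrC.
Qed.

Lemma complex_complete : seqcomplete R[i].
Proof.
move=> u uc.
have [|x hx] := @real_seq_complete (fun n => complex.Re (u n)).
  move=> e /uc[N hN]; exists N => m n Nm Nn.
  have := rnorm_Re (u m - u n); rewrite raddfB /=.
  by move/le_lt_trans; apply; exact: hN.
have [|y hy] := @real_seq_complete (fun n => complex.Im (u n)).
  move=> e /uc[N hN]; exists N => m n Nm Nn.
  have := rnorm_Im (u m - u n); rewrite raddfB /=.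
  by move/le_lt_trans; apply; exact: hN.
exists (x +i* y) => e e0.
have [|N hN] := hx (e / 2); first by rewrite divr_gt0.
have [|M hM] := hy (e / 2); first by rewrite divr_gt0.
exists (maxn N M) => n; rewrite geq_max => /andP[/hN h1 /hM h2].
have := rnorm_ReIm (u n - (x +i* y)); rewrite !raddfB /= => h; lra.
Qed.

Lemma archi_pow2 (C e : R) : 0 < e -> exists k, C / 2 ^+ k < e.
Proof.
move=> e0; have [k hk] : exists k : nat, `|C| / e < k%:R.
  exists (Num.bound (`|C| / e)); apply: archi_boundP.
  by rewrite divr_ge0 // ltW.
exists k; rewrite ltr_pdivrMr ?exprn_gt0 //.
move: hk; rewrite ltr_pdivrMr // => hk.
apply: le_lt_trans (ler_norm C) _; apply: lt_le_trans hk _.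
by rewrite mulrC ler_pM2l // -natrX ler_nat ltnW // ltn_expl.
Qed.

Lemma geo_series (V : normedZmodType R[i]) (x : nat -> V) (C : R) :
  seqcomplete V -> (forall k, rnorm (x k) <= C / 2 ^+ k) ->
  exists s, seqcvg (fun n => \sum_(k < n) x k) s /\
    forall n, rnorm (s - \sum_(k < n) x k) <= 2 * C / 2 ^+ n.
Proof.
move=> Vc xC; pose S n := \sum_(k < n) x k.
(* The bound is kept as a difference, because [C / 2^k] is exactly [2C / 2^k - 2C / 2^(k+1)] and the
   induction on [d] telescopes. *)
have SC m d : rnorm (S (m + d)%N - S m) <= 2 * C / 2 ^+ m - 2 * C / 2 ^+ (m + d).
  elim: d => [|d IHd]; first by rewrite addn0 !subrr rnorm0.
  rewrite addnS /S big_ord_recr /= addrAC; have := rnormD (S (m + d)%N - S m) (x (m + d)%N).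
  have := xC (m + d)%N; rewrite exprS invfM.
  rewrite /S in IHd *; move=> h1 h2; apply: le_trans h2 _.
  move: IHd h1; set t := (2 ^+ (m + d))^-1 => IHd h1.
  have -> : 2 * C * (2^-1 * t) = C * t by field.
  lra.
have C0 : 0 <= C by have := xC 0%N; rewrite expr0 divr1; apply: le_trans (rnorm_ge0 _).
have SC' m n : (m <= n)%N -> rnorm (S n - S m) <= 2 * C / 2 ^+ m.
  move=> /subnKC <-; apply: le_trans (SC _ _) _.
  by rewrite lerBlDr lerDl divr_ge0 ?mulr_ge0 ?exprn_ge0.
have [s Ss] : exists s, seqcvg S s.
  apply: Vc => e e0; have [N hN] := archi_pow2 (4 * C) e0; exists N => m n Nm Nn.
  have := rnorm_tri (S N) (S m) (S n); rewrite (rnormC (S N)).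
  have := SC' _ _ Nm; have := SC' _ _ Nn; move=> h1 h2 h3.
  have -> // : rnorm (S m - S n) < e.
  apply: le_lt_trans h3 _; apply: le_lt_trans hN; lra.
exists s; split=> // n; apply: (@seqcvg_le _ (fun m => S m - S n) _ _ n).
  by apply: seqcvgB => //; exact: seqcvg_cst.
by move=> m; exact: SC'.
Qed.

End Sequences.

(** * Closed sets and continuous operators through sequences and real bounds *)

Section ClosedContinuous.
Context {R : realType}.

Definition seqclosed (V : normedZmodType R[i]) (A : set V) :=
  forall u x, (forall n, A (u n)) -> seqcvg u x -> A x.

Lemma closedP (V : normedModType R[i]) (A : set V) : closed A <-> seqclosed A.
Proof.
split=> [Ac u x Au /seqcvg_cvg ux|Ac x Ax].
  by apply: (closed_cvg A) ux => //; exact: nearW.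
have /choice[u hu] : forall n : nat, exists y, A y /\ rnorm (y - x) < 2^-1 ^+ n.
  move=> n; have e0 : 0 < (2^-1 ^+ n : R)%:C by rewrite ltcR exprn_gt0.
  have [y [Ay]] := Ax _ (nbhsx_ballx x _ e0).
  by rewrite -ball_normE /= rnormE ltcR rnormC; exists y.
apply: (Ac u) => [n|e e0]; first by have [] := hu n.
have [N hN] := archi_pow2 1 e0; exists N => n Nn.
have [_ /lt_le_trans] := hu n; apply; apply: le_trans (ltW hN).
by rewrite mul1r -exprVn ler_wiXn2l //; lra.
Qed.

Definition opbounded (V W : normedZmodType R[i]) (f : V -> W) :=
  exists2 B : R, 0 < B & forall x, rnorm (f x) <= B * rnorm x.

Lemma continuousP (V W : normedModType R[i]) (f : {linear V -> W}) :
  continuous f <-> opbounded f.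
Proof.
split=> [|[B B0 fB]].
  move=> /linear_bounded_continuous/linear_boundedP/pinfty_ex_gt0[r r0 fr].
  have rE : r = (complex.Re r)%:C by rewrite RRe_real // gtr0_real.
  exists (complex.Re r); first by rewrite -ltcR -rE.
  by move=> x; rewrite -lecR rmorphM /= -rE -!rnormE.
apply: bounded_linear_continuous; apply/linear_boundedP.
near=> r => x; apply: (@le_trans _ _ (B%:C * `|x|)).
  by rewrite !rnormE -rmorphM /= lecR.
rewrite ler_wpM2r //; near: r; apply: nbhs_pinfty_ge.
by rewrite gtr0_real // ltcR.
Unshelve. all: by end_near. Qed.

Lemma opbounded_cvg (V W : normedModType R[i]) (f : {linear V -> W}) u x :
  opbounded f -> seqcvg u x -> seqcvg (fun n => f (u n)) (f x).
Proof.
move=> [B _ fB]; apply: (@seqcvg_dominated _ _ _ _ _ _ _ B) => n.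
by rewrite -linearB.
Qed.

End ClosedContinuous.

(** * Linear subspaces as sets *)

Section Subspaces.
Context {R : realType}.

Definition subspace (X : lmodType R[i]) (V : set X) :=
  [/\ V 0, forall x y, V x -> V y -> V (x + y) & forall a x, V x -> V (a *: x)].

Section Def.
Context {X : lmodType R[i]}.
Implicit Types V W : set X.

Lemma subspaceB V x y : subspace V -> V x -> V y -> V (x - y).
Proof. by case=> _ VD VZ Vx Vy; rewrite -scaleN1r; apply: VD => //; exact: VZ. Qed.

Lemma subspace_sum V I (r : seq I) (P : pred I) (F : I -> X) :
  subspace V -> (forall i, P i -> V (F i)) -> V (\sum_(i <- r | P i) F i).
Proof. by case=> V0 VD _ VF; elim/big_ind: _. Qed.

Lemma subspaceT : subspace [set: X]. Proof. by []. Qed.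

Lemma subspace0 : subspace [set (0 : X)].
Proof. by split=> // [x y -> ->|a x ->] /=; rewrite ?addr0 ?scaler0. Qed.

Lemma subspaceI V W : subspace V -> subspace W -> subspace (V `&` W).
Proof.
move=> [V0 VD VZ] [W0 WD WZ]; split=> // [x y [Vx Wx] [Vy Wy]|a x [Vx Wx]].
  by split; [exact: VD|exact: WD].
by split; [exact: VZ|exact: WZ].
Qed.

Definition setadd (V W : set X) : set X :=
  [set x | exists y z, [/\ V y, W z & x = y + z]].

Lemma subspace_add V W : subspace V -> subspace W -> subspace (setadd V W).
Proof.
move=> [V0 VD VZ] [W0 WD WZ]; split.
- by exists 0, 0; rewrite addr0.
- move=> _ _ [x [y [Vx Wy ->]]] [x' [y' [Vx' Wy' ->]]].
  by exists (x + x'), (y + y'); rewrite addrACA; split=> //; [exact: VD|exact: WD].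
- move=> a _ [x [y [Vx Wy ->]]].
  by exists (a *: x), (a *: y); rewrite scalerDr; split=> //; [exact: VZ|exact: WZ].
Qed.

Lemma setaddl V W : subspace W -> V `<=` setadd V W.
Proof. by move=> [W0 _ _] x Vx; exists x, 0; rewrite addr0. Qed.

Lemma setaddr V W : subspace V -> W `<=` setadd V W.
Proof. by move=> [V0 _ _] x Wx; exists 0, x; rewrite add0r. Qed.

Definition opker (Y : lmodType R[i]) (f : X -> Y) : set X := [set x | f x = 0].

Lemma subspace_ker (Y : lmodType R[i]) (f : {linear X -> Y}) : subspace (opker f).
Proof.
split; rewrite /opker /=; first by rewrite linear0.
  by move=> x y fx fy; rewrite linearD fx fy addr0.
by move=> a x fx; rewrite linearZ /= fx scaler0.
Qed.

Lemma subspace_image (Y : lmodType R[i]) (f : {linear X -> Y}) V :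
  subspace V -> subspace (f @` V).
Proof.
move=> [V0 VD VZ]; split; first by exists 0; rewrite ?linear0.
  by move=> _ _ [x Vx <-] [y Vy <-]; exists (x + y); [exact: VD|rewrite linearD].
by move=> a _ [x Vx <-]; exists (a *: x); [exact: VZ|rewrite linearZ].
Qed.

Lemma iter_additive (f : {linear X -> X}) n a x y :
  iter n f (a *: x + y) = a *: iter n f x + iter n f y.
Proof. by elim: n => //= n ->; rewrite linearP. Qed.

HB.instance Definition _ (f : {linear X -> X}) n :=
  GRing.isLinear.Build R[i] X X _ (iter n f) (iter_additive f n).

End Def.

Lemma opbounded_iter (X : normedModType R[i]) (f : {linear X -> X}) n :
  opbounded f -> opbounded (iter n f).
Proof.
move=> [B B0 fB]; elim: n => [|n [C C0 IHn]]; first by exists 1 => // x; rewrite mul1r.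
exists (B * C) => [|x]; first exact: mulr_gt0.
by rewrite iterS (le_trans (fB _)) // -mulrA ler_pM2l.
Qed.

End Subspaces.

(** * The open mapping theorem and relative dimension *)

Section OpenMapping.
Context {R : realType} {Y : completeNormedModType R[i]}.

(* P y r reads: y has a preimage of norm at most r *)
Record gauge (W : set Y) (P : Y -> R -> Prop) : Prop := Gauge {
  gauge_total : forall y, W y -> exists r, P y r ;
  gauge_sub : forall y r, P y r -> W y /\ 0 <= r;
  gauge_mono : forall y r s, P y r -> r <= s -> P y s ;
  gaugeD : forall y z r s, P y r -> P z s -> P (y + z) (r + s) ;
  gaugeZ : forall a y r, P y r -> P (a *: y) (rnorm a * r) ;
  gauge_series : forall (y : nat -> Y) s r, (forall k, P (y k) (r / 2 ^+ k)) ->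
    seqcvg (fun n => \sum_(k < n) y k) s -> P s (2 * r) }.

(* nested balls avoiding the closures of [P _ n] *)
Lemma gauge_baire W P : subspace W -> seqclosed W -> gauge W P ->
  exists y0 d n, [/\ W y0, 0 < d & forall y e, W y -> rnorm (y - y0) < d -> 0 < e ->
    exists2 y', P y' n & rnorm (y - y') < e].
Proof.
move=> Ws Wc gP; apply: contrapT => noball.
(* As no ball works, the half ball around the centre contains a point at positive distance from all
   [y'] with [P y' n]. The new radius is at most half of that distance. *)
have step (s : Y * R) n : W s.1 -> 0 < s.2 -> exists t : Y * R,
    [/\ W t.1, 0 < t.2, t.2 <= s.2 / 2, rnorm (t.1 - s.1) <= s.2 / 2 &
      forall y', P y' n -> t.2 <= rnorm (t.1 - y') / 2].
  case: s => y0 d /= Wy0 d0; apply: contrapT => not.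
  apply: noball; exists y0, (d / 2), n; split=> //; first by rewrite divr_gt0.
  move=> y e Wy yd e0; apply: contrapT => noy'; apply: not.
  exists (y, Num.min (d / 2) (e / 2)); split=> //=.
  - by rewrite lt_min !divr_gt0.
  - by rewrite ge_min lexx.
  - exact: ltW.
  move=> y' Py'; rewrite ge_min; apply/orP; right.
  rewrite ler_pM2r ?invr_gt0 // leNgt; apply/negP => ye.
  by apply: noy'; exists y'.
(* The state also carries the level to be avoided next, so that the k-th ball avoids level k. The
   dummy value for invalid states makes the step total, as [choice] requires. *)
have {}step (s : nat * (Y * R)) : exists t : nat * (Y * R), W s.2.1 -> 0 < s.2.2 ->
    t.1 = s.1.+1 /\ [/\ W t.2.1, 0 < t.2.2, t.2.2 <= s.2.2 / 2, rnorm (t.2.1 - s.2.1) <= s.2.2 / 2 &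
      forall y', P y' s.1%:R -> t.2.2 <= rnorm (t.2.1 - y') / 2].
  case: (pselect (W s.2.1 /\ 0 < s.2.2)) => [[Ws0 s0]|n].
    by have [t ht] := step s.2 s.1%:R Ws0 s0; exists (s.1.+1, t).
  by exists s => ? ?; case: n.
have [g hg] := choice step.
pose s k := iter k g (0%N, (0, 1)).
have sP k : W (s k).2.1 /\ 0 < (s k).2.2.
  elim: k => [|k [IH1 IH2]]; first by case: Ws.
  by have [_ []] := hg _ IH1 IH2.
have sn k : (s k).1 = k.
  by elim: k => // k IHk; have [+ _] := hg _ (sP k).1 (sP k).2; rewrite IHk.
have rk k : (s k).2.2 <= 1 / 2 ^+ k.
  elim: k => [|k IHk]; first by rewrite expr0 divr1.
  have [_ [_ _ h _ _]] := hg _ (sP k).1 (sP k).2.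
  rewrite /s /= -/(s k); apply: le_trans h _.
  by move: IHk; rewrite exprS invfM => ?; lra.
have dk k : rnorm ((s k.+1).2.1 - (s k).2.1) <= (s k).2.2 / 2.
  by have [_ []] := hg _ (sP k).1 (sP k).2.
have rS k : (s k.+1).2.2 <= (s k).2.2 / 2.
  by have [_ []] := hg _ (sP k).1 (sP k).2.
have yk k d : rnorm ((s (k + d)%N).2.1 - (s k).2.1) <= (s k).2.2 - (s (k + d)%N).2.2.
  elim: d => [|d IHd]; first by rewrite addn0 !subrr rnorm0.
  rewrite addnS; have := rnorm_tri (s (k + d)%N).2.1 (s (k + d).+1).2.1 (s k).2.1.
  have := dk (k + d)%N; have := rS (k + d)%N => ? ? ?; lra.
have [y ylim] : exists y, seqcvg (fun k => (s k).2.1) y.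
  apply: banach_complete => e e0; have [N hN] := archi_pow2 2 e0.
  exists N => m n /subnKC <- /subnKC <-.
  have := rnorm_tri (s N).2.1 (s (N + (m - N))%N).2.1 (s (N + (n - N))%N).2.1.
  rewrite (rnormC (s N).2.1); have := yk N (m - N)%N; have := yk N (n - N)%N.
  have := rk N; have := (sP (N + (n - N))%N).2; have := (sP (N + (m - N))%N).2.
  move=> ? ? ? ? ? ?; lra.
have yy k : rnorm (y - (s k).2.1) <= (s k).2.2.
  apply: (@seqcvg_le _ _ (fun n => (s n).2.1 - (s k).2.1) _ _ k).
    by apply: seqcvgB => //; exact: seqcvg_cst.
  move=> n /subnKC <-; apply: le_trans (yk _ _) _.
  by rewrite gerBl ltW //; exact: (sP _).2.
have Wy : W y by apply: Wc ylim => n; exact: (sP n).1.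
have [r Pr] := gauge_total gP Wy.
have [k rk'] : exists k : nat, r <= k%:R.
  exists (Num.bound `|r|); apply: le_trans (ler_norm r) _; apply: ltW.
  exact: archi_boundP.
have [_ [_ t0 _ _ ht]] := hg _ (sP k).1 (sP k).2.
(* The limit is within the radius of the centre of ball [k.+1], whereas everything of level k is at
   least two radii away from it. *)
have := ht y; rewrite sn => /(_ (gauge_mono gP Pr rk')).
have := yy k.+1; rewrite rnormC -/(s k.+1) => h1 h2.
have := (sP k.+1).2; rewrite /s /= in h1 h2 *; lra.
Qed.

(** Symmetry moves the ball given by [gauge_baire] to the origin, where points are approximated at
    level [n]. Scaling gives corrections at level [n / 2^k] for residuals of size [d / 2^k], and
    [gauge_series] adds them up to level [2 * n]. *)
Lemma gauge_bounded W P : subspace W -> seqclosed W -> gauge W P ->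
  exists2 C : R, 0 < C & forall y, W y -> P y (C * rnorm y).
Proof.
move=> Ws Wc gP; have [y0 [d [n [Wy0 d0 hd]]]] := gauge_baire Ws Wc gP.
have [_ WD WZ] := Ws.
have half : rnorm (2^-1 : R[i]) = 2^-1.
  by rewrite rnormV -[2]/(2%:R) -(rmorph_nat (real_complex R)) /= rnorm_real ger0_norm.
(* [y] is half the difference of [y0 + y] and [y0 - y], both in the ball; halving the difference of
   their approximations keeps level [n] and error [e]. *)
have approx y e : W y -> rnorm y < d -> 0 < e -> exists2 y', P y' n & rnorm (y - y') < e.
  move=> Wy yd e0.
  have [||y1 P1 h1] := hd (y0 + y) e _ _ e0; first exact: WD.
    by rewrite addrAC subrr add0r.
  have [||y2 P2 h2] := hd (y0 - y) e _ _ e0; first exact: subspaceB.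
    by rewrite addrAC subrr add0r rnormN.
  exists (2^-1 *: (y1 + (-1) *: y2)).
    have := gaugeZ gP (2^-1) (gaugeD gP P1 (gaugeZ gP (-1) P2)).
    by rewrite half rnormN rnorm1 mul1r; congr P; field.
  have -> : y - 2^-1 *: (y1 + -1 *: y2) = 2^-1 *: ((y0 + y - y1) - (y0 - y - y2)).
    by lmod_reduce Y; field.
  rewrite rnormZ half; have := rnormB (y0 + y - y1) (y0 - y - y2) => ?; lra.
have n0 : 0 <= n.
  have [|y' /(gauge_sub gP)[]//] := hd y0 1 Wy0 _ ltr01.
  by rewrite subrr rnorm0.
have step k y : exists y', W y -> rnorm y < d / 2 ^+ k ->
    P y' (n / 2 ^+ k) /\ rnorm (y - y') < d / 2 ^+ k.+1.
  case: (pselect (W y /\ rnorm y < d / 2 ^+ k)) => [[Wy yd]|no]; last first.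
    by exists 0 => ? ?; case: no.
  have p0 : 0 < (2 ^+ k : R) by rewrite exprn_gt0.
  have nk : rnorm ((2 ^+ k : R[i])) = 2 ^+ k.
    by rewrite -[2]/(2%:R) -(rmorph_nat (real_complex R)) -rmorphXn /= rnorm_real ger0_norm // ltW.
  have [|||y' Py' hy'] := approx ((2 ^+ k) *: y) (d / 2); first exact: WZ.
  - by rewrite rnormZ nk mulrC -ltr_pdivlMr.
  - by rewrite divr_gt0.
  exists ((2 ^+ k)^-1 *: y') => _ _; split.
    by have := gaugeZ gP (2 ^+ k)^-1 Py'; rewrite rnormV nk mulrC.
  have -> : y - (2 ^+ k)^-1 *: y' = (2 ^+ k)^-1 *: (2 ^+ k *: y - y').
    by rewrite scalerBr scalerA mulVf ?scale1r // expf_neq0.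
  rewrite rnormZ rnormV nk exprS invfM mulrA mulrC.
  by rewrite ltr_pM2r ?invr_gt0.
have [g hg] := choice (fun s : nat * Y => step s.1 s.2).
have main y : W y -> rnorm y < d -> P y (2 * n).
  move=> Wy yd.
  (* [z k] is the residual after k corrections; each correction halves its bound. *)
  pose z k := nat_rect (fun=> Y) y (fun k z => z - g (k, z)) k.
  have zP k : W (z k) /\ rnorm (z k) < d / 2 ^+ k.
    elim: k => [|k [IH1 IH2]]; first by rewrite expr0 divr1.
    have [/(gauge_sub gP)[Wg _] ?] := hg (k, z k) IH1 IH2.
    by split=> //; exact: subspaceB.
  apply: (gauge_series gP (y := fun k => g (k, z k))).
    by move=> k; have [] := hg (k, z k) (zP k).1 (zP k).2.
  have zE m : \sum_(k < m) g (k : nat, z k) - y = - z m.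
    elim: m => [|m IHm]; first by rewrite big_ord0 sub0r.
    by rewrite big_ord_recr /= addrAC IHm opprB addrC.
  move=> e e0; have [N hN] := archi_pow2 d e0; exists N => m Nm.
  rewrite zE rnormN; apply: lt_trans (zP m).2 _; apply: le_lt_trans hN.
  by rewrite ler_pM2l // lef_pV2 ?posrE ?exprn_gt0 // ler_eXn2l // ltr1n.
(* Rescaling [y] to norm [d / 2] costs the factor [2 * rnorm y / d] on level [2 * n]. The summand 1
   keeps the constant positive when [n] is 0. *)
have c0 : 0 < 4 * (n + 1) / d by rewrite divr_gt0 ?mulr_gt0 ?ltr_wpDl.
exists (4 * (n + 1) / d) => // y Wy.
case: (pselect (y = 0)) => [->|/rnorm_gt0 y0'].
  have := gaugeZ gP 0 (main 0 _ _); rewrite !scale0r !rnorm0 mul0r mulr0; apply.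
  - by case: Ws.
  - exact: d0.
pose a : R := d / (2 * rnorm y).
have a0 : 0 < a by rewrite divr_gt0 ?mulr_gt0.
have na : rnorm a%:C = a by rewrite rnorm_real gtr0_norm.
have := gaugeZ gP (a%:C)^-1 (main (a%:C *: y) _ _).
rewrite scalerA mulVf ?scale1r ?rnormV ?na; last first.
  by rewrite -(rmorph0 (real_complex R)) (inj_eq (@complexI _)) gt_eqF.
move=> h; apply: (gauge_mono gP (h _ _)).
- exact: WZ.
- rewrite rnormZ na /a invfM -mulrA -mulrA mulVf ?gt_eqF // mulr1; lra.
rewrite -subr_ge0 /a.
have -> : 4 * (n + 1) / d * rnorm y - (d / (2 * rnorm y))^-1 * (2 * n) = 4 * rnorm y / d.
  by field; rewrite !gt_eqF.
by rewrite divr_ge0 ?mulr_ge0 ?rnorm_ge0 // ltW.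
Qed.

End OpenMapping.

(** * Relative dimension of subspaces *)

Section RelativeDimension.
Context {R : realType} {X : lmodType R[i]}.
Implicit Types V W : set X.

Definition lspan n (e : 'I_n -> X) : set X :=
  [set x | exists c : 'rV[R[i]]_n, x = \sum_i c 0 i *: e i].

Definition indep_mod W n (e : 'I_n -> X) :=
  forall c : 'rV[R[i]]_n, W (\sum_i c 0 i *: e i) -> c = 0.

(** A lower bound for the dimension of V modulo its intersection with W, instead of the dimension
    itself. Equality of two dimensions, finite or not, becomes equivalence of these predicates for
    all n. *)
Definition qdim_ge V W n :=
  exists e : 'I_n -> X, (forall i, V (e i)) /\ indep_mod W e.

Lemma subspace_span n (e : 'I_n -> X) : subspace (lspan e).
Proof.
split=> [|x y [c ->] [d ->]|a x [c ->]].
- by exists 0; rewrite big1 // => i _; rewrite mxE scale0r.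
- exists (c + d); rewrite -big_split; apply: eq_bigr => i _.
  by rewrite mxE scalerDl.
- exists (a *: c); rewrite scaler_sumr; apply: eq_bigr => i _.
  by rewrite mxE scalerA.
Qed.

Lemma span_sub n (e : 'I_n -> X) V : subspace V -> (forall i, V (e i)) -> lspan e `<=` V.
Proof.
move=> Vs Ve _ [c ->]; apply: subspace_sum => // i _.
by case: Vs => _ _ VZ; exact: VZ.
Qed.

Lemma mem_span n (e : 'I_n -> X) i : lspan e (e i).
Proof.
exists (delta_mx 0 i); rewrite (bigD1 i) //= mxE !eqxx scale1r big1 ?addr0 // => j ij.
by rewrite mxE eqxx (negbTE ij) scale0r.
Qed.

(** The new coordinate sits at index 0, matching the extended families [oapp e x (unlift 0 j)] used
    below. *)
Definition row_cons n (a : R[i]) (c : 'rV[R[i]]_n) : 'rV_n.+1 :=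
  \row_j oapp (c 0) a (unlift 0 j).

Lemma sum_row_cons n a (c : 'rV[R[i]]_n) (x : X) (e : 'I_n -> X) :
  \sum_j row_cons a c 0 j *: oapp e x (unlift 0 j) = a *: x + \sum_i c 0 i *: e i.
Proof.
rewrite big_ord_recl mxE unlift_none /=; congr (_ + _).
by apply: eq_bigr => i _; rewrite mxE liftK.
Qed.

Lemma sum_rowZ n a (c : 'rV[R[i]]_n) (e : 'I_n -> X) :
  \sum_i (a *: c) 0 i *: e i = a *: \sum_i c 0 i *: e i.
Proof. by rewrite scaler_sumr; apply: eq_bigr => i _; rewrite mxE scalerA. Qed.

Lemma sum_rowB n (c d : 'rV[R[i]]_n) (e : 'I_n -> X) :
  \sum_i (c - d) 0 i *: e i = \sum_i c 0 i *: e i - \sum_i d 0 i *: e i.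
Proof. by rewrite -sumrB; apply: eq_bigr => i _; rewrite !mxE scalerBl. Qed.

Lemma row_cons0 n : row_cons 0 0 = 0 :> 'rV[R[i]]_n.+1.
Proof. by apply/rowP => j; rewrite !mxE; case: unlift => //= i; rewrite mxE. Qed.

Lemma row_consE n (c : 'rV[R[i]]_n.+1) : c = row_cons (c 0 0) (\row_i c 0 (lift 0 i)).
Proof.
by apply/rowP => j; rewrite mxE; case: unliftP => [i|] -> //=; rewrite mxE.
Qed.

Lemma row_cons_eq0 n a (c : 'rV[R[i]]_n) : row_cons a c = 0 -> a = 0 /\ c = 0.
Proof.
move=> /rowP ac0; split; first by have := ac0 0; rewrite !mxE unlift_none.
by apply/rowP => i; have := ac0 (lift 0 i); rewrite !mxE liftK.
Qed.

Lemma qdim_ge0 V W : qdim_ge V W 0.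
Proof.
by exists (fun i : 'I_0 => 0); split=> [[]//|c _]; apply/rowP => -[].
Qed.

Lemma qdim_geS V W n : subspace W -> qdim_ge V W n.+1 -> qdim_ge V W n.
Proof.
move=> Ws [e [Ve ie]]; exists (fun i => e (lift 0 i)); split=> // c Wc.
suff /row_cons_eq0[] : row_cons 0 c = 0 by [].
apply: ie; rewrite big_ord_recl mxE unlift_none scale0r add0r; by under eq_bigr do rewrite mxE liftK.
Qed.

Lemma qdim_ge_le V W m n : subspace W -> (m <= n)%N -> qdim_ge V W n -> qdim_ge V W m.
Proof.
move=> Ws /subnKC <-; elim: (n - m)%N => [|k IHk]; first by rewrite addn0.
by rewrite addnS => /(qdim_geS Ws).
Qed.

(** Steinitz exchange by rank: with m > n, the m by n coefficient matrix has a non-zero left kernel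
    vector, that is, a relation modulo W. *)
Lemma qdim_ge_span V W n m (e : 'I_n -> X) : subspace W ->
  (forall x, V x -> exists c : 'rV[R[i]]_n, W (x - \sum_i c 0 i *: e i)) ->
  qdim_ge V W m -> (m <= n)%N.
Proof.
move=> Ws eV [f [Vf indf]].
have /choice[A hA] : forall j : 'I_m, exists c : 'rV[R[i]]_n, W (f j - \sum_i c 0 i *: e i).
  by move=> j; exact: eV.
rewrite leqNgt; apply/negP => nm.
pose M : 'M[R[i]]_(m, n) := \matrix_(j, i) A j 0 i.
have /rowV0Pn[v /sub_kermxP vM v0] : kermx M != 0.
  by rewrite -mxrank_eq0 mxrank_ker subn_eq0 -ltnNge (leq_ltn_trans (rank_leq_col M)).
case/eqP: v0; apply: indf.
have -> : \sum_j v 0 j *: f j = \sum_j v 0 j *: (f j - \sum_i A j 0 i *: e i).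
  under [RHS]eq_bigr do rewrite scalerBr.
  rewrite sumrB -[LHS]subr0; congr (_ - _).
  under eq_bigr do rewrite scaler_sumr.
  rewrite exchange_big /= big1 // => i _.
  under eq_bigr do rewrite scalerA.
  rewrite -scaler_suml; have /rowP/(_ i) := vM; rewrite !mxE => vMi.
  rewrite [X in X *: _](_ : _ = 0) ?scale0r // -[RHS]vMi.
  by apply: eq_bigr => j _; rewrite mxE.
by apply: subspace_sum => // j _; case: Ws => _ _ WZ; apply: WZ; exact: hA.
Qed.

Lemma indep_mod_cons W n (e : 'I_n -> X) x : subspace W -> indep_mod W e ->
  ~ setadd (lspan e) W x -> indep_mod W (fun j : 'I_n.+1 => oapp e x (unlift 0 j)).
Proof.
move=> [W0 WD WZ] ie xn c; rewrite [c]row_consE sum_row_cons.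
set a := c 0 0; set d := \row_i _ => Wad.
have a0 : a = 0.
  apply: contrapT => /eqP a0; apply: xn.
  exists (\sum_i (- a^-1 *: d) 0 i *: e i), (a^-1 *: (a *: x + \sum_i d 0 i *: e i)).
  split; [by exists (- a^-1 *: d)|exact: WZ|].
  by rewrite sum_rowZ; lmod_reduce X; field.
rewrite a0 scale0r add0r in Wad.
by rewrite a0 (ie _ Wad) row_cons0.
Qed.

(** A largest independent family spans, since a vector outside its span plus W would extend it by
    [indep_mod_cons]. *)
Lemma qdim_ge_basis V W n : subspace V -> subspace W -> ~ qdim_ge V W n ->
  exists m (e : 'I_m -> X), [/\ (m < n)%N, forall i, V (e i), indep_mod W e,
     V `<=` setadd (lspan e) W & ~ qdim_ge V W m.+1].
Proof.
move=> Vs Ws; elim: n => [[]|n IHn nn]; first exact: qdim_ge0.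
case: (pselect (qdim_ge V W n)) => [[e [Ve ie]]|/IHn[m [e [mn ? ? ? ?]]]]; last first.
  by exists m, e; split=> //; exact: ltnW.
exists n, e; split=> // x Vx; apply: contrapT => xn; apply: nn.
exists (fun j : 'I_n.+1 => oapp e x (unlift 0 j)); split.
  by move=> j; case: unliftP => [i|] _ //=.
exact: indep_mod_cons.
Qed.

Lemma qdim_ge_self V W n : V `<=` W -> subspace W -> (0 < n)%N -> ~ qdim_ge V W n.
Proof.
case: n => // n VW Ws _ [e [Ve ie]].
have : lspan e (e 0) by exact: mem_span.
have : W (\sum_i (delta_mx 0 0 : 'rV[R[i]]_n.+1) 0 i *: e i).
  apply: subspace_sum => // i _; have [_ _ WZ] := Ws; apply: WZ; exact: VW.
by move=> /ie/rowP/(_ 0); rewrite !mxE !eqxx => /eqP; rewrite oner_eq0.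
Qed.

Lemma qdim_ge1 V W : subspace W -> ~ qdim_ge V W 1 <-> V `<=` W.
Proof.
move=> Ws; split=> [n1 x Vx|VW]; last exact: qdim_ge_self.
apply: contrapT => Wx; apply: n1; exists (fun=> x); split=> // c.
rewrite big_ord1 => Wc; apply/rowP => j; rewrite ord1 mxE; apply: contrapT => /eqP c0.
apply: Wx; have [_ _ /(_ (c 0 0)^-1 _ Wc)] := Ws.
by rewrite scalerA mulVf // scale1r.
Qed.

(** V modulo W is V' modulo W' plus the line of [x]. It serves to show that splitting off one Jordan
    chain lowers nullity and deficiency by exactly one. *)
Lemma qdim_ge_addone V V' W W' x n : subspace V' -> subspace W -> subspace W' ->
  V' `<=` V -> W' `<=` W -> V x ->
  (forall v, V v -> exists v' c w, [/\ V' v', W w & v = v' + c *: x + w]) ->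
  (forall v' c, V' v' -> W (v' + c *: x) -> W' v' /\ c = 0) ->
  qdim_ge V W n.+1 <-> qdim_ge V' W' n.
Proof.
move=> Vs' Ws Ws' VV WW Vx dec ind; split=> [nV|[e [Ve ie]]]; last first.
  exists (fun j : 'I_n.+1 => oapp e x (unlift 0 j)); split.
    by move=> j; case: unliftP => [i|] _ //=; exact: VV.
  move=> c; rewrite [c]row_consE sum_row_cons addrC.
  set a := c 0 0; set d := \row_i _ => /ind[|Wd a0].
    by apply: span_sub Ve _ _ => //; exists d.
  by rewrite a0 (ie _ Wd) row_cons0.
apply: contrapT => /(qdim_ge_basis Vs' Ws')[m [e [mn Ve ie eV _]]].
have : (n.+1 <= m.+1)%N; last by rewrite ltnNge mn.
apply: (qdim_ge_span (e := fun j : 'I_m.+1 => oapp e x (unlift 0 j)) Ws _ nV).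
move=> v /dec[v' [c [w [/eV[_ [w' [[d ->] Ww' ->]]] Ww ->]]]]; exists (row_cons c d).
rewrite sum_row_cons; set s := \sum_i _.
have -> : s + w' + c *: x + w - (c *: x + s) = w' + w by lmod X.
by have [_ WD _] := Ws; apply: WD => //; exact: WW.
Qed.

End RelativeDimension.

Section HasQdim.
Context {R : realType} {X : completeNormedModType R[i]}.
Implicit Types V W : set X.

(** Unique coordinates modulo W amount to an independent family of n vectors together with the
    impossibility of n+1. *)
Lemma has_qdimP V W n : subspace V -> subspace W ->
  has_qdim V W n <-> qdim_ge V W n /\ ~ qdim_ge V W n.+1.
Proof.
move=> Vs Ws; split=> [[e [Ve eV]]|[nV nV1]].
  split.
    exists e; split=> // c Wc; have [c' [_ uniq_c]] := eV 0 (let: And3 h _ _ := Vs in h).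
    rewrite -(uniq_c 0) ?(uniq_c c) //.
      by rewrite sub0r -scaleN1r; case: Ws => _ _; exact.
    by rewrite big1 ?subrr // => [|i _]; [case: Ws|rewrite mxE scale0r].
  move=> nV; suff : (n.+1 <= n)%N by rewrite ltnn.
  by apply: (qdim_ge_span (e := e) Ws _ nV) => x /eV[c [Wc _]]; exists c.
have [m [e [mn Ve ie eV nm]]] := qdim_ge_basis Vs Ws nV1.
have {}mn : m = n.
  apply/eqP; rewrite eqn_leq -ltnS mn leqNgt; apply/negP => mn'; apply: nm.
  exact: qdim_ge_le nV.
subst m; exists e; split=> // x /eV[_ [w [[c ->] Ww ->]]]; exists c.
split=> [|d Wd]; first by rewrite addrAC subrr add0r.
apply/eqP; rewrite -subr_eq0; apply/eqP/ie.
have := subspaceB Ws Wd Ww; rewrite [X in W X](_ : _ = \sum_i (c - d) 0 i *: e i) //.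
by rewrite sum_rowB; lmod X.
Qed.

End HasQdim.

(** * Closed ranges and closed sums *)

Section ClosedRange.
Context {R : realType} {X Y : completeNormedModType R[i]}.

Lemma seqclosed_series (Z : normedModType R[i]) (V : set Z) (x : nat -> Z) s :
  subspace V -> seqclosed V -> (forall k, V (x k)) ->
  seqcvg (fun n => \sum_(k < n) x k) s -> V s.
Proof. by move=> Vs Vc Vx; apply: Vc => n; apply: subspace_sum. Qed.

(** A quantitative closed range condition: for positive [C], the reduced minimum modulus of T on V
    is at least [1 / C]. *)
Definition modulus (T : X -> Y) (V : set X) (C : R) :=
  forall x, V x -> exists x', [/\ V x', T x' = T x & rnorm x' <= C * rnorm (T x)].

(** Here the gauge is the norm of a preimage in V; its series property is completeness of X with
    continuity of T. *)
Lemma open_mapping (T : {linear X -> Y}) V :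
  subspace V -> seqclosed V -> opbounded T -> seqclosed (T @` V) ->
  exists2 C, 0 < C & modulus T V C.
Proof.
move=> Vs Vc Tb TVc; have [V0 VD VZ] := Vs.
pose P y r := exists x, [/\ V x, T x = y & rnorm x <= r].
have gP : gauge (T @` V) P.
  split.
  - by move=> _ [x Vx <-]; exists (rnorm x), x.
  - move=> _ r [x [Vx <- xr]]; split; first by exists x.
    exact: le_trans (rnorm_ge0 x) xr.
  - by move=> y r s [x [Vx <- xr]] rs; exists x; split=> //; exact: le_trans rs.
  - move=> _ _ r s [x [Vx <- xr]] [x' [Vx' <- xr']]; exists (x + x').
    split; [exact: VD|by rewrite linearD|].
    by apply: le_trans (rnormD _ _) _; exact: lerD.
  - move=> a _ r [x [Vx <- xr]]; exists (a *: x).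
    split; [exact: VZ|by rewrite linearZ|].
    by rewrite rnormZ ler_wpM2l // rnorm_ge0.
  - move=> y s r /choice[x hx] ys.
    have [|s' [s'x s'r]] := @geo_series _ _ x r (@banach_complete _ X).
      by move=> k; have [] := hx k.
    exists s'; split.
    + by apply: seqclosed_series s'x => // k; have [] := hx k.
    + apply: seqcvg_unique ys; apply: seqcvg_eq (opbounded_cvg Tb s'x) => n.
      by rewrite linear_sum; apply: eq_bigr => k _; have [] := hx k.
    + by have := s'r 0%N; rewrite big_ord0 subr0 expr0 divr1.
have [C C0 hC] := gauge_bounded (subspace_image T Vs) TVc gP.
exists C => // x Vx; have [|x' [? ? ?]] := hC (T x); first by exists x.
by exists x'.
Qed.

(** Converse of [open_mapping]: the increments of a rapidly converging sequence in the range are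
    lifted with controlled norm, and the lifts are summed. *)
Lemma modulus_closed (T : {linear X -> Y}) V C :
  subspace V -> seqclosed V -> opbounded T -> 0 <= C -> modulus T V C ->
  seqclosed (T @` V).
Proof.
move=> Vs Vc Tb C0 mT u y uV uy; have [V0 VD VZ] := Vs.
(* Passing to terms within [1 / 2^k] of the limit makes the increments geometrically small. *)
have /choice[v hv] : forall k : nat, exists v, (T @` V) v /\ rnorm (v - y) <= 1 / 2 ^+ k.
  move=> k; have [|N hN] := uy (1 / 2 ^+ k); first by rewrite divr_gt0 ?exprn_gt0.
  by exists (u N); split; [exact: uV|exact/ltW/hN].
have dv k : rnorm (v k.+1 - v k) <= 2 / 2 ^+ k.
  have := rnorm_tri y (v k.+1) (v k); rewrite (rnormC y).
  have := (hv k).2; have := (hv k.+1).2; rewrite exprS invfM => h1 h2 h3.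
  have : 0 <= (2 ^+ k : R)^-1 by rewrite invr_ge0 exprn_ge0.
  move=> h4; lra.
have /choice[w hw] : forall k, exists w, [/\ V w, T w = v k.+1 - v k & rnorm w <= (C * 2) / 2 ^+ k].
  move=> k; have [[x Vx xv] _] := hv k; have [[x' Vx' xv'] _] := hv k.+1.
  have [|w [Vw Tw wC]] := mT (x' - x); first exact: subspaceB.
  rewrite linearB /= xv xv' in Tw wC.
  exists w; split=> //; apply: le_trans wC _.
  by rewrite -mulrA ler_wpM2l.
have [|s [ws _]] := @geo_series _ _ w (C * 2) (@banach_complete _ X).
  by move=> k; have [] := hw k.
have Vsum : V s by apply: seqclosed_series ws => // k; have [] := hw k.
have [[x0 Vx0 xv0] _] := hv 0%N.
exists (s + x0); first exact: VD.
have Ts := opbounded_cvg Tb ws.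
rewrite linearD /= xv0; apply/eqP; rewrite -subr_eq0 -addrA; apply/eqP.
have vy : seqcvg v y.
  move=> e e0; have [N hN] := archi_pow2 1 e0; exists N => n Nn.
  apply: le_lt_trans (hv n).2 _; apply: le_lt_trans hN.
  by rewrite ler_pM2l // lef_pV2 ?posrE ?exprn_gt0 // ler_eXn2l // ltr1n.
suff -> : T s = y - v 0%N by lmod Y.
apply: seqcvg_unique Ts _; apply: seqcvg_eq (seqcvgB vy (seqcvg_cst (v 0%N))) => n.
elim: n => [|n IHn]; first by rewrite big_ord0 linear0 subrr.
by rewrite big_ord_recr linearD -IHn /=; have [_ -> _] := hw n; lmod Y.
Qed.

(** The gauge bounds both parts of [y = T x + sum of c_i e_i]. The coordinates c modulo the range
    are therefore continuous; they vanish on the range and hence on its limits. *)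
Lemma finite_codim_closed (T : {linear X -> Y}) W V n (e : 'I_n -> Y) :
  subspace W -> seqclosed W -> subspace V -> seqclosed V -> opbounded T ->
  T @` W `<=` V -> (forall i, V (e i)) -> indep_mod (T @` W) e ->
  V `<=` setadd (lspan e) (T @` W) -> seqclosed (T @` W).
Proof.
move=> Ws Wc Vs Vc Tb TWV Ve ie VeT; have [W0 WD WZ] := Ws; have [V0 VD VZ] := Vs.
pose P y r := exists x (c : 'rV[R[i]]_n),
  [/\ W x, y = T x + \sum_i c 0 i *: e i, rnorm x <= r & forall i, rnorm (c 0 i) <= r].
have PV y r : P y r -> V y.
  move=> [x [c [Wx -> _ _]]]; apply: VD; first by apply: TWV; exists x.
  by apply: subspace_sum => // i _; exact: VZ.
have gP : gauge V P.
  split.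
  - move=> y /VeT[_ [_ [[c ->] [x Wx <-] ->]]].
    exists (rnorm x + \sum_i rnorm (c 0 i)), x, c; split=> //.
    + by rewrite addrC.
    + by rewrite lerDl sumr_ge0 // => i _; exact: rnorm_ge0.
    + move=> i; rewrite (bigD1 i) //= addrCA lerDl addr_ge0 ?rnorm_ge0 //.
      by rewrite sumr_ge0 // => j _; exact: rnorm_ge0.
  - move=> y r Pyr; split; first exact: PV Pyr.
    by case: Pyr => x [c [_ _ xr _]]; exact: le_trans (rnorm_ge0 x) xr.
  - move=> y r s [x [c [Wx -> xr cr]]] rs; exists x, c; split=> //; first exact: le_trans rs.
    by move=> i; exact: le_trans rs.
  - move=> y z r s [x [c [Wx -> xr cr]]] [x' [c' [Wx' -> xr' cr']]].
    exists (x + x'), (c + c'); split; first exact: WD.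
    + rewrite linearD /= addrACA -big_split; congr (_ + _).
      by apply: eq_bigr => i _; rewrite mxE scalerDl.
    + by apply: le_trans (rnormD _ _) _; exact: lerD.
    + by move=> i; rewrite mxE; apply: le_trans (rnormD _ _) _; exact: lerD.
  - move=> a y r [x [c [Wx -> xr cr]]]; exists (a *: x), (a *: c); split; first exact: WZ.
    + by rewrite sum_rowZ linearZ scalerDr.
    + by rewrite rnormZ ler_wpM2l // rnorm_ge0.
    + by move=> i; rewrite mxE rnormM ler_wpM2l // rnorm_ge0.
  - move=> y s r /choice[x /choice[c hxc]] ys.
    have [|s' [s'x s'r]] := @geo_series _ _ x r (@banach_complete _ X).
      by move=> k; have [] := hxc k.
    have /choice[d hd] : forall i : 'I_n, exists d,
        seqcvg (fun n => \sum_(k < n) c k 0 i) d /\ rnorm d <= 2 * r.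
      move=> i; have [|d [dc dr]] := @geo_series _ _ (fun k => c k 0 i) r (@complex_complete R).
        by move=> k; have [_ _ _] := hxc k; exact.
      by exists d; split=> //; have := dr 0%N; rewrite big_ord0 subr0 expr0 divr1.
    exists s', (\row_i d i); split.
    + by apply: seqclosed_series s'x => // k; have [] := hxc k.
    + apply: seqcvg_unique ys _.
      have lc : seqcvg (fun n => \sum_i (\sum_(k < n) c k 0 i) *: e i)
          (\sum_i (\row_i d i) 0 i *: e i).
        by apply: seqcvg_sum => i; rewrite mxE; apply: seqcvgZl; have [] := hd i.
      apply: seqcvg_eq (seqcvgD (opbounded_cvg Tb s'x) lc) => m.
      rewrite linear_sum /=.
      under [X in _ + X]eq_bigr do rewrite scaler_suml.
      rewrite exchange_big -big_split; apply: eq_bigr => k _ /=.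
      by have [_ ->] := hxc k.
    + by have := s'r 0%N; rewrite big_ord0 subr0 expr0 divr1.
    + by move=> i; rewrite mxE; have [] := hd i.
have [C C0 hC] := gauge_bounded Vs Vc gP.
move=> u y uTW uy.
have Vy : V y by apply: Vc uy => k; exact: TWV.
have [_ [_ [[c ->] [x Wx <-] yE]]] := VeT _ Vy.
suff c0 : c = 0.
  exists x => //; rewrite yE c0 [X in X + _]big1 ?add0r // => i _.
  by rewrite mxE scale0r.
apply/rowP => i; rewrite [RHS]mxE; apply/rnorm_eq0/le_anti.
rewrite rnorm_ge0 andbT; apply: lt_eps_le0 => eps eps0.
have [|N hN] := uy (eps / C); first by rewrite divr_gt0.
have [z Wz zu] := uTW N.
have [|x' [c' [Wx' yE' _ c'C]]] := hC (y - u N).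
  by apply: subspaceB => //; apply: TWV; exists z.
(* As [u N] lies in the range, [y] and [y - u N] have the same coordinates modulo the range, and the
   latter vector is small. *)
suff -> : c = c'.
  apply: le_trans (c'C i) _; rewrite -ler_pdivlMl // mulrC rnormC.
  exact/ltW/hN.
apply/eqP; rewrite -subr_eq0; apply/eqP/ie.
exists (z + x' - x); first by apply: subspaceB => //; exact: WD.
rewrite sum_rowB linearB linearD /= zu.
have -> : T x' = y - u N - \sum_i c' 0 i *: e i by rewrite yE'; lmod Y.
by rewrite yE; lmod Y.
Qed.

End ClosedRange.

(** * Closed sums and Riesz families *)

Section ClosedSums.
Context {R : realType} {X : completeNormedModType R[i]}.
Implicit Types V W M N : set X.

(** Boundedness of the projection onto M along N: the gauge of a vector is the norm of its
    M-component. *)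
Lemma direct_sum_bound M N : subspace M -> subspace N -> seqclosed M -> seqclosed N ->
  seqclosed (setadd M N) -> (forall x, M x -> N x -> x = 0) ->
  exists2 C : R, 0 < C & forall y z, M y -> N z -> rnorm y <= C * rnorm (y + z).
Proof.
move=> Ms Ns Mc Nc MNc MN0; have [M0 MD MZ] := Ms; have [N0 ND NZ] := Ns.
pose P x r := exists y z, [/\ M y, N z, x = y + z & rnorm y <= r].
have gP : gauge (setadd M N) P.
  split.
  - by move=> _ [y [z [My Nz ->]]]; exists (rnorm y), y, z.
  - move=> x r [y [z [My Nz -> yr]]]; split; first by exists y, z.
    exact: le_trans (rnorm_ge0 y) yr.
  - by move=> x r s [y [z [My Nz -> yr]]] rs; exists y, z; split=> //; exact: le_trans rs.
  - move=> _ _ r s [y [z [My Nz -> yr]]] [y' [z' [My' Nz' -> yr']]].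
    exists (y + y'), (z + z'); split; [exact: MD|exact: ND|by rewrite addrACA|].
    by apply: le_trans (rnormD _ _) _; exact: lerD.
  - move=> a _ r [y [z [My Nz -> yr]]]; exists (a *: y), (a *: z).
    split; [exact: MZ|exact: NZ|by rewrite scalerDr|].
    by rewrite rnormZ ler_wpM2l // rnorm_ge0.
  - move=> x s r /choice[y /choice[z h]] xs.
    have [|s' [s'y s'r]] := @geo_series _ _ y r (@banach_complete _ X).
      by move=> k; have [] := h k.
    exists s', (s - s'); split.
    + by apply: seqclosed_series s'y => // k; have [] := h k.
    + apply: (seqclosed_series (x := z) Ns Nc); first by move=> k; have [] := h k.
      apply: seqcvg_eq (seqcvgB xs s'y) => n; rewrite -sumrB; apply: eq_bigr => k _.
      by have [_ _ -> _] := h k; rewrite addrAC subrr add0r.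
    + by rewrite addrC subrK.
    + by have := s'r 0%N; rewrite big_ord0 subr0 expr0 divr1.
have [C C0 hC] := gauge_bounded (subspace_add Ms Ns) MNc gP.
exists C => // y z My Nz; have [|y' [z' [My' Nz' E yr]]] := hC (y + z).
  by exists y, z.
apply: le_trans yr; suff -> : y = y' by exact: lexx.
apply/eqP; rewrite -subr_eq0; apply/eqP/MN0; first exact: subspaceB.
by have -> : y - y' = z' - z; [rewrite -[y](addrK z) E; lmod X|exact: subspaceB].
Qed.

(** The bound makes the M-components of a convergent sequence Cauchy, so that both components
    converge. *)
Lemma seqclosed_add M N (C : R) : subspace M -> subspace N -> seqclosed M -> seqclosed N ->
  (forall y z, M y -> N z -> rnorm y <= C * rnorm (y + z)) -> seqclosed (setadd M N).
Proof.
move=> Ms Ns Mc Nc hC u x /choice[y /choice[z h]] ux.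
have [y' yy'] : exists y', seqcvg y y'.
  apply: banach_complete; apply: seqcauchy_dominated (seqcvg_cauchy ux) => m n.
  have [My Nz ->] := h m; have [My' Nz' ->] := h n.
  rewrite opprD addrACA; apply: hC; exact: subspaceB.
exists y', (x - y'); split.
- by apply: Mc yy' => n; have [] := h n.
- apply: (Nc z); first by move=> n; have [] := h n.
  apply: seqcvg_eq (seqcvgB ux yy') => n; have [_ _ ->] := h n.
  by rewrite addrAC subrr add0r.
- by rewrite addrC subrK.
Qed.

Lemma dist_gt0 W x : seqclosed W -> ~ W x ->
  exists2 d : R, 0 < d & forall w, W w -> d <= rnorm (x - w).
Proof.
move=> Wc Wx; apply: contrapT => no; apply: Wx.
have /choice[w hw] : forall k : nat, exists w, W w /\ rnorm (x - w) < 1 / 2 ^+ k.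
  move=> k; apply: contrapT => nw; apply: no; exists (1 / 2 ^+ k).
    by rewrite divr_gt0 ?exprn_gt0.
  by move=> w Ww; rewrite leNgt; apply/negP => xw; apply: nw; exists w.
apply: (Wc w) => [k|e e0]; first by have [] := hw k.
have [N hN] := archi_pow2 1 e0; exists N => n Nn; rewrite rnormC.
apply: lt_trans (hw n).2 _; apply: le_lt_trans hN.
by rewrite ler_pM2l // lef_pV2 ?posrE ?exprn_gt0 // ler_eXn2l // ltr1n.
Qed.

Lemma dist_line W x : subspace W -> seqclosed W -> ~ W x ->
  exists2 d : R, 0 < d & forall a w, W w -> rnorm a * d <= rnorm (a *: x + w).
Proof.
move=> [W0 WD WZ] Wc Wx; have [d d0 hd] := dist_gt0 Wc Wx; exists d => // a w Ww.
have [->|a0] := eqVneq a 0; first by rewrite rnorm0 mul0r rnorm_ge0.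
have -> : a *: x + w = a *: (x - (- a^-1 *: w)) by lmod_reduce X; field.
by rewrite rnormZ ler_wpM2l ?rnorm_ge0 // hd //; exact: WZ.
Qed.

Definition line x : set X := [set y | exists a, y = a *: x].

Lemma subspace_line x : subspace (line x).
Proof.
split=> [|y z [a ->] [b ->]|a y [b ->]].
- by exists 0; rewrite scale0r.
- by exists (a + b); rewrite scalerDl.
- by exists (a * b); rewrite scalerA.
Qed.

Lemma seqclosed_add_line W x : subspace W -> seqclosed W -> seqclosed (setadd (line x) W).
Proof.
move=> Ws Wc; case: (pselect (W x)) => Wx.
  move=> u y uW uy; apply: setaddr; first exact: subspace_line.
  apply: Wc uy => n; have [_ [w [[a ->] Ww ->]]] := uW n.
  by have [_ WD WZ] := Ws; apply: WD => //; exact: WZ.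
have [d d0 hd] := dist_line Ws Wc Wx.
move=> u y /choice[ax /choice[w hw]] uy.
have /choice[a ha] : forall n, exists a, u n = a *: x + w n.
  by move=> n; have [[a ->] _ ->] := hw n; exists a.
have Ww n : W (w n) by have [] := hw n.
(* [dist_line] controls the coefficient of [x] by the norm of the sum. *)
have [b ab] : exists b, seqcvg a b.
  apply: complex_complete; apply: (@seqcauchy_dominated _ _ _ u _ d^-1) (seqcvg_cauchy uy) => m n.
  rewrite mulrC ler_pdivlMr // !ha.
  have -> : a m *: x + w m - (a n *: x + w n) = (a m - a n) *: x + (w m - w n) by lmod X.
  by apply: hd; exact: subspaceB.
exists (b *: x), (y - b *: x); split; [by exists b| |by rewrite addrC subrK].
apply: (Wc w) => //; apply: seqcvg_eq (seqcvgB uy (seqcvgZl x ab)) => n.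
by rewrite ha addrAC subrr add0r.
Qed.

Lemma seqclosed_add_span W n (e : 'I_n -> X) :
  subspace W -> seqclosed W -> seqclosed (setadd (lspan e) W).
Proof.
elim: n e W => [|n IHn] e W Ws Wc.
  suff -> : setadd (lspan e) W = W by [].
  apply/seteqP; split=> [_ [_ [w [[c ->] Ww ->]]]|]; first by rewrite big_ord0 add0r.
  by apply: setaddr; exact: subspace_span.
suff -> : setadd (lspan e) W = setadd (lspan (fun i => e (lift 0 i))) (setadd (line (e 0)) W).
  apply: IHn; first by apply: subspace_add => //; exact: subspace_line.
  exact: seqclosed_add_line.
apply/seteqP; split=> [_ [_ [w [[c ->] Ww ->]]]|_ [_ [_ [[c ->] [_ [w [[a ->] Ww ->]]] ->]]]].
  exists (\sum_i (\row_j c 0 (lift 0 j)) 0 i *: e (lift 0 i)), (c 0 0 *: e 0 + w); split.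
  - by exists (\row_j c 0 (lift 0 j)).
  - by exists (c 0 0 *: e 0), w; split=> //; exists (c 0 0).
  - by rewrite big_ord_recl; under [in RHS]eq_bigr do rewrite mxE; lmod X.
exists (\sum_i row_cons a c 0 i *: e i), w; split=> //; first by exists (row_cons a c).
rewrite big_ord_recl mxE unlift_none /=; under [in RHS]eq_bigr do rewrite mxE liftK /=.
by lmod X.
Qed.

(* Riesz's lemma, iterated: the lower bound only depends on the number of vectors. *)
Lemma riesz_basis n : exists2 b : R, 0 < b & forall V W, subspace V -> subspace W ->
  seqclosed W -> W `<=` V -> qdim_ge V W n ->
  exists e : 'I_n -> X, [/\ forall i, V (e i), forall i, rnorm (e i) <= 1 &
    forall (c : 'rV[R[i]]_n) w, W w ->
      b * (\sum_i rnorm (c 0 i)) <= rnorm (\sum_i c 0 i *: e i - w)].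
Proof.
elim: n => [|n [b b0 IHn]].
  exists 1 => // V W Vs Ws Wc WV _; exists (fun=> 0); split=> [[]//|[]//|c w Ww].
  by rewrite !big_ord0 mulr0 rnorm_ge0.
(* With D the norm to be bounded below, the new coefficient is at most [2 * D] and the old ones sum
   to at most [3 * D / b]; hence the constant [2 + 3 / b]. *)
have b1 : 0 < 2 + 3 / b by rewrite addr_gt0 ?divr_gt0.
exists (2 + 3 / b)^-1; first by rewrite invr_gt0.
move=> V W Vs Ws Wc WV nV; have [V0 VD VZ] := Vs.
have [e [Ve e1 eb]] := IHn V W Vs Ws Wc WV (qdim_geS Ws nV).
pose F := setadd (lspan e) W.
have Fs : subspace F by apply: subspace_add => //; exact: subspace_span.
have Fc : seqclosed F by exact: seqclosed_add_span.
have FV : F `<=` V.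
  by move=> _ [y [w [ye Ww ->]]]; apply: VD; [exact: span_sub ye|exact: WV].
have [v0 Vv0 Fv0] : exists2 v0, V v0 & ~ F v0.
  apply: contrapT => no; have : (n.+1 <= n)%N; last by rewrite ltnn.
  apply: (qdim_ge_span (e := e) Ws _ nV) => x Vx; apply: contrapT => nx; apply: no; exists x => //.
  by move=> [_ [w [[c ->] Ww xE]]]; apply: nx; exists c; rewrite xE addrAC subrr add0r.
have [d d0 hd] := dist_gt0 Fc Fv0.
pose E := [set r | exists2 f, F f & r = rnorm (v0 - f)].
have Einf : has_inf E.
  split; first by exists (rnorm (v0 - 0)), 0; [case: Fs|].
  by exists d => _ [f Ff ->]; exact: hd.
have dE : d <= inf E by apply: lb_le_inf => [|_ [f Ff ->]]; [case: Einf|exact: hd].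
have Epos : 0 < inf E by exact: lt_le_trans dE.
have [_ [f0 Ff0 ->] hf0] := inf_adherent Epos Einf.
have f0E f : F f -> rnorm (v0 - f0) <= 2 * rnorm (v0 - f).
  move=> Ff; have : inf E <= rnorm (v0 - f).
    by apply: ge_inf; [case: Einf|exists f].
  move=> ?; lra.
have r0 : 0 < rnorm (v0 - f0) by apply: lt_le_trans (hd _ Ff0).
pose r := rnorm (v0 - f0).
have nr : rnorm (r^-1)%:C = r^-1 by rewrite rnorm_real gtr0_norm // invr_gt0.
pose v := (r^-1)%:C *: (v0 - f0).
have Vv : V v by apply: VZ; apply: subspaceB => //; exact: FV.
have v1 : rnorm v = 1 by rewrite rnormZ nr mulVf // gt_eqF.
have vF f : F f -> 1 / 2 <= rnorm (v - f).
  move=> Ff; have -> : v - f = (r^-1)%:C *: (v0 - (f0 + r%:C *: f)).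
    rewrite /v; have rr : (r^-1)%:C * r%:C = 1 :> R[i].
      by rewrite -rmorphM /= mulVf ?rmorph1 // gt_eqF.
    by rewrite -[f in LHS]scale1r -rr; lmod X.
  rewrite rnormZ nr [leRHS]mulrC ler_pdivlMr //; have := f0E (f0 + r%:C *: f).
  rewrite -/r => h; have : F (f0 + r%:C *: f) by have [_ FD FZ] := Fs; apply: FD => //; exact: FZ.
  by move=> /h ?; lra.
exists (fun j => oapp e v (unlift 0 j)); split.
- by move=> j; case: unliftP => [i|] _ //=.
- by move=> j; case: unliftP => [i|] _ //=; rewrite v1.
move=> c w Ww; rewrite [c]row_consE sum_row_cons big_ord_recl.
under eq_bigr do rewrite mxE liftK /=.
rewrite mxE unlift_none /=; set a := c 0 0; set c' := \row_i _.
set s := \sum_i _; set D := (X in _ <= X).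
have aD : rnorm a / 2 <= D.
  have [->|a0] := eqVneq a 0; first by rewrite rnorm0 mul0r rnorm_ge0.
  have := vF (- a^-1 *: (\sum_i c' 0 i *: e i - w)); rewrite /D.
  have -> : a *: v + \sum_i c' 0 i *: e i - w = a *: (v - (- a^-1 *: (\sum_i c' 0 i *: e i - w))).
    by lmod_reduce X; field.
  rewrite rnormZ => h.
  have : F (- a^-1 *: (\sum_i c' 0 i *: e i - w)).
    have [_ _ FZ] := Fs; apply: FZ; exists (\sum_i c' 0 i *: e i), (- w); split=> //.
      by exists c'.
    by have [_ _ WZ] := Ws; rewrite -scaleN1r; exact: WZ.
  move=> /h h'; have := ler_wpM2l (rnorm_ge0 a) h'; lra.
have sD : b * s <= D + rnorm a.
  have := eb c' w Ww; rewrite -/s => h; apply: le_trans h _.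
  have -> : \sum_i c' 0 i *: e i - w = (a *: v + \sum_i c' 0 i *: e i - w) - a *: v.
    by lmod X.
  by apply: le_trans (rnormB _ _) _; rewrite rnormZ v1 mulr1.
rewrite mulrC ler_pdivrMr //.
have -> : D * (2 + 3 / b) = 2 * D + (3 * D) / b by field; rewrite gt_eqF.
apply: lerD; first by lra.
rewrite ler_pdivlMr // mulrC; lra.
Qed.

End ClosedSums.

(** * Stability of Kato operators *)

Section KatoOn.
Context {R : realType} {X : completeNormedModType R[i]}.
Implicit Types (V : set X) (f : X -> X).

Definition nul_ge f V n := qdim_ge (V `&` opker f) [set 0] n.

Definition def_ge f V n := qdim_ge V (f @` V) n.

Definition kato_on f V :=
  seqclosed (f @` V) /\ forall n x, V x -> f x = 0 -> (iter n f @` V) x.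

Definition stable f V := forall x, V x -> V (f x).

Lemma stable_iter f V n : stable f V -> stable (iter n f) V.
Proof. by move=> fV x Vx; elim: n => //= n; exact: fV. Qed.

Lemma subspace_nul (T : {linear X -> X}) V : subspace V -> subspace (V `&` opker T).
Proof. by move=> Vs; apply: subspaceI => //; exact: subspace_ker. Qed.

Lemma opbounded_shift (T : {linear X -> X}) m : opbounded T -> opbounded (shift_op T m).
Proof.
move=> [B B0 TB]; exists (B + rnorm m); first by rewrite ltr_pwDl ?rnorm_ge0.
move=> x; rewrite mulrDl -rnormZ; apply: le_trans (rnormB _ _) _.
by rewrite lerD2r.
Qed.

Lemma stable_shift (T : {linear X -> X}) V m :
  subspace V -> stable T V -> stable (shift_op T m) V.
Proof.
move=> Vs TV x Vx; apply: (subspaceB Vs); first exact: TV.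
by have [_ _ VZ] := Vs; exact: VZ.
Qed.

Lemma shift_op0 (T : {linear X -> X}) : shift_op T 0 = T :> (X -> X).
Proof. by apply/funext => x; change (T x - 0 *: x = T x); rewrite scale0r subr0. Qed.

Lemma shift_opD (T : {linear X -> X}) a b :
  shift_op (shift_op T a) b = shift_op T (a + b) :> (X -> X).
Proof.
apply/funext => x; change (T x - a *: x - b *: x = T x - (a + b) *: x).
by lmod X.
Qed.

Lemma shift_opE (T : {linear X -> X}) a x : shift_op T a x = T x - a *: x.
Proof. by []. Qed.

End KatoOn.

Section KatoStability.
Context {R : realType} {X : completeNormedModType R[i]}.
Variables (T : {linear X -> X}) (V : set X) (C : R).
Hypotheses (Vs : subspace V) (Vc : seqclosed V) (Tb : opbounded T) (TV : stable T V).
Hypotheses (TK : kato_on T V) (C0 : 0 < C) (mT : modulus T V C).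

(** The hyper-range of T on V. By the Kato property it contains the kernel, and T maps it onto
    itself. *)
Let core := [set x | V x /\ forall n, (iter n T @` V) x].

Let core_ker x : V x -> T x = 0 -> core x.
Proof. by move=> Vx Tx; split=> // n; exact: TK.2. Qed.

Let core_lift y : core y -> exists x, [/\ core x, T x = y & rnorm x <= C * rnorm y].
Proof.
move=> [Vy yT]; have [x0 Vx0 x0y] := yT 1%N.
have [x [Vx xx0 xC]] := mT Vx0; rewrite /= in x0y; rewrite x0y in xx0 xC.
exists x; split=> //; split=> // n; have [y' Vy' y'y] := yT n.+1.
have [_ VD _] := Vs.
(* Two preimages of [y] differ by a kernel element, which lies in the range of every power. So the
   preimage of controlled norm stays in the core. *)
have [||z Vz zx] := TK.2 n (x - iter n T y').
- by apply: (subspaceB Vs) => //; exact: stable_iter.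
- by rewrite linearB /= xx0 -y'y subrr.
by exists (z + y'); [exact: VD|rewrite linearD /= zx subrK].
Qed.

(** A backward Neumann series: choose [x_0 = y] and [T x_(k+1) = x_k] in the core, and sum
    [m^k x_(k+1)]. The condition on [m] makes the ratio 1/2. *)
Let core_solve m y : C * rnorm m <= 1 / 2 -> core y ->
  exists x, [/\ core x, shift_op T m x = y & rnorm x <= 2 * C * rnorm y].
Proof.
move=> Cm cy.
have /choice[g hg] : forall y, exists x,
    core y -> [/\ core x, T x = y & rnorm x <= C * rnorm y].
  move=> y'; case: (pselect (core y')) => [/core_lift[x hx]|n]; first by exists x.
  by exists 0.
pose x k := iter k g y.
have xc k : core (x k) by elim: k => //= k /hg[].
have Tx k : T (x k.+1) = x k by have [] := hg _ (xc k).
have xC k : rnorm (x k) <= C ^+ k * rnorm y.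
  elim: k => [|k IHk]; first by rewrite expr0 mul1r.
  have [_ _ h] := hg _ (xc k); apply: le_trans h _.
  by rewrite exprS -mulrA ler_pM2l.
have tC j k : rnorm (m ^+ k *: x (k + j.+1)%N) <= (C ^+ j.+1 * rnorm y) / 2 ^+ k.
  rewrite rnormZ rnormX; apply: le_trans (ler_wpM2l _ (xC _)) _.
    by rewrite exprn_ge0 // rnorm_ge0.
  have -> : rnorm m ^+ k * (C ^+ (k + j.+1) * rnorm y) =
      C ^+ j.+1 * rnorm y * (C * rnorm m) ^+ k by rewrite exprD exprMn; ring.
  rewrite ler_wpM2l ?mulr_ge0 ?exprn_ge0 ?rnorm_ge0 ?(ltW C0) // -exprVn.
  by rewrite lerXn2r ?nnegrE ?mulr_ge0 ?rnorm_ge0 ?(ltW C0) //; lra.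
(* All shifted series [s_j] are needed: T maps [s_(j+1)] to [s_j], which puts [s_0] in the range of
   every power. *)
have /choice[s hs] : forall j, exists s,
    seqcvg (fun n => \sum_(k < n) m ^+ k *: x (k + j.+1)%N) s /\
    rnorm s <= 2 * (C ^+ j.+1 * rnorm y).
  move=> j; have [s [s1 s2]] := geo_series (@banach_complete _ X) (tC j).
  by exists s; split=> //; have := s2 0%N; rewrite big_ord0 subr0 expr0 divr1.
have Vx k : V (x k) by have [] := xc k.
have VZ : forall a z, V z -> V (a *: z) by case: Vs.
have Vsj j : V (s j).
  apply: (seqclosed_series (x := fun k => m ^+ k *: x (k + j.+1)%N) Vs Vc) (hs j).1.
  by move=> k; exact: VZ.
have Tsj j : T (s j.+1) = s j.
  apply: seqcvg_unique (opbounded_cvg Tb (hs j.+1).1) _.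
  apply: seqcvg_eq (hs j).1 => n; rewrite linear_sum; apply: eq_bigr => k _.
  by rewrite linearZ /= [(k + j.+2)%N]addnS Tx.
exists (s 0%N); split.
- split=> // n; exists (s n) => //.
  by elim: n => // n IHn; rewrite iterSr Tsj.
- rewrite shift_opE; apply/eqP; rewrite subr_eq; apply/eqP.
  apply: seqcvg_unique (@seqcvg_shift _ _ _ _ 1 (opbounded_cvg Tb (hs 0%N).1)) _.
  apply: seqcvg_eq (seqcvgD (seqcvg_cst y) (seqcvgZ m (hs 0%N).1)) => n.
  rewrite scaler_sumr [(n + 1)%N]addn1 big_ord_recl linearD linear_sum expr0 scale1r.
  congr (_ + _); first exact: (esym (Tx 0%N)).
  apply: eq_bigr => k _; rewrite scalerA -exprS [RHS]linearZ; congr (_ *: _).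
  exact: (esym (Tx (k + 1)%N)).
- by have [_] := hs 0%N; rewrite expr1 mulrA.
Qed.

(** One step replaces [u] by [u'] with the same value and norm at most
    [rnorm u / 2 + 2 * C * rnorm (S u)]. Iteration makes the first term as small as
    [C * rnorm (S u)] and the second at most [4 * C * rnorm (S u)], whence [5 * C]. *)
Lemma modulus_shift m : C * rnorm m <= 1 / 8 -> modulus (shift_op T m) V (5 * C).
Proof.
move=> Cm; have [V0 VD VZ] := Vs; set S := shift_op T m.
have step u : V u -> exists u', [/\ V u', S u' = S u &
    rnorm u' <= rnorm u / 2 + 2 * C * rnorm (S u)].
  (* With [T w = T u], the error is [S w - S u = m (u - w)]. It lies in the core, since [u - w] is
     in the kernel, and [core_solve] corrects it. *)
  move=> Vu; have [w [Vw wu wC]] := mT Vu.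
  have [||v [[Vv _] Sv vC]] := @core_solve m (m *: (u - w)).
  - lra.
  - have : core (u - w).
      by apply: core_ker; [exact: subspaceB|rewrite linearB /= wu subrr].
    move=> [Vuw uwT]; split=> [|n]; first exact: VZ.
    by have [z Vz zE] := uwT n; exists (m *: z); [exact: VZ|rewrite linearZ /= zE].
  exists (w - v); split; first exact: subspaceB.
    have -> : S (w - v) = S w - S v by rewrite linearB.
    by rewrite [S v]Sv !shift_opE wu; lmod X.
  have nT : rnorm (T u) <= rnorm (S u) + rnorm m * rnorm u.
    by rewrite -rnormZ; have := rnormD (S u) (m *: u); rewrite shift_opE subrK.
  have nuw := rnormB u w; have nwv := rnormB w v.
  rewrite rnormZ in vC.
  set t := C * rnorm m in Cm *.
  have t0 : 0 <= t by rewrite mulr_ge0 ?rnorm_ge0 // ltW.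
  have h1 : rnorm w <= C * rnorm (S u) + t * rnorm u.
    apply: le_trans wC _; rewrite /t -mulrA -mulrDr ler_pM2l //.
  have h2 : rnorm v <= 2 * t * (rnorm u + rnorm w).
    apply: le_trans vC _; rewrite /t !mulrA -(mulrA 2) ler_wpM2l //.
    by rewrite mulr_ge0 // mulr_ge0 ?rnorm_ge0 // ltW.
  have h3 : t * rnorm u <= rnorm u / 8 by have := ler_wpM2r (rnorm_ge0 u) Cm; lra.
  have h4 : t * rnorm w <= rnorm w / 8 by have := ler_wpM2r (rnorm_ge0 w) Cm; lra.
  have h5 : 0 <= C * rnorm (S u) by rewrite mulr_ge0 ?rnorm_ge0 // ltW.
  have h6 := rnorm_ge0 u; lra.
move=> u Vu; have [Su0|/rnorm_gt0 Su0] := pselect (S u = 0).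
  by exists 0; rewrite Su0 linear0 !rnorm0 mulr0.
have /choice[g hg] : forall u, exists u', V u -> [/\ V u', S u' = S u &
    rnorm u' <= rnorm u / 2 + 2 * C * rnorm (S u)].
  move=> u1; case: (pselect (V u1)) => [/step[u' h]|nV]; first by exists u'.
  by exists 0.
have it k : [/\ V (iter k g u), S (iter k g u) = S u &
    rnorm (iter k g u) <= rnorm u / 2 ^+ k + 4 * C * rnorm (S u)].
  elim: k => [|k [IH1 IH2 IH3]].
    by split=> //; rewrite expr0 divr1 lerDl ?mulr_ge0 ?rnorm_ge0 // ltW.
  have [h1 h2 h3] := hg _ IH1; rewrite iterS; split=> //; first by rewrite h2.
  apply: le_trans h3 _; rewrite IH2 exprS invfM; lra.
have Ce : 0 < C * rnorm (S u) by rewrite mulr_gt0.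
have [k hk] := archi_pow2 (rnorm u) Ce.
by have [h1 h2 h3] := it k; exists (iter k g u); split=> //; lra.
Qed.

Lemma kato_shift m : C * rnorm m <= 1 / 8 -> kato_on (shift_op T m) V.
Proof.
move=> Cm; have [V0 VD VZ] := Vs; split.
  apply: (@modulus_closed _ _ _ _ _ (5 * C)) => //.
  - exact: opbounded_shift.
  - by rewrite mulr_ge0 // ltW.
  - exact: modulus_shift.
move=> n x Vx Sx.
(* A kernel vector of the shift satisfies [T x = m x]; for non-zero [m] it is the k-th iterate of
   [m^(-k) x]. *)
have cx : core x.
  case: (pselect (m = 0)) => [m0|/eqP m0].
    by apply: core_ker => //; move: Sx; rewrite m0 shift_op0.
  split=> // k; exists ((m ^+ k)^-1 *: x); first exact: VZ.
  have Tx : T x = m *: x by apply/eqP; rewrite -subr_eq0 -shift_opE Sx.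
  have iTx j : iter j T x = m ^+ j *: x.
    by elim: j => [|j IHj]; rewrite ?scale1r // iterS IHj linearZ /= Tx scalerA exprSr.
  by rewrite linearZ /= iTx scalerA mulVf ?scale1r // expf_neq0.
suff [z [[Vz _] <-]] : exists z, core z /\ iter n (shift_op T m) z = x by exists z.
elim: n => [|n [z [cz <-]]]; first by exists x.
have [|y [cy <- _]] := @core_solve m z _ cz; first by lra.
by exists y; rewrite iterSr.
Qed.

End KatoStability.

Section SmallSteps.
Context {R : realType} {X : completeNormedModType R[i]}.
Variables (V : set X).
Hypotheses (Vs : subspace V) (Vc : seqclosed V).

Lemma sum_rnorm_eq0 n (c : 'rV[R[i]]_n) (b b' : R) : b' < b ->
  b * (\sum_i rnorm (c 0 i)) <= b' * (\sum_i rnorm (c 0 i)) -> c = 0.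
Proof.
move=> bb h; have s0 : \sum_i rnorm (c 0 i) = 0.
  apply/le_anti; rewrite (sumr_ge0 _ (fun i _ => rnorm_ge0 _)) andbT.
  by rewrite -(@pmulr_rle0 _ (b - b')) ?subr_gt0 // mulrBl subr_le0.
apply/rowP => i; rewrite mxE; apply/rnorm_eq0.
by have := psumr_eq0P (fun i _ => rnorm_ge0 (c 0 i)) s0; move=> /(_ i isT).
Qed.

Lemma rnorm_comb n (c : 'rV[R[i]]_n) (e : 'I_n -> X) (b : R) :
  (forall i, rnorm (e i) <= b) ->
  rnorm (\sum_i c 0 i *: e i) <= b * \sum_i rnorm (c 0 i).
Proof.
move=> eb; apply: le_trans (rnorm_sum _ _ _) _; rewrite mulr_sumr.
by apply: ler_sum => i _; rewrite rnormZ mulrC ler_wpM2r ?rnorm_ge0.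
Qed.

(** A Riesz family for S has a lower bound [b] depending only on n. Kernel vectors are corrected to
    kernel vectors of S' by at most [C * d], and vectors independent modulo the range of S stay so
    modulo that of S', as [C * d < b]. Since [d] ignores S and S', the lemma can be iterated. *)
Lemma dim_step n C : 0 < C -> exists2 d : R, 0 < d &
  forall S S' : {linear X -> X}, modulus S' V C -> seqclosed (S @` V) -> stable S V ->
    opbounded S ->
    (forall x, rnorm (S x - S' x) <= d * rnorm x) ->
    (nul_ge S V n -> nul_ge S' V n) /\ (def_ge S V n -> def_ge S' V n).
Proof.
move=> C0; have [b b0 hb] := @riesz_basis R X n; have [V0 VD VZ] := Vs.
have Cd : C * (b / (2 * C)) < b.
  have -> : C * (b / (2 * C)) = b / 2 by field; rewrite gt_eqF.
  lra.
exists (b / (2 * C)); first by rewrite divr_gt0 // mulr_gt0.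
set d := b / (2 * C) in Cd *; move=> S S' mS' Sc SV Sb SS'; split.
  move=> nS; have [||e [Ve e1 eb]] := hb _ _ (subspace_nul S Vs) (@subspace0 _ X) _ _ nS.
  - by move=> u x u0 ux; apply: seqcvg_unique ux _; apply: seqcvg_eq (seqcvg_cst 0) => k; rewrite u0.
  - by move=> _ ->; case: (subspace_nul S Vs).
  have /choice[v hv] : forall i, exists v, [/\ V v, S' v = S' (e i) & rnorm v <= C * d].
    move=> i; have [Vei Sei] := Ve i; have [v [Vv vE vC]] := mS' _ Vei.
    exists v; split=> //; apply: le_trans vC _; rewrite ler_pM2l //.
    rewrite -rnormN -[X in rnorm X]add0r -Sei; apply: le_trans (SS' _) _.
    rewrite -[leRHS]mulr1 ler_wpM2l // /d divr_ge0 // ?mulr_ge0 // ltW //.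
  exists (fun i => e i - v i); split.
    move=> i; have [Vei Sei] := Ve i; have [Vv vE _] := hv i.
    by split; [exact: subspaceB|rewrite /opker /= linearB vE subrr].
  move=> c /= c0; apply: sum_rnorm_eq0 Cd _.
  apply: le_trans (eb c 0 erefl) _; rewrite subr0.
  have -> : \sum_i c 0 i *: e i = \sum_i c 0 i *: v i.
    apply/eqP; rewrite -subr_eq0 -sumrB -[X in _ == X]c0; apply/eqP.
    by apply: eq_bigr => i _; rewrite scalerBr.
  by apply: rnorm_comb => i; have [] := hv i.
move=> dS; have SVV : S @` V `<=` V by move=> _ [x Vx <-]; exact: SV.
have [e [Ve e1 eb]] := hb _ _ Vs (subspace_image S Vs) Sc SVV dS.
exists e; split=> // c [x Vx xE]; apply: sum_rnorm_eq0 Cd _.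
have [x' [Vx' x'x x'C]] := mS' _ Vx.
have := eb c (S x'); rewrite -xE -x'x => /(_ _)/le_trans; apply; first by exists x'.
rewrite rnormC; apply: le_trans (SS' _) _.
rewrite (_ : C * d * _ = d * (C * \sum_i rnorm (c 0 i))); last by ring.
rewrite ler_wpM2l //.
  by rewrite /d divr_ge0 ?mulr_ge0 ?ltW.
apply: le_trans x'C _; rewrite ler_pM2l // xE.
by rewrite -[leRHS]mul1r; exact: rnorm_comb.
Qed.

(* Nullity and deficiency cannot jump on a small step, where smallness is uniform
   along the segment joining T to its shift. *)
Lemma kato_stability (T : {linear X -> X}) : opbounded T -> stable T V -> kato_on T V ->
  exists2 r : R, 0 < r & forall m, rnorm m < r ->
    [/\ kato_on (shift_op T m) V,
        forall n, nul_ge (shift_op T m) V n <-> nul_ge T V n &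
        forall n, def_ge (shift_op T m) V n <-> def_ge T V n].
Proof.
move=> Tb TV TK; have [C C0 mT] := open_mapping Vs Vc Tb TK.1.
(* In this disc [C * rnorm m <= 1 / 8], the condition under which [modulus_shift] and [kato_shift]
   apply. *)
exists (1 / (8 * C)); first by rewrite divr_gt0 // mulr_gt0.
have small m : rnorm m < 1 / (8 * C) -> C * rnorm m <= 1 / 8.
  by rewrite ltr_pdivlMr ?mulr_gt0 // => h; lra.
move=> m mr; suff nd n : (nul_ge (shift_op T m) V n <-> nul_ge T V n) /\
    (def_ge (shift_op T m) V n <-> def_ge T V n).
  by split=> [|n|n]; [exact/kato_shift/small|exact: (nd n).1|exact: (nd n).2].
have C5 : 0 < 5 * C by rewrite mulr_gt0.
have [d d0 hd] := dim_step n C5.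
(* The segment is cut into N pieces of length at most the [d] that [dim_step] gives for n and the
   common modulus [5 * C]; N may depend on n. *)
have [N N0 hN] : exists2 N : nat, (0 < N)%N & rnorm m / N%:R <= d.
  exists (Num.bound (rnorm m / d)).+1 => //; rewrite ler_pdivrMr ?ltr0n // mulrC.
  rewrite -ler_pdivrMr //; apply: ltW; apply: le_lt_trans (ler_norm _) _.
  apply: lt_trans (archi_boundP (normr_ge0 _)) _.
  by rewrite ger0_norm ?ltr_nat // divr_ge0 ?rnorm_ge0 // ltW.
pose a (j : nat) : R[i] := (j%:R / N%:R)%:C * m.
have ar j : (j <= N)%N -> C * rnorm (a j) <= 1 / 8.
  move=> jN; apply: small; apply: le_lt_trans mr.
  rewrite rnormM rnorm_real ger0_norm ?divr_ge0 //.
  by rewrite ler_piMl ?rnorm_ge0 // ler_pdivrMr ?ltr0n // mul1r ler_nat.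
have aS j x : rnorm (shift_op T (a j) x - shift_op T (a j.+1) x) <= d * rnorm x.
  have -> : shift_op T (a j) x - shift_op T (a j.+1) x = (a j.+1 - a j) *: x.
    by rewrite !shift_opE; lmod X.
  rewrite rnormZ ler_wpM2r ?rnorm_ge0 //.
  rewrite /a -mulrBl -rmorphB /= -mulrBl -natrB // subSnn rnormM rnorm_real mul1r.
  by rewrite ger0_norm ?invr_ge0 // mulrC.
have main j : (j <= N)%N -> (nul_ge (shift_op T (a j)) V n <-> nul_ge T V n) /\
    (def_ge (shift_op T (a j)) V n <-> def_ge T V n).
  elim: j => [|j IHj] jN.
    by rewrite /a mul0r rmorph0 mul0r shift_op0.
  have [<- <-] : (nul_ge (shift_op T (a j)) V n = nul_ge T V n) /\
    (def_ge (shift_op T (a j)) V n = def_ge T V n).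
    by have [h1 h2] := IHj (ltnW jN); split; exact/propext.
  have [Kj Kj1] := (kato_shift Vs Vc Tb TV TK C0 mT (ar _ (ltnW jN)),
                    kato_shift Vs Vc Tb TV TK C0 mT (ar _ jN)).
  have [Mj Mj1] := (modulus_shift Vs Vc Tb TV TK C0 mT (ar _ (ltnW jN)),
                    modulus_shift Vs Vc Tb TV TK C0 mT (ar _ jN)).
  have [h1 h2] := hd _ _ Mj1 Kj.1 (stable_shift _ Vs TV) (opbounded_shift _ Tb) (aS j).
  have [|h3 h4] := hd _ _ Mj Kj1.1 (stable_shift _ Vs TV) (opbounded_shift _ Tb).
    by move=> x; rewrite rnormC; exact: aS.
  by [].
have := main N (leqnn N); rewrite /a divff ?pnatr_eq0 -?lt0n // rmorph1 mul1r.
exact.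
Qed.

End SmallSteps.

(** * Separation of a point from a closed subspace *)

Section HahnBanach.
Context {R : realType} {X : lmodType R[i]}.
Variable p : X -> R.
Hypotheses (pD : forall x y, p (x + y) <= p x + p y)
  (pZ : forall t x, 0 <= t -> p (t%:C *: x) = t * p x).

(** Partial real-linear functionals are handled as graphs, ordered by inclusion for Zorn's lemma;
    single-valuedness comes out of domination. *)
Record dominated_graph (G : set (X * R)) : Prop := DominatedGraph {
  graphD : forall x y r s, G (x, r) -> G (y, s) -> G (x + y, r + s) ;
  graphZ : forall t x r, G (x, r) -> G (t%:C *: x, t * r) ;
  graph_le : forall x r, G (x, r) -> r <= p x }.

(** The graph contains [(0, r - s)], and [p 0 = 0] dominates this difference in both directions. *)
Lemma graph_fun G x r s : dominated_graph G -> G (x, r) -> G (x, s) -> r = s.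
Proof.
move=> [GD GZ Gle].
have p0 : p 0 = 0 by have := pZ 0 (lexx 0); rewrite scaler0 mul0r.
suff le r' s' : G (x, r') -> G (x, s') -> r' <= s'.
  by move=> h1 h2; apply/le_anti; rewrite !le.
move=> h1 h2; have := Gle _ _ (GD _ _ _ _ h1 (GZ (-1) _ _ h2)).
by rewrite rmorphN1 scaleN1r subrr p0 mulN1r subr_le0.
Qed.

Lemma graph_extend G x : dominated_graph G -> G (0, 0) ->
  exists G', [/\ dominated_graph G', G `<=` G' & exists r, G' (x, r)].
Proof.
move=> [GD GZ Gle] G0.
pose E := [set a | exists y r, G (y, r) /\ a = r - p (y - x)].
have Eub z s : G (z, s) -> ubound E (p (z + x) - s).
  move=> Gz _ [y [r [Gy ->]]]; have := Gle _ _ (GD _ _ _ _ Gy Gz).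
  have := pD (y - x) (z + x).
  have -> : y - x + (z + x) = y + z by lmod X.
  by move=> h1 h2; lra.
have Esup : has_sup E.
  by split; [exists (0 - p (0 - x)), 0, 0|exists (p (0 + x) - 0); exact: Eub].
(* Any value between the supremum of [r - p (y - x)] and the infimum of [p (z + x) - s] would do at
   [x]; subadditivity orders the two sides. *)
pose a := sup E.
have a1 y r : G (y, r) -> r - a <= p (y - x).
  move=> Gy; have : r - p (y - x) <= a by apply: ub_le_sup; [case: Esup|exists y, r].
  by move=> ?; lra.
have a2 y r : G (y, r) -> r + a <= p (y + x).
  move=> Gy; have : a <= p (y + x) - r by apply: ge_sup; [case: Esup|exact: Eub].
  by move=> ?; lra.
exists [set z | exists y r t, G (y, r) /\ z = (y + t%:C *: x, r + t * a)]; split.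
- split.
  + move=> u v r s [y [r' [t [Gy [-> ->]]]]] [z [s' [t' [Gz [-> ->]]]]].
    exists (y + z), (r' + s'), (t + t'); split; first exact: GD.
    by rewrite rmorphD /=; congr (_, _); [lmod X|ring].
  + move=> t _ _ [y [r [s [Gy [-> ->]]]]]; exists (t%:C *: y), (t * r), (t * s).
    split; first exact: GZ.
    by rewrite rmorphM /=; congr (_, _); [lmod X|ring].
  + move=> _ _ [y [r [t [Gy [-> ->]]]]].
    have [t0|t0|->] := ltgtP t 0; last first.
    * by rewrite rmorph0 scale0r mul0r !addr0; exact: Gle.
    * have tC : t%:C * (t^-1)%:C = 1 :> R[i] by rewrite -rmorphM /= mulfV ?rmorph1 // gt_eqF.
      have -> : y + t%:C *: x = t%:C *: ((t^-1)%:C *: y + x).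
        by rewrite scalerDr scalerA tC scale1r.
      rewrite (pZ _ (ltW t0)); have := a2 _ _ (GZ t^-1 _ _ Gy).
      by rewrite -(ler_pM2l t0) mulrDr mulrA mulfV ?mul1r // gt_eqF.
    * pose u := - t; have u0 : 0 < u by rewrite oppr_gt0.
      have tC : u%:C * (u^-1)%:C = 1 :> R[i] by rewrite -rmorphM /= mulfV ?rmorph1 // gt_eqF.
      have -> : y + t%:C *: x = u%:C *: ((u^-1)%:C *: y - x).
        by rewrite scalerBr scalerA tC scale1r /u rmorphN scaleNr opprK.
      rewrite (pZ _ (ltW u0)); have := a1 _ _ (GZ u^-1 _ _ Gy).
      rewrite -(ler_pM2l u0) mulrBr mulrA mulfV ?mul1r ?gt_eqF //.
      by rewrite /u mulNr opprK.
- move=> [y r] Gy; exists y, r, 0; split=> //.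
  by rewrite rmorph0 scale0r mul0r !addr0.
- exists (0 + 1 * a), 0, 0, 1; split=> //.
  by rewrite rmorph1 scale1r !add0r.
Qed.

Lemma graph_total G0 : dominated_graph G0 -> G0 (0, 0) ->
  exists G, [/\ dominated_graph G, G0 `<=` G & forall x, exists r, G (x, r)].
Proof.
move=> domG0 G00.
pose P (G : set (X * R)) := G = set0 \/ (G0 `<=` G /\ dominated_graph G).
have [|G [PG maxG]] := @Zorn_bigcup _ P.
  move=> F FP Ftot; case: (pselect (exists2 A, F A & A !=set0)) => [[A FA [a Aa]]|no].
    right; have PA B b : F B -> B b -> G0 `<=` B /\ dominated_graph B.
      by move=> /FP[->|].
    split; first by move=> z /(PA A a FA Aa).1 Az; exists A.
    split.
    - move=> x y r s [B FB Bx] [B' FB' By].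
      have [BB|BB] := Ftot _ _ FB FB'; [exists B'|exists B] => //.
        by apply: (graphD (PA _ _ FB' By).2) => //; exact: BB.
      by apply: (graphD (PA _ _ FB Bx).2) => //; exact: BB.
    - by move=> t x r [B FB Bx]; exists B => //; exact: (graphZ (PA _ _ FB Bx).2).
    - by move=> x r [B FB Bx]; exact: (graph_le (PA _ _ FB Bx).2).
  left; apply/seteqP; split=> // z [B FB Bz]; apply: no; exists B => //; by exists z.
have {PG}[G0G domG] : G0 `<=` G /\ dominated_graph G.
  case: PG => // G0'; exfalso; apply: (maxG G0); last by right; split.
  by rewrite G0'; split=> // /(_ _ G00).
exists G; split=> // x.
have [G' [domG' GG' [r G'x]]] := graph_extend x domG (G0G _ G00).
exists r; apply: contrapT => Gx; apply: (maxG G').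
  by split=> // /(_ _ G'x).
by right; split=> //; exact: subset_trans GG'.
Qed.

End HahnBanach.

Section SeparatingFunctional.
Context {R : realType} {X : completeNormedModType R[i]}.

(* Real Hahn-Banach applied to the norm scaled by the distance of x0 to W, then
   complexified by f x = g x - i g (i x). *)
Lemma separating_functional (W : set X) x0 : subspace W -> seqclosed W -> ~ W x0 ->
  exists f : {linear X -> R[i]^o}, [/\ opbounded (f : X -> R[i]),
    forall w, W w -> f w = 0 & f x0 = 1].
Proof.
move=> Ws Wc Wx0; have [W0 WD WZ] := Ws; have [d d0 hd] := dist_line Ws Wc Wx0.
(* With this scaling, [dist_line] says precisely that the real part of [c] is dominated at
   [c *: x0 + w]. *)
pose p (x : X) : R := rnorm x / d.
have pD x y : p (x + y) <= p x + p y.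
  by rewrite /p -mulrDl ler_pM2r ?invr_gt0 // rnormD.
have pZ t x : 0 <= t -> p (t%:C *: x) = t * p x.
  by move=> t0; rewrite /p rnormZ rnorm_real ger0_norm // mulrA.
pose G0 := [set z : X * R | exists c w, W w /\ z = (c *: x0 + w, complex.Re c)].
have [||G [domG G0G totG]] := @graph_total _ _ p pD pZ G0.
- split.
  + move=> _ _ _ _ [c [w [Ww [-> ->]]]] [c' [w' [Ww' [-> ->]]]].
    by exists (c + c'), (w + w'); split; [exact: WD|rewrite raddfD; congr (_, _); lmod X].
  + move=> t _ _ [c [w [Ww [-> ->]]]]; exists (t%:C * c), (t%:C *: w); split; first exact: WZ.
    congr (_, _); first by lmod X.
    by case: c => a b; rewrite /= mul0r subr0.
  + move=> _ _ [c [w [Ww [-> ->]]]]; rewrite /p ler_pdivlMr //.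
    apply: le_trans (hd c w Ww); rewrite ler_pM2r //.
    exact: le_trans (ler_norm _) (rnorm_Re c).
- by exists 0, 0; rewrite scale0r addr0.
have /choice[g hg] := totG.
have uniq := graph_fun pZ domG.
have gD x y : g (x + y) = g x + g y.
  by apply: uniq (hg _) _; exact: (graphD domG (hg x) (hg y)).
have gZ t x : g (t%:C *: x) = t * g x by apply: uniq (hg _) _; exact: (graphZ domG t (hg x)).
have gW w : W w -> g w = 0.
  by move=> Ww; apply: uniq (hg _) (G0G _ _); exists 0, w; rewrite scale0r add0r.
have gx0 c : g (c *: x0) = complex.Re c.
  by apply: uniq (hg _) (G0G _ _); exists c, 0; rewrite addr0.
have gN x : g (- x) = - g x by rewrite -mulN1r -gZ rmorphN1 scaleN1r.
have gp x : `|g x| <= p x.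
  rewrite ler_norml lerNl -gN (graph_le domG (hg x)) andbT.
  by apply: le_trans (graph_le domG (hg _)) _; rewrite /p rnormN.
pose f (x : X) : R[i]^o := g x +i* - g ('i *: x).
have fD x y : f (x + y) = f x + f y.
  by rewrite /f scalerDr !gD opprD.
have fZ a x : f (a *: x) = a * f x.
  case: a => a b; rewrite /f.
  have E (c e : R) : (c +i* e) *: x = c%:C *: x + e%:C *: ('i *: x).
    by rewrite scalerA -scalerDl; congr (_ *: _); simpc.
  have E' : 'i *: ((a +i* b) *: x) = ((- b) +i* a) *: x.
    by rewrite scalerA; congr (_ *: _); simpc.
  transitivity ((a * g x - b * - g ('i *: x)) +i* (a * - g ('i *: x) + b * g x)) => //.
  by rewrite E' (E a b) (E (- b) a) !gD !gZ; congr Complex; ring.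
have f_linear : linear f by move=> a x y; rewrite fD fZ.
pose F : {linear X -> R[i]^o} := HB.pack f (GRing.isLinear.Build R[i] X R[i]^o _ f f_linear).
exists F; split.
- exists (2 / d); first by rewrite divr_gt0.
  move=> x; apply: le_trans (rnorm_ReIm _) _; rewrite /= normrN.
  have := gp x; have := gp ('i *: x); rewrite /p rnormZ rnorm_i mul1r => h1 h2.
  rewrite mulrAC -mulrA; lra.
- by move=> w Ww; rewrite /= /f !gW ?oppr0 //; exact: WZ.
- by rewrite /= /f gx0 -[in g x0](scale1r x0) gx0 /= oppr0.
Qed.

End SeparatingFunctional.

(** * The Kato decomposition *)

Section KatoDecomposition.
Context {R : realType} {X : completeNormedModType R[i]}.
Implicit Types (V W : set X).
Variable T : {linear X -> X}.
Hypothesis Tb : opbounded T.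

Lemma qdim_ge_trans V W U m n : subspace V -> subspace W -> subspace U ->
  ~ qdim_ge V W m -> ~ qdim_ge W U n -> ~ qdim_ge V U (m + n).
Proof.
move=> Vs Ws Us /(qdim_ge_basis Vs Ws)[a [e [am _ _ eV _]]].
move=> /(qdim_ge_basis Ws Us)[b [f [bn _ _ fW _]]] VU.
suff : (m + n <= a + b)%N.
  by rewrite leqNgt (leq_trans _ (leq_add am bn)) // addSn addnS ltnS leqnSn.
pose h (i : 'I_(a + b)) := match fintype.split i with inl j => e j | inr j => f j end.
apply: (qdim_ge_span (e := h) Us _ VU) => x /eV[_ [w [[c ->] /fW[_ [u [[d ->] Uu ->]]] ->]]].
exists (row_mx c d); rewrite big_split_ord /=.
have -> : \sum_(i < a) row_mx c d 0 (lshift b i) *: h (lshift b i) = \sum_i c 0 i *: e i.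
  by apply: eq_bigr => i _; rewrite row_mxEl /h (unsplitK (inl i)).
have -> : \sum_(i < b) row_mx c d 0 (rshift a i) *: h (rshift a i) = \sum_i d 0 i *: f i.
  by apply: eq_bigr => i _; rewrite row_mxEr /h (unsplitK (inr i)).
by rewrite (_ : _ - _ = u) //; lmod X.
Qed.

(** If [T (w_n)] tends to [T x], the modulus of T on V gives small [v_n] with [T v_n = T (x - w_n)].
    So [x - v_n] lies in the kernel plus W and tends to [x]. *)
Lemma image_closed V W : subspace V -> seqclosed V -> stable T V ->
  seqclosed (T @` V) -> subspace W -> W `<=` V ->
  seqclosed (setadd (V `&` opker T) W) -> seqclosed (T @` W).
Proof.
move=> Vs Vc TV TVc Ws WV NWc; have [C C0 mT] := open_mapping Vs Vc Tb TVc.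
move=> u y uW uy.
have [x Vx xy] : (T @` V) y.
  by apply: TVc uy => n; have [w Ww <-] := uW n; exists w => //; exact: WV.
have /choice[w hw] : forall n, exists w, W w /\ T w = u n.
  by move=> n; have [w Ww <-] := uW n; exists w.
have /choice[v hv] : forall n, exists v, [/\ V v, T v = T (x - w n) & rnorm v <= C * rnorm (u n - y)].
  move=> n; have [|v [Vv vE vC]] := mT (x - w n).
    by apply: (subspaceB Vs) => //; apply: WV; have [] := hw n.
  exists v; split=> //; rewrite rnormC -xy; have [_ <-] := hw n.
  by rewrite -linearB.
suff [n [w' [[Vn Tn] Ww' xE]]] : setadd (V `&` opker T) W x.
  by exists w' => //; rewrite -xy xE linearD /= Tn add0r.
apply: (NWc (fun n => x - v n)) => [n|].
  exists (x - v n - w n), (w n); split.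
  - have Vw : V (w n) by apply: WV; have [] := hw n.
    have [Vv vE _] := hv n; split; first by do 2!apply: (subspaceB Vs) => //.
    by rewrite /opker /= !linearB /= vE linearB /=; lmod X.
  - by have [] := hw n.
  - by rewrite subrK.
apply: seqcvg_dominated uy => n.
by have [_ _ h] := hv n; rewrite addrAC subrr add0r rnormN; exact: h.
Qed.

Lemma iter_range_sub V k : stable T V -> iter k T @` V `<=` V.
Proof. by move=> TV _ [x Vx <-]; exact: stable_iter. Qed.

Lemma image_iterS V k : iter k.+1 T @` V = T @` (iter k T @` V).
Proof.
apply/seteqP; split=> [_ [x Vx <-]|_ [_ [x Vx <-] <-]]; last by exists x.
by exists (iter k T x) => //; exists x.
Qed.

Lemma image_iterSr V k : iter k.+1 T @` V = iter k T @` (T @` V).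
Proof.
apply/seteqP; split=> [_ [x Vx <-]|_ [_ [x Vx <-] <-]]; last by exists x; rewrite ?iterSr.
by exists (T x); [exists x|rewrite iterSr].
Qed.

Lemma qdim_ge_image V W n : qdim_ge (T @` V) (T @` W) n -> qdim_ge V W n.
Proof.
move=> [e [Ve ie]].
have /choice[v hv] : forall i, exists v, V v /\ T v = e i.
  by move=> i; have [v Vv <-] := Ve i; exists v.
exists v; split=> [i|c Wc]; first by have [] := hv i.
apply: ie; exists (\sum_i c 0 i *: v i) => //.
rewrite linear_sum; apply: eq_bigr => i _.
by rewrite linearZ /=; have [_ ->] := hv i.
Qed.

(** With finite nullity, the kernel plus a closed subspace is closed and [image_closed] applies.
    With finite deficiency, all powers have ranges of finite codimension, closed by
    [finite_codim_closed]. *)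
Lemma iter_range_closed V : subspace V -> seqclosed V -> stable T V ->
  seqclosed (T @` V) -> (exists n, ~ nul_ge T V n \/ ~ def_ge T V n) ->
  forall k, seqclosed (iter k T @` V).
Proof.
move=> Vs Vc TV TVc [n nd].
have Is k : subspace (iter k T @` V) by exact: subspace_image.
have I0 : iter 0 T @` V = V.
  by apply/seteqP; split=> [_ [x Vx <-]|x Vx] //; exists x.
case: nd => [nn|dn].
  elim=> [|k IHk]; first by rewrite I0.
  rewrite image_iterS; apply: (image_closed Vs) => //; first exact: iter_range_sub.
  have [m [e [_ Ve _ eN _]]] := qdim_ge_basis (subspace_nul T Vs) (@subspace0 _ X) nn.
  suff -> : setadd (V `&` opker T) (iter k T @` V) = setadd (lspan e) (iter k T @` V).
    exact: seqclosed_add_span.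
  apply/seteqP; split=> _ [x [w [xN Ww ->]]]; exists x, w; split=> //.
    by have [y [z [ye -> ->]]] := eN _ xN; rewrite addr0.
  exact: (span_sub (subspace_nul T Vs) Ve xN).
(* T induces a surjection from V modulo the k-th range onto T V modulo the next one, so each power
   adds at most the deficiency of T. *)
have TkV k : exists m, ~ qdim_ge V (iter k T @` V) m.
  elim: k => [|k [m hm]]; first by exists 1%N; rewrite I0; apply: qdim_ge_self.
  exists (n + m)%N; apply: (@qdim_ge_trans _ (T @` V)) => //; first exact: subspace_image.
  by rewrite image_iterS => /qdim_ge_image.
elim=> [|k IHk]; first by rewrite I0.
have [m hm] := TkV k.+1.
have [a [e [_ Ve ie eV _]]] := qdim_ge_basis Vs (Is k.+1) hm.
rewrite image_iterS in ie eV *; apply: (finite_codim_closed (e := e) (V := V)) => //.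
by rewrite -image_iterS; exact: iter_range_sub.
Qed.

(* Splitting off a Jordan chain y, T y, .., T^k y ending in the kernel: the
   functional f detects T^k y modulo the range of T^(k+1), and M is the largest
   T-invariant subspace of its kernel. *)
Lemma split_chain V k y : subspace V -> seqclosed V -> stable T V ->
  seqclosed (T @` V) -> seqclosed (iter k.+1 T @` V) -> V y ->
  T (iter k T y) = 0 -> ~ (iter k.+1 T @` V) (iter k T y) ->
  let F := lspan (fun j : 'I_k.+1 => iter j T y) in
  exists M, [/\ [/\ subspace M, seqclosed M, stable T M & seqclosed (T @` M)],
    V = setadd M F, forall x, M x -> F x -> x = 0 &
    forall n, (nul_ge T V n.+1 <-> nul_ge T M n) /\ (def_ge T V n.+1 <-> def_ge T M n)].
Proof.
move=> Vs Vc TV TVc TkVc Vy Tky ny F; have [V0 VD VZ] := Vs.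
have [f [fb f0 f1]] := separating_functional (subspace_image _ Vs) TkVc ny.
have fZ a x : f (a *: x) = a * f x by rewrite linearZ.
have big j : (k < j)%N -> iter j T y = 0.
  move=> /subnKC <-; elim: (j - k.+1)%N => [|i IHi]; first by rewrite addn0.
  by rewrite addnS iterS IHi linear0.
have fbig j x : V x -> (k < j)%N -> f (iter j T x) = 0.
  move=> Vx /subnKC <-; apply: f0; exists (iter (j - k.+1) T x).
    exact: stable_iter.
  exact: (esym (iterD _ _ _ _)).
pose M := [set x | V x /\ forall j, (j <= k)%N -> f (iter j T x) = 0].
have Mall x j : M x -> f (iter j T x) = 0.
  by move=> [Vx Mx]; case: (leqP j k) => [/Mx//|]; exact: fbig.
have MV : M `<=` V by move=> x [].
have Ms : subspace M.
  split.
  - by split=> // j _; rewrite !linear0.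
  - move=> x z Mx Mz; split; first by apply: VD; exact: MV.
    by move=> j _; rewrite linearD /= linearD /= !Mall // addr0.
  - move=> a x Mx; split; first by apply: VZ; exact: MV.
    by move=> j _; rewrite linearZ /= fZ Mall // mulr0.
have Mc : seqclosed M.
  move=> u x uM ux; split; first by apply: Vc ux => n; exact: MV.
  move=> j _; have ujx := opbounded_cvg (opbounded_iter j Tb) ux.
  have := opbounded_cvg (f := f) fb ujx; move=> fu; apply: seqcvg_unique fu _.
  apply: seqcvg_eq (@seqcvg_cst _ R[i] 0) => n; by rewrite Mall.
have TM : stable T M.
  move=> x Mx; split; first by apply: TV; exact: MV.
  by move=> j _; rewrite -iterSr Mall.
have Fs : subspace F by exact: subspace_span.
have FV : F `<=` V by apply: span_sub => // j; exact: stable_iter.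
have Fj j : F (iter j T y).
  case: (ltnP j k.+1) => jk; first exact: (mem_span _ (Ordinal jk)).
  by rewrite big //; case: Fs.
have TF : stable T F.
  move=> _ [c ->]; rewrite linear_sum; apply: subspace_sum => // j _.
  by rewrite linearZ /= -iterS; case: Fs => _ _ FZ; apply: FZ.
(* Triangularity: applying T [k - j] times kills the chain terms beyond j, and f is 1 on the term
   that reaches [T^k y]. *)
have fF (c : 'rV[R[i]]_k.+1) (j : 'I_k.+1) : (forall i : 'I_k.+1, (i < j)%N -> c 0 i = 0) ->
    f (iter (k - j) T (\sum_i c 0 i *: iter i T y)) = c 0 j.
  move=> cj; rewrite !linear_sum (bigD1 j) //= big1 => [|i ij].
    by rewrite addr0 linearZ /= fZ -iterD subnK ?leq_ord // f1 mulr1.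
  rewrite linearZ /= fZ -iterD; have [ij'|ij'] := ltnP i j; first by rewrite cj // mul0r.
  rewrite big ?linear0 ?mulr0 //.
  have ji : (j < i)%N by rewrite ltn_neqAle ij' andbT eq_sym; apply: contra ij => /eqP h; apply/eqP/val_inj.
  by rewrite -[X in (X < _)%N](subnK (leq_ord j)) ltn_add2l.
have F0 (c : 'rV[R[i]]_k.+1) : M (\sum_i c 0 i *: iter i T y) -> c = 0.
  move=> Mx; suff h m (j : 'I_k.+1) : (j < m)%N -> c 0 j = 0.
    by apply/rowP => j; rewrite mxE (h j.+1).
  elim: m j => // m IHm j; rewrite ltnS => jm; rewrite -(fF c j) ?Mall // => i ij.
  by apply: IHm; exact: leq_trans jm.
have MF0 x : M x -> F x -> x = 0.
  by move=> Mx [c xE]; rewrite xE in Mx *; rewrite (F0 _ Mx) big1 // => i _; rewrite mxE scale0r.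
have VMF : V = setadd M F.
  apply/seteqP; split=> [x Vx|_ [z [w [/MV Vz /FV Vw ->]]]]; last exact: VD.
  (* The conditions defining M are enforced from the highest iterate downwards. Adding a multiple of
     [T^j y] repairs the iterate [k - j] and leaves the higher ones untouched. *)
  suff h m : exists z, F z /\ forall i, (k < i + m)%N -> f (iter i T (x - z)) = 0.
    have [z [Fz zx]] := h k.+1.
    exists (x - z), z; rewrite subrK; split=> //; split.
      by apply: (subspaceB Vs) => //; exact: FV.
    by move=> j _; apply: zx; rewrite addnS ltnS leq_addl.
  elim: m => [|j [z [Fz zx]]].
    exists 0; split; first by case: Fs.
    by move=> i; rewrite addn0 subr0 => ki; exact: fbig.
  case: (leqP j k) => jk; last first.
    by exists z; split=> // i _; apply: zx; exact: leq_trans (leq_addl _ _).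
  have [_ FD FZ] := Fs; pose a := f (iter (k - j) T (x - z)).
  exists (z + a *: iter j T y); split; first by apply: FD => //; exact: FZ.
  move=> i ki; have -> : x - (z + a *: iter j T y) = x - z - a *: iter j T y by lmod X.
  rewrite linearB /= linearB /= [iter i T (a *: _)]linearZ /= fZ -iterD.
  move: ki; rewrite addnS ltnS leq_eqVlt => /orP[/eqP kij|kij].
    have -> : i = (k - j)%N by rewrite kij addnK.
    by rewrite -/a subnK // f1 mulr1 subrr.
  by rewrite zx // big // linear0 mulr0 subr0.
(* The image of V meets M only in the image of M: the F-component of such a vector lies in both M
   and F. *)
have TVM x : V x -> M (T x) -> (T @` M) (T x).
  rewrite {1}VMF => -[m [z [Mm Fz ->]]]; rewrite linearD => MTx.
  have Tz : T z = 0.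
    apply: MF0; last exact: TF.
    have -> : T z = T m + T z - T m by lmod X.
    by apply: (subspaceB Ms) => //; exact: TM.
  by rewrite Tz addr0; exists m.
have TMc : seqclosed (T @` M).
  move=> u x uM ux; have [z Vz zx] : (T @` V) x.
    by apply: TVc ux => n; have [z /MV Vz <-] := uM n; exists z.
  rewrite -zx; apply: TVM => //; rewrite zx; apply: Mc ux => n.
  by have [z' /TM Mz' <-] := uM n.
exists M; split=> // n; split.
  apply: (qdim_ge_addone (x := iter k T y)).
  - exact: subspace_nul.
  - exact: subspace0.
  - exact: subspace0.
  - by move=> x [/MV].
  - by [].
  - by split=> //; exact: stable_iter.
  (* On kernel vectors only the condition with iterate 0 has content, so subtracting [f v] times the
     end of the chain gives an element of M. *)
  - move=> v [Vv Tv]; exists (v - f v *: iter k T y), (f v), 0; split=> //; last by lmod X.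
    have Vv' : V (v - f v *: iter k T y).
      by apply: (subspaceB Vs) => //; apply: VZ; exact: stable_iter.
    split; last by rewrite /opker /= linearB linearZ /= Tv Tky scaler0 subrr.
    split=> // -[_|j _]; first by rewrite linearB fZ /= f1 mulr1 subrr.
    by rewrite iterSr linearB linearZ /= Tv Tky scaler0 subrr !linear0.
  - move=> v c [Mv _] vc; have c0 : c = 0.
      have : f (v + c *: iter k T y) = 0 by rewrite vc linear0.
      by rewrite linearD fZ /= f1 mulr1 (Mall v 0%N Mv) add0r.
    by move: vc; rewrite c0 scale0r addr0.
apply: (qdim_ge_addone (x := y)) => //.
- exact: subspace_image.
- exact: subspace_image.
- by move=> _ [x /MV Vx <-]; exists x.
(* Modulo the range, the chain contributes only its top [y]: the other members are images under
   T. *)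
- move=> v; rewrite {1}VMF => -[m [_ [Mm [c ->] ->]]].
  exists m, (c 0 0), (T (\sum_(i < k) c 0 (lift 0 i) *: iter i T y)); split=> //.
    exists (\sum_(i < k) c 0 (lift 0 i) *: iter i T y) => //.
    by apply: subspace_sum => // i _; apply: VZ; exact: stable_iter.
  rewrite -addrA big_ord_recl linear_sum; congr (_ + (_ + _)).
  by apply: eq_bigr => i _; rewrite linearZ.
- move=> v c Mv [x Vx xE]; have c0 : c = 0.
    have : f (iter k T (T x)) = 0 by rewrite -iterSr fbig.
    by rewrite xE linearD /= linearD /= [iter k T (c *: y)]linearZ /= fZ f1 mulr1 Mall // add0r.
  split=> //; rewrite c0 scale0r addr0 in xE; rewrite -xE; apply: TVM => //.
  by rewrite xE.
Qed.

(** Each chain split off lowers nullity and deficiency by one, so the process ends as soon as one of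
    them is finite. The number [d] of chains is the same for both, which keeps the index. *)
Lemma kato_decomposition n V : subspace V -> seqclosed V -> stable T V ->
  seqclosed (T @` V) -> ~ nul_ge T V n \/ ~ def_ge T V n ->
  exists M F, [/\ [/\ subspace M, seqclosed M, stable T M & kato_on T M],
    [/\ subspace F, seqclosed F, stable T F & exists q, forall x, F x -> iter q T x = 0],
    V = setadd M F, forall x, M x -> F x -> x = 0 &
    exists d, forall k, (nul_ge T V (d + k) <-> nul_ge T M k) /\
                        (def_ge T V (d + k) <-> def_ge T M k)].
Proof.
elim: n V => [|n IHn] V Vs Vc TV TVc nd; first by case: nd; case; exact: qdim_ge0.
case: (pselect (kato_on T V)) => [VK|nK].
  exists V, [set 0]; split=> //.
  - split; first exact: subspace0.
    + by move=> u x u0 ux; apply: seqcvg_unique ux _; apply: seqcvg_eq (seqcvg_cst 0) => k; rewrite u0.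
    + by move=> _ ->; rewrite linear0.
    + by exists 0%N.
  - apply/seteqP; split; first by apply: setaddl; exact: subspace0.
    by move=> _ [x [_ [Vx -> ->]]]; rewrite addr0.
  - by exists 0%N.
have TkVc := iter_range_closed Vs Vc TV TVc (ex_intro _ n.+1 nd).
(* Failure of the Kato property gives a kernel vector and a last power whose range contains it; a
   preimage under that power starts the chain. *)
have [k [x [Vx Tx [y Vy yx] nx]]] : exists k x, [/\ V x, T x = 0, (iter k T @` V) x &
    ~ (iter k.+1 T @` V) x].
  apply: contrapT => no; apply: nK; split=> // m x Vx Tx.
  elim: m => [|m IHm]; first by exists x.
  by apply: contrapT => nx; apply: no; exists m, x.
subst x; have [M [[Ms Mc TM TMc] VMF MF0 dims]] := split_chain Vs Vc TV TVc (TkVc _) Vy Tx nx.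
set F := lspan _ in VMF MF0.
have [|M1 [F1 [M1P [F1s F1c TF1 [q qF1]] MF1 MF10 [d hd]]]] := IHn M Ms Mc TM TMc.
  by case: nd => [nn|dn]; [left; rewrite -(dims n).1|right; rewrite -(dims n).2].
have [M1s M1c TM1 M1K] := M1P.
have Fs : subspace F by exact: subspace_span.
have big j : (k < j)%N -> iter j T y = 0.
  move=> /subnKC <-; elim: (j - k.+1)%N => [|i IHi]; first by rewrite addn0.
  by rewrite addnS iterS IHi linear0.
have TF : stable T F.
  move=> _ [c ->]; rewrite linear_sum; apply: subspace_sum => // j _.
  rewrite linearZ /= -iterS; case: (ltnP j.+1 k.+1) => jk.
    by case: Fs => _ _ FZ; apply: FZ; exact: (mem_span _ (Ordinal jk)).
  by rewrite big // scaler0; case: Fs.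
have Fq z : F z -> iter k.+1 T z = 0.
  move=> [c ->]; rewrite linear_sum big1 // => j _.
  by rewrite linearZ /= -iterS -iterD big ?scaler0 // leq_addr.
have F1M : F1 `<=` M by move=> z; rewrite MF1; apply: setaddr.
have M1M : M1 `<=` M by move=> z; rewrite MF1; apply: setaddl.
exists M1, (setadd F F1); split=> //.
- split; [exact: subspace_add|exact: seqclosed_add_span| |].
    move=> _ [z [w [Fz F1w ->]]]; exists (T z), (T w).
    by split; [exact: TF|exact: TF1|rewrite linearD].
  exists (k.+1 + q)%N => _ [z [w [Fz F1w ->]]]; rewrite linearD.
  change (iter (k.+1 + q) T z + iter (k.+1 + q) T w = 0).
  have -> : iter (k.+1 + q) T z = 0 by rewrite addnC iterD Fq // linear0.
  by rewrite iterD qF1 // linear0 addr0.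
- rewrite VMF MF1; apply/seteqP; split.
    by move=> _ [_ [z [[m [w [Mm Fw ->]] Fz ->]]]]; exists m, (z + w); split=> //;
       [exists z, w|lmod X].
  move=> _ [m [_ [Mm [z [w [Fz F1w ->]]] ->]]]; exists (m + w), z; split=> //; last by lmod X.
  by exists m, w.
- move=> x M1x [z [w [Fz F1w xE]]].
  have z0 : z = 0.
    apply: MF0 => //; have -> : z = (z + w) - w by lmod X.
    by rewrite -xE; apply: (subspaceB Ms); [exact: M1M|exact: F1M].
  by rewrite xE z0 add0r in M1x *; exact: MF10.
(* One for the present chain and [d] for those split off from M. *)
- by exists d.+1 => m; rewrite addSn (dims _).1 (dims _).2.
Qed.

End KatoDecomposition.

(** * Poles of the resolvent and Drazin invertibility *)

Section PowerSeries.
Context {R : realType} {X : normedModType R[i]}.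

Lemma seqcvg_bounded (u : nat -> X) x : seqcvg u x ->
  exists2 K : R, 0 < K & forall n, rnorm (u n) <= K.
Proof.
move=> /(_ 1 ltr01)[N hN]; exists (1 + rnorm x + \sum_(k < N) rnorm (u k)).
  by rewrite ltr_pwDl ?sumr_ge0 ?ltr_pwDl ?rnorm_ge0 // => i _; exact: rnorm_ge0.
move=> n; have [nN|/hN h] := ltnP n N.
  rewrite (bigD1 (Ordinal nN)) //= addrCA lerDl.
  by rewrite !addr_ge0 ?rnorm_ge0 ?sumr_ge0 // => i _; exact: rnorm_ge0.
have := le_rnorm_dist (u n) x => ?.
have : 0 <= \sum_(k < N) rnorm (u k) by rewrite sumr_ge0 // => i _; exact: rnorm_ge0.
by move=> ?; lra.
Qed.

Lemma seqcvg_series_term (u : nat -> X) s :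
  seqcvg (fun n => \sum_(k < n) u k) s -> seqcvg u 0.
Proof.
move=> us; have := seqcvgB (@seqcvg_shift _ _ _ _ 1 us) us; rewrite subrr.
by apply: seqcvg_eq => n; rewrite addn1 big_ord_recr /= addrAC subrr add0r.
Qed.

Lemma power_series_eq0 (d : nat -> X) (r : R) : 0 < r ->
  (forall z : R[i], 0 < rnorm z < r -> seqcvg (fun n => \sum_(k < n) z ^+ k *: d k) 0) ->
  forall j, d j = 0.
Proof.
move=> r0 dz; elim/ltn_ind => j IHj; apply: contrapT => /rnorm_gt0 dj.
pose rho := r / 2; have rho0 : 0 < rho by rewrite divr_gt0.
have rhor : rho < r by rewrite /rho; lra.
have nrho : rnorm rho%:C = rho by rewrite rnorm_real gtr0_norm.
have [K K0 hK] : exists2 K : R, 0 < K & forall k, rho ^+ k * rnorm (d k) <= K.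
  have rr : 0 < rnorm rho%:C < r by rewrite nrho rho0.
  have /seqcvg_bounded[K K0 hK] :=
    seqcvg_series_term (u := fun k => rho%:C ^+ k *: d k) (dz _ rr).
  by exists K => // k; have := hK k; rewrite rnormZ rnormX nrho.
pose D := rho ^+ j * rnorm (d j).
have D0 : 0 < D by rewrite mulr_gt0 // exprn_gt0.
(* The tail after index j is at most [2 * K * t^(j+1)]; with [4 * K * t <= D] this is at most half
   of the leading term [t^j * D]. *)
pose t : R := Num.min (1 / 2) (D / (4 * K)).
have t0 : 0 < t by rewrite lt_min; apply/andP; split; rewrite divr_gt0 // mulr_gt0.
have t2 : t <= 1 / 2 by rewrite ge_min lexx.
have tK : 4 * K * t <= D.
  by rewrite mulrC -ler_pdivlMr ?mulr_gt0 // ge_min lexx orbT.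
pose z := (t * rho)%:C; have nz : rnorm z = t * rho.
  by rewrite rnorm_real gtr0_norm // mulr_gt0.
have /dz dz0 : 0 < rnorm z < r.
  rewrite nz mulr_gt0 //=; apply: le_lt_trans rhor.
  by rewrite ler_piMl ?ltW //; lra.
have term k : rnorm (z ^+ k *: d k) <= K * t ^+ k.
  by rewrite rnormZ rnormX nz exprMn -mulrA [leRHS]mulrC ler_wpM2l ?exprn_ge0 ?(ltW t0).
have main n : rnorm (\sum_(k < (j.+1 + n)%N) z ^+ k *: d k - z ^+ j *: d j) <=
    2 * K * (t ^+ j.+1 - t ^+ (j.+1 + n)).
  elim: n => [|n IHn].
    rewrite addn0 big_ord_recr /= big1 => [|i _]; last by rewrite IHj // scaler0.
    by rewrite add0r !subrr rnorm0 mulr0.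
  rewrite addnS big_ord_recr /= addrAC; apply: le_trans (rnormD _ _) _.
  apply: le_trans (lerD IHn (term _)) _; rewrite exprS [t ^+ (j.+1 + n).+1]exprS.
  set s := t ^+ (j.+1 + n); have s0 : 0 <= s by rewrite exprn_ge0 // ltW.
  have : 0 <= K * s * (1 - 2 * t) by rewrite mulr_ge0 ?(mulr_ge0 (ltW K0)) //; lra.
  by move=> ?; lra.
have [|N hN] := dz0 (t ^+ j * D / 2); first by rewrite !divr_gt0 ?mulr_gt0 ?exprn_gt0.
have := hN (j.+1 + N)%N (leq_addl _ _); rewrite subr0 => h1.
have := main N; set S := \sum_(k < _) _ in h1 *; rewrite rnormC => h2.
have := le_rnorm_dist (z ^+ j *: d j) S; rewrite rnormZ rnormX nz exprMn.
rewrite -mulrA -/D => h3.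
have h4 : 2 * K * (t ^+ j.+1 - t ^+ (j.+1 + N)) <= t ^+ j * D / 2.
  have : 0 <= 2 * K * t ^+ (j.+1 + N) by rewrite !mulr_ge0 ?exprn_ge0 ?ltW.
  have := ler_wpM2l (exprn_ge0 j (ltW t0)) tK; rewrite exprS => ? ?; lra.
have D1 : 0 < t ^+ j * D by rewrite mulr_gt0 // exprn_gt0.
lra.
Qed.

(* the coefficients of z^m x = sum_k (z^k a_k - z^(k+1) b_k) *)
Lemma power_series_recurrence (a b : nat -> X) (m : nat) (x : X) (r : R) : 0 < r ->
  (forall z : R[i], 0 < rnorm z < r ->
    (exists s, seqcvg (fun n => \sum_(k < n) z ^+ k *: b k) s) /\
    seqcvg (fun n => \sum_(k < n) z ^+ k *: a k - z *: \sum_(k < n) z ^+ k *: b k) (z ^+ m *: x)) ->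
  forall k, a k = (if k is k'.+1 then b k' else 0) + (if k == m then x else 0).
Proof.
move=> r0 abz k.
pose d k := a k - ((if k is k'.+1 then b k' else 0) + (if k == m then x else 0)).
apply/eqP; rewrite -subr_eq0; apply/eqP; move: k.
apply: (power_series_eq0 (d := d) r0) => z zr; have [[s bs] azb] := abz z zr.
have sumb n : \sum_(k < n.+1) z ^+ k *: (if k : nat is k'.+1 then b k' else 0) =
    z *: \sum_(k < n) z ^+ k *: b k.
  rewrite big_ord_recl scaler0 add0r scaler_sumr; apply: eq_bigr => i _.
  by rewrite scalerA -exprS.
have sumx n : (m < n)%N -> \sum_(k < n) z ^+ k *: (if k == m :> nat then x else 0) = z ^+ m *: x.
  move=> mn; rewrite (bigD1 (Ordinal mn)) //= eqxx big1 ?addr0 // => i im.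
  by rewrite ifN ?scaler0 //; apply: contra im => /eqP im; apply/eqP/val_inj.
(* Multiplication by z shifts the series of b by one index. The correction [z^(n+1) b_n] matches the
   truncations and tends to 0 as a term of a convergent series. *)
have lim : seqcvg (fun n => (\sum_(k < n + 1) z ^+ k *: a k - z *: \sum_(k < n + 1) z ^+ k *: b k)
    + z *: (z ^+ n *: b n) - z ^+ m *: x) (z ^+ m *: x + z *: 0 - z ^+ m *: x).
  apply: seqcvgB; last exact: seqcvg_cst.
  apply: seqcvgD; first exact: (@seqcvg_shift _ _ _ _ 1 azb).
  apply: seqcvgZ; exact: (seqcvg_series_term (u := fun k => z ^+ k *: b k) bs).
rewrite scaler0 addr0 subrr in lim.
move=> e e0; have [N hN] := lim e e0; exists (maxn N m).+1 => -[//|n].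
rewrite ltnS geq_max => /andP[Nn mn].
have := hN n Nn; congr (rnorm _ < e); rewrite !subr0 /d addn1.
under [RHS]eq_bigr do rewrite scalerBr scalerDr.
rewrite sumrB big_split /= sumb sumx // [in X in _ - X + _]big_ord_recr /=.
by lmod X.
Qed.

End PowerSeries.

Section Drazin.
Context {R : realType} {X : completeNormedModType R[i]}.

(* Drazin invertibility, without normalizing the inverse B *)
Definition drazin (A : {linear X -> X}) :=
  exists (m : nat) (B : {linear X -> X}), [/\ opbounded B,
    forall x, A (B x) = B (A x) & forall x, iter m A x = iter m.+1 A (B x)].

Lemma resolvent_pole_punctured (T : {linear X -> X}) l : resolvent_pole T l ->
  exists2 r : R, 0 < r & forall z, 0 < rnorm z < r -> invertible (shift_op T (l + z)).
Proof.
move=> [m [A [r [m0 r0 Ac A0 hr]]]].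
have rE : r = (complex.Re r)%:C by rewrite RRe_real // gtr0_real.
exists (complex.Re r); first by rewrite -ltcR -rE.
move=> z zr; have [|S Si _] := hr (l + z); last by exists S.
by rewrite addrAC subrr add0r rnormE rE !ltcR.
Qed.

(** Comparing coefficients in [(U - z) S = 1] gives [U A_k = A_(k-1)], plus the identity for k = m.
    Hence [U^(j+1) A_j = 0] for j < m, and [A_m] is the required B. *)
Lemma resolvent_pole_drazin (T : {linear X -> X}) l : opbounded T ->
  resolvent_pole T l -> drazin (shift_op T l).
Proof.
move=> Tb [m [A [r [m0 r0 Ac _ hr]]]].
have rE : r = (complex.Re r)%:C by rewrite RRe_real // gtr0_real.
have rr0 : 0 < complex.Re r by rewrite -ltcR -rE.
set U := shift_op T l; have Ub : opbounded U by exact: opbounded_shift.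
have lim z : 0 < rnorm z < complex.Re r -> exists S : {linear X -> X},
    [/\ forall x, U (S x) - z *: S x = x, forall x, S (U x) - z *: S x = x &
      forall x, seqcvg (fun n => \sum_(k < n) z ^+ k *: A k x) (z ^+ m *: S x)].
  move=> zr; have z0 : z != 0.
    by apply: contraTneq zr => ->; rewrite rnorm0 ltxx.
  have [|S [Sc US SU] cvgS] := hr (l + z).
    by rewrite addrAC subrr add0r rnormE rE !ltcR.
  rewrite addrAC subrr add0r in cvgS.
  exists S; split.
  - by move=> x; rewrite -[RHS]SU !shift_opE; lmod X.
  - move=> x; rewrite -[RHS]US !shift_opE -linearZ -linearB; congr (S _).
    by lmod X.
  move=> x; have limx : seqcvg (fun n => \sum_(k < n) z ^ (k%:Z - m%:Z) *: A k x) (S x).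
    move=> e e0; have e2 : 0 < (e / (2 * (rnorm x + 1)))%:C :> R[i].
      by rewrite ltcR divr_gt0 // mulr_gt0 // ltr_wpDl ?rnorm_ge0.
    have [N _ hN] := cvgS _ e2; exists N => n /hN /(_ x).
    rewrite !rnormE -rmorphM lecR => /le_lt_trans; apply.
    have x1 : 0 < rnorm x + 1 by rewrite ltr_wpDl ?rnorm_ge0.
    rewrite mulrAC ltr_pdivrMr ?mulr_gt0 // ltr_pM2l //; have := rnorm_ge0 x => ?; lra.
  apply: seqcvg_eq (seqcvgZ (z ^+ m) limx) => n; rewrite scaler_sumr.
  apply: eq_bigr => k _; rewrite scalerA; congr (_ *: _).
  by rewrite !exprnP -expfzDr // addrC subrK.
have UA x k : U (A k x) = (if k is k'.+1 then A k' x else 0) + (if k == m then x else 0).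
  move: k; apply: (@power_series_recurrence _ _ _ _ m x _ rr0) => z /lim[S [US SU SA]].
  split; first by exists (z ^+ m *: S x).
  have -> : z ^+ m *: x = U (z ^+ m *: S x) - z *: (z ^+ m *: S x).
    have -> : U (z ^+ m *: S x) = z ^+ m *: U (S x) by rewrite linearZ.
    by rewrite -{1}(US x); lmod X.
  apply: seqcvgB; last exact: seqcvgZ.
  apply: seqcvg_eq (opbounded_cvg Ub (SA x)) => n.
  by rewrite linear_sum; apply: eq_bigr => k _; rewrite linearZ.
have AU x k : A k (U x) = (if k is k'.+1 then A k' x else 0) + (if k == m then x else 0).
  move: k; apply: (@power_series_recurrence _ _ _ _ m x _ rr0) => z /lim[S [US SU SA]].
  split; first by exists (z ^+ m *: S x).
  have -> : z ^+ m *: x = z ^+ m *: S (U x) - z *: (z ^+ m *: S x).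
    by rewrite -{1}(SU x); lmod X.
  by apply: seqcvgB; last exact: seqcvgZ.
have nilA j x : (j < m)%N -> iter j.+1 U (A j x) = 0.
  elim: j => [|j IHj] jm; first by rewrite [LHS]UA ltn_eqF // addr0.
  by rewrite iterSr UA ltn_eqF // addr0 IHj // ltnW.
exists m, (A m); split; first exact/continuousP.
  by move=> x; rewrite UA AU.
move=> x; rewrite iterSr UA eqxx linearD /=.
by case: m m0 {lim UA AU hr} nilA => // m _ nilA; rewrite nilA // add0r.
Qed.

Lemma invertible_drazin (T : {linear X -> X}) : invertible T -> drazin T.
Proof.
by move=> [S [Sc TS ST]]; exists 0%N, S; split=> [|x|x]; rewrite ?TS ?ST //; exact/continuousP.
Qed.

Lemma meromorphic_drazin (T : {linear X -> X}) l : opbounded T ->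
  meromorphic T -> l <> 0 -> drazin (shift_op T l).
Proof.
move=> Tb mT l0; case: (pselect (invertible (shift_op T l))) => [|sl].
  exact: invertible_drazin.
by apply: resolvent_pole_drazin => //; exact: mT.
Qed.

(** The point [e / 2] is regular or a pole; a pole has a regular punctured disc, and a move by at
    most [e / 4] stays within [e]. *)
Lemma meromorphic_resolvent (T : {linear X -> X}) (e : R) : meromorphic T -> 0 < e ->
  exists2 l, 0 < rnorm l < e & invertible (shift_op T l).
Proof.
move=> mT e0; pose l := (e / 2)%:C : R[i].
have nl : rnorm l = e / 2 by rewrite rnorm_real gtr0_norm // divr_gt0.
case: (pselect (invertible (shift_op T l))) => [|sl].
  by exists l => //; rewrite nl; apply/andP; split; lra.
have [|r r0 hr] := @resolvent_pole_punctured T l; first apply: mT => //.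
  by move=> l0; move: nl; rewrite l0 rnorm0; lra.
pose d := Num.min (e / 4) (r / 2).
have d0 : 0 < d by rewrite lt_min !divr_gt0.
have d1 : d <= e / 4 by rewrite ge_min lexx.
have d2 : d <= r / 2 by rewrite ge_min lexx orbT.
exists (l + d%:C); last by apply: hr; rewrite rnorm_real gtr0_norm // d0 /=; lra.
by rewrite /l -rmorphD /= rnorm_real gtr0_norm; [apply/andP; split|]; lra.
Qed.

(** The summands are the range and the kernel of [A^m]; the projection onto the range is
    [A^m B^m]. *)
Lemma drazin_split (A : {linear X -> X}) : opbounded A -> drazin A ->
  exists N1 N2, [/\ [/\ subspace N1, seqclosed N1, stable A N1 &
      (forall x, N1 x -> A x = 0 -> x = 0) /\ (forall y, N1 y -> (A @` N1) y)],
    [/\ subspace N2, seqclosed N2, stable A N2 & exists m, forall x, N2 x -> iter m A x = 0],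
    forall x, N1 x -> N2 x -> x = 0 & setadd N1 N2 = setT].
Proof.
move=> Ab [m [B [Bb AB hB]]].
have ABi i x : A (iter i B x) = iter i B (A x).
  by elim: i x => //= i IHi x; rewrite AB IHi.
have AiB i x : iter i A (B x) = B (iter i A x).
  by elim: i => //= i ->; rewrite AB.
have AiBi i j x : iter i A (iter j B x) = iter j B (iter i A x).
  by elim: j => //= j <-; rewrite AiB.
(* The hypothesis on B used j times. It shows that [A^m B^m] fixes the range of [A^m] and that this
   range meets the kernel only in 0. *)
have E j x : iter m A x = iter (j + m) A (iter j B x).
  elim: j x => // j IHj x; by rewrite IHj addSnnS iterD hB -iterD.
exists (range (iter m A)), (opker (iter m A)); split.
- split.
  + exact: subspace_image.
  (* The range is the fixed space of the continuous map [A^m B^m], hence closed. *)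
  + move=> u x uN ux; exists (iter m B x) => //.
    have c1 := opbounded_cvg (opbounded_iter m Ab) (opbounded_cvg (opbounded_iter m Bb) ux).
    apply: seqcvg_unique c1 _; apply: seqcvg_eq ux => n.
    by have [y _ <-] := uN n; rewrite /= AiBi -iterD -AiBi -E.
  + by move=> _ [x _ <-]; exists (A x) => //; rewrite -iterS iterSr.
  + split=> [_ [y _ <-] Ay|_ [y _ <-]].
      by rewrite (hB y) AiB iterS Ay linear0.
    by exists (iter m A (B y)); [exists (B y)|rewrite -iterS -hB].
- split.
  + exact: subspace_ker.
  + move=> u x uN ux; apply: seqcvg_unique (opbounded_cvg (opbounded_iter m Ab) ux) _.
    by apply: seqcvg_eq (seqcvg_cst 0) => n; exact: (esym (uN n)).
  + by move=> x xN; rewrite /opker /= -iterSr iterS (_ : iter m A x = 0) ?linear0.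
  + by exists m.
- by move=> _ [y _ <-] h; rewrite (E m y) AiBi iterD (_ : iter m A (iter m A y) = 0) ?linear0.
- apply/seteqP; split=> // x _; exists (iter m A (iter m B x)), (x - iter m A (iter m B x)).
  split; [by exists (iter m B x)| |by rewrite addrC subrK].
  by rewrite /opker /= linearB /= -iterD -E subrr.
Qed.

End Drazin.

(** * Meromorphy after adding a nilpotent summand *)

Section NilpotentSum.
Context {R : realType} {E G : completeNormedModType R[i]}.
Variables (J : {linear G -> E}) (P : {linear E -> G}).
Variables (T : {linear E -> E}) (U : {linear G -> G}).
Hypotheses (Jb : opbounded J) (Pb : opbounded P) (Tb : opbounded T).
Hypotheses (PJ : cancel J P) (TJ : forall y, T (J y) = J (U y))
  (PT : forall x, P (T x) = U (P x)).
Variable p : nat.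
Hypothesis nilT : forall x, iter p T (x - J (P x)) = 0.

(** The projection onto the kernel of P along the copy of G in E; [nilT] makes T nilpotent on that
    kernel. *)
Let Q x := x - J (P x).

Let QQ x : Q (Q x) = Q x.
Proof. by rewrite /Q linearB /= PJ subrr linear0 subr0. Qed.

Let TQ x : T (Q x) = Q (T x).
Proof. by rewrite /Q linearB /= TJ PT. Qed.

Let PQ x : P (Q x) = 0.
Proof. by rewrite /Q linearB /= PJ subrr. Qed.

(* the inverse of T - l on the nilpotent summand, extended by 0 *)
Let D (l : R[i]) x := - \sum_(j < p) (l ^+ j.+1)^-1 *: iter j T (Q x).

Let D_linear l : linear (D l).
Proof.
move=> a x y; rewrite /D scalerN -opprD; congr (- _).
rewrite scaler_sumr -big_split; apply: eq_bigr => j _ /=.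
have -> : Q (a *: x + y) = a *: Q x + Q y by rewrite /Q !linearP /=; lmod E.
by rewrite iter_additive; lmod E.
Qed.

HB.instance Definition _ l := GRing.isLinear.Build R[i] E E _ (D l) (@D_linear l).

Let Q_bounded : opbounded Q.
Proof.
have [a a0 ha] := Jb; have [b b0 hb] := Pb.
exists (1 + a * b); first by rewrite addr_gt0 // mulr_gt0.
move=> x; rewrite mulrDl mul1r; apply: le_trans (rnormB _ _) _; rewrite lerD2l.
by apply: le_trans (ha _) _; rewrite -mulrA ler_pM2l.
Qed.

Let D_bounded l : opbounded (D l).
Proof.
have [q q0 hq] := Q_bounded.
have /choice[b hb] : forall j, exists b, 0 < b /\ forall x, rnorm (iter j T x) <= b * rnorm x.
  by move=> j; have [b b0 hb] := opbounded_iter j Tb; exists b.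
have s0 : 0 <= \sum_(j < p) rnorm (l ^+ j.+1)^-1 * (b j * q).
  apply: sumr_ge0 => j _; rewrite mulr_ge0 ?rnorm_ge0 // mulr_ge0 ?(ltW q0) //.
  by apply: ltW; have [] := hb j.
exists (1 + \sum_(j < p) rnorm (l ^+ j.+1)^-1 * (b j * q)); first by rewrite ltr_pwDl.
move=> x; rewrite /D rnormN; apply: le_trans (rnorm_sum _ _ _) _.
rewrite mulrDl mul1r; apply: ler_wpDl; first exact: rnorm_ge0.
rewrite mulr_suml; apply: ler_sum => j _; rewrite rnormZ -mulrA.
rewrite ler_wpM2l ?rnorm_ge0 //; have [bj h] := hb j.
by apply: le_trans (h _) _; rewrite -mulrA ler_pM2l.
Qed.

Let T_D l x : T (D l x) = D l (T x).
Proof.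
rewrite /D linearN linear_sum; congr (- _); apply: eq_bigr => j _.
by rewrite linearZ /= -TQ -iterSr.
Qed.

Let TlD l x : l != 0 -> T (D l x) - l *: D l x = Q x.
Proof.
(* The finite geometric sum telescopes to [u 0 - u p], and [u p] vanishes by nilpotency. *)
move=> l0; pose u j := (l ^+ j)^-1 *: iter j T (Q x).
have -> : T (D l x) = - \sum_(j < p) u j.+1 +
    \sum_(j < p) ((l ^+ j.+1)^-1 *: iter j.+1 T (Q x) - (l ^+ j.+1)^-1 *: T (iter j T (Q x))).
  rewrite [X in _ + X]big1 ?addr0 => [|j _]; last by rewrite iterS subrr.
  rewrite /D linearN linear_sum; congr (- _); apply: eq_bigr => j _.
  by rewrite linearZ.
rewrite [X in _ + X - _]big1 ?addr0 => [|j _]; last by rewrite iterS subrr.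
have -> : l *: D l x = - \sum_(j < p) u j.
  rewrite /D scalerN scaler_sumr; congr (- _); apply: eq_bigr => j _.
  rewrite scalerA /u exprS invfM mulrA mulfV // mul1r //.
have -> : - \sum_(j < p) u j.+1 - - \sum_(j < p) u j = u 0%N - u p.
  elim: p => [|k IHk]; first by rewrite !big_ord0 !subrr.
  rewrite !big_ord_recr /=; move: IHk; set a := \sum_i _; set b := \sum_i _ => IHk.
  have -> : - (a + u k.+1) - - (b + u k) = (- a - - b) + (u k - u k.+1) by lmod E.
  by rewrite IHk; lmod E.
by rewrite /u expr0 invr1 scale1r /= nilT scaler0 subr0.
Qed.

Let DTl l x : l != 0 -> D l (T x - l *: x) = Q x.
Proof. by move=> l0; rewrite linearB linearZ /= -T_D TlD. Qed.

Let DQ l x : D l (Q x) = D l x.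
Proof. by rewrite /D QQ. Qed.

Let QD l x : Q (D l x) = D l x.
Proof.
suff PD : P (D l x) = 0 by rewrite /Q PD linear0 subr0.
rewrite /D linearN linear_sum big1 ?oppr0 // => j _.
rewrite linearZ /=; suff -> : P (iter j T (Q x)) = 0 by rewrite scaler0.
by elim: (j : nat) => [|k IHk]; rewrite ?PQ // iterS PT IHk linear0.
Qed.

(** The resolvent identity on the nilpotent summand; iterated, it expands [D l'] in powers of
    [l' - l]. *)
Let D_resolvent l l' x : l != 0 -> l' != 0 -> D l' x - D l x = (l' - l) *: D l' (D l x).
Proof.
move=> l0 l0'; have := DTl (D l x) l0'.
have -> : T (D l x) - l' *: D l x = Q x - (l' - l) *: D l x by rewrite -(TlD x l0); lmod E.
rewrite QD linearB /= DQ linearZ /= => h.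
by rewrite -[X in _ - X]h; lmod E.
Qed.

Let inverse_sum l (S : {linear G -> G}) : l != 0 -> is_inverse (shift_op U l) S ->
  exists2 S' : {linear E -> E}, is_inverse (shift_op T l) S' & forall x, S' x = J (S (P x)) + D l x.
Proof.
move=> l0 [Sc US SU]; pose S' : {linear E -> E} := (J \o S \o P) \+ D l.
exists S' => //; split.
- apply/continuousP; have [a a0 ha] := Jb; have [b b0 hb] := Pb.
  have [c c0 hc] := (continuousP S).1 Sc; have [d d0 hd] := D_bounded l.
  exists (a * (c * b) + d); first by rewrite addr_gt0 // !mulr_gt0.
  move=> x; rewrite mulrDl; apply: le_trans (rnormD _ _) _; apply: lerD; last exact: hd.
  apply: le_trans (ha _) _; rewrite -mulrA ler_pM2l //.
  by apply: le_trans (hc _) _; rewrite -mulrA ler_pM2l.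
- move=> x; change (J (S (P (T x - l *: x))) + D l (T x - l *: x) = x).
  rewrite DTl // linearB linearZ /= PT.
  have -> : S (U (P x) - l *: P x) = P x by exact: US.
  by rewrite /Q addrC subrK.
- move=> x; change (T (J (S (P x)) + D l x) - l *: (J (S (P x)) + D l x) = x).
  have := SU (P x); rewrite shift_opE => SUx.
  have -> : T (J (S (P x)) + D l x) - l *: (J (S (P x)) + D l x) =
      J (U (S (P x)) - l *: S (P x)) + (T (D l x) - l *: D l x).
    rewrite [T (_ + _)]linearD TJ [J (_ - _)]linearB [J (_ *: _)]linearZ /=.
    by lmod E.
  by rewrite SUx TlD // /Q addrC subrK.
Qed.

(** At a non-zero point the nilpotent summand contributes the series of [z^j B^(j+1)] with
    [B = D l]. Its coefficients enter from index m on, so the order of the pole and the leading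
    coefficient are inherited from U. *)
Lemma meromorphic_nilpotent_sum : meromorphic U -> meromorphic T.
Proof.
move=> mU l sT l0'; have l0 : l != 0 by exact/eqP.
have sU : spectrum U l.
  by move=> [S Si]; apply: sT; have [S' S'i _] := inverse_sum l0 Si; exists S'.
have [m [A [r [m0 r0 Ac [y A0y] hr]]]] := mU l sU l0'.
have rE : r = (complex.Re r)%:C by rewrite RRe_real // gtr0_real.
have rr0 : 0 < complex.Re r by rewrite -ltcR -rE.
pose B := D l; have [b b0 hb] : opbounded B by exact: D_bounded.
have iB k x : rnorm (iter k B x) <= b ^+ k * rnorm x.
  elim: k => [|k IHk]; first by rewrite expr0 mul1r.
  by rewrite iterS exprS -mulrA; apply: le_trans (hb _) _; rewrite ler_pM2l.
pose f k x := J (A k (P x)) + (if (m <= k)%N then iter (k - m).+1 B x else 0).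
have f_linear k : linear (f k).
  move=> a x z; rewrite /f linearP linearP linearP /=; case: ifP => _; last by lmod E.
  have -> : B (iter (k - m) B (a *: x + z)) = a *: B (iter (k - m) B x) + B (iter (k - m) B z).
    exact: (iter_additive (D l) (k - m).+1).
  by lmod E.
pose A' k : {linear E -> E} := HB.pack (f k) (GRing.isLinear.Build R[i] E E _ (f k) (f_linear k)).
(* The three bounds keep [l'] in the disc of U, keep [l'] away from 0, and make [rnorm z * b] at
   most 1/2. *)
pose s := Num.min (complex.Re r) (Num.min (rnorm l) (1 / (2 * b))).
have s1 : s <= complex.Re r by rewrite ge_min lexx.
have s2 : s <= rnorm l by rewrite !ge_min lexx orbT.
have s3 : s <= 1 / (2 * b) by rewrite !ge_min lexx !orbT.
have s0 : 0 < s by rewrite !lt_min rr0 rnorm_gt0 //= divr_gt0 // mulr_gt0.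
have [a a0 ha] := Jb; have [c c0 hc] := Pb.
exists m, A', s%:C; split=> //.
- by rewrite ltcR.
- move=> k; apply/continuousP; have [d d0 hd] := (continuousP (A k)).1 (Ac k).
  have h x : rnorm (J (A k (P x))) <= a * (d * c) * rnorm x.
    apply: le_trans (ha _) _; rewrite -mulrA ler_pM2l //.
    by apply: le_trans (hd _) _; rewrite -mulrA ler_pM2l.
  exists (a * (d * c) + b ^+ (k - m).+1); first by rewrite addr_gt0 ?exprn_gt0 // !mulr_gt0.
  move=> x; rewrite mulrDl; apply: le_trans (rnormD _ _) _; apply: lerD => //.
  case: ifP => _; first exact: iB.
  by rewrite rnorm0 mulr_ge0 ?rnorm_ge0 ?exprn_ge0 // ltW.
(* Since m is positive, index 0 receives no contribution of the nilpotent summand. *)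
- exists (J y) => A'0; apply: A0y; rewrite -[LHS]PJ -(linear0 P) -A'0.
  have -> : A' 0%N (J y) = f 0%N (J y) by [].
  by rewrite /f leqNgt m0 addr0 !PJ.
move=> l' l'r; set z := l' - l.
have {l'r} zr : 0 < rnorm z < s by move: l'r; rewrite rnormE !ltcR.
have z0 : z != 0 by apply: contraTneq zr => ->; rewrite rnorm0 ltxx.
have l'0 : l' != 0.
  apply: contraTneq zr => l'0; rewrite /z l'0 sub0r rnormN; apply/negP => /andP[_].
  by rewrite ltNge s2.
have [|S Si cvgS] := hr l'.
  rewrite rnormE rE !ltcR -/z; case/andP: zr => -> /lt_le_trans; exact.
have [S' S'i S'E] := inverse_sum l'0 Si; exists S' => // e e0.
have eE : e = (complex.Re e)%:C by rewrite RRe_real // gtr0_real.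
have re0 : 0 < complex.Re e by rewrite -ltcR -eE.
have [d d0 hd] := D_bounded l'.
have e'0 : 0 < (complex.Re e / (2 * (a * c)))%:C :> R[i].
  by rewrite ltcR divr_gt0 // !mulr_gt0.
have [N _ hN] := cvgS _ e'0.
(* Half of the error is reserved for the Laurent part on G, the other half for the geometric
   remainder [d / 2^(n - m)]. *)
have [q hq] := archi_pow2 d (divr_gt0 re0 (ltr0Sn R 1)).
exists (N + m + q)%N => // n /= nN x.
have nN1 : (N <= n)%N by apply: leq_trans nN; rewrite -addnA leq_addr.
have nm : (m <= n)%N by apply: leq_trans nN; rewrite addnAC leq_addl.
have nq : (q <= n - m)%N.
  by rewrite leq_subRL //; apply: leq_trans nN; rewrite -addnA leq_addl.
pose Z k := \sum_(j < k) z ^+ j *: iter j.+1 B x.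
have sumE : \sum_(k < n) z ^ (k%:Z - m%:Z) *: A' k x =
    J (\sum_(k < n) z ^ (k%:Z - m%:Z) *: A k (P x)) + Z (n - m)%N.
  have -> : \sum_(k < n) z ^ (k%:Z - m%:Z) *: A' k x =
    \sum_(k < n) (J (z ^ (k%:Z - m%:Z) *: A k (P x)) +
      z ^ (k%:Z - m%:Z) *: (if (m <= k)%N then iter (k - m).+1 B x else 0)).
    by apply: eq_bigr => k _; rewrite linearZ /= /f scalerDr.
  rewrite big_split /= linear_sum; congr (_ + _).
  suff h k : \sum_(i < m + k) z ^ (i%:Z - m%:Z) *: (if (m <= i)%N then iter (i - m).+1 B x else 0) = Z k.
    by have := h (n - m)%N; rewrite subnKC.
  rewrite big_split_ord /= big1 => [|i _]; last by rewrite leqNgt ltn_ord scaler0.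
  rewrite add0r; apply: eq_bigr => i _ /=.
  by rewrite leq_addr addKn PoszD addrC addKr -exprnP.
have ZE k : D l' x - Z k = z ^+ k *: D l' (iter k B x).
  elim: k => [|k IHk]; first by rewrite /Z big_ord0 subr0 expr0 scale1r.
  rewrite /Z big_ord_recr opprD addrA -/(Z k) IHk -scalerBr iterS D_resolvent //.
  by rewrite scalerA -exprSr.
rewrite sumE S'E !rnormE eE -rmorphM lecR.
have -> : J (\sum_(k < n) z ^ (k%:Z - m%:Z) *: A k (P x)) + Z (n - m)%N - (J (S (P x)) + D l' x) =
    J (\sum_(k < n) z ^ (k%:Z - m%:Z) *: A k (P x) - S (P x)) - (D l' x - Z (n - m)%N).
  by rewrite [J (_ - _)]linearB; lmod E.
apply: le_trans (rnormB _ _) _; rewrite [complex.Re e]splitr mulrDl; apply: lerD.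
  apply: le_trans (ha _) _.
  have := hN n nN1 (P x); rewrite !rnormE -rmorphM lecR => h.
  have {}h := le_trans h (ler_wpM2l (ltW (divr_gt0 re0 (mulr_gt0 (ltr0Sn R 1) (mulr_gt0 a0 c0)))) (hc x)).
  rewrite -(ler_pM2l a0) in h; apply: le_trans h _.
  by rewrite le_eqVlt; apply/orP; left; apply/eqP; field; rewrite !gt_eqF.
rewrite ZE rnormZ rnormX.
have h1 : rnorm z * b <= 1 / 2.
  have /andP[_ /ltW/le_trans/(_ s3)] := zr; rewrite -(ler_pM2r b0) => h.
  by apply: le_trans h _; rewrite le_eqVlt; apply/orP; left; apply/eqP; field; rewrite gt_eqF.
have h2 : rnorm z ^+ (n - m) * rnorm (D l' (iter (n - m) B x)) <= d / 2 ^+ (n - m) * rnorm x.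
  apply: le_trans (ler_wpM2l _ (le_trans (hd _) (ler_wpM2l (ltW d0) (iB _ _)))) _.
    by rewrite exprn_ge0 ?rnorm_ge0.
  rewrite (_ : _ * (d * _) = d * (rnorm z * b) ^+ (n - m) * rnorm x); last by rewrite exprMn; ring.
  rewrite ler_wpM2r ?rnorm_ge0 // ler_pM2l // -exprVn lerXn2r ?nnegrE ?mulr_ge0 ?rnorm_ge0 ?(ltW b0) //.
  by rewrite -[leRHS]mul1r.
apply: le_trans h2 _; rewrite ler_wpM2r ?rnorm_ge0 //; apply: le_trans (ltW hq).
by rewrite ler_pM2l // lef_pV2 ?posrE ?exprn_gt0 // ler_eXn2l // ltr1n.
Qed.

End NilpotentSum.

(** * Nullity, deficiency and the classes R_i *)

Section IndexClasses.

(* [nu n], [de n] stand for nullity >= n and deficiency >= n *)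
Definition index_class (i : nat) (nu de : nat -> Prop) : Prop :=
  match i with
  | 1 => ~ nu 1%N
  | 2 => ~ de 1%N
  | 3 => ~ nu 1%N /\ ~ de 1%N
  | 4 => exists n, ~ nu n
  | 5 => exists n, ~ de n
  | 6 => (exists n, ~ nu n) /\ (exists n, ~ de n)
  | 7 => (exists n, ~ nu n) /\ (forall n, nu n -> de n)
  | 8 => (exists n, ~ de n) /\ (forall n, de n -> nu n)
  | 9 => [/\ exists n, ~ nu n, exists n, ~ de n & forall n, nu n <-> de n]
  | _ => False
  end.

Lemma index_class_ext i nu de nu' de' : (forall n, nu n <-> nu' n) ->
  (forall n, de n <-> de' n) -> index_class i nu de -> index_class i nu' de'.
Proof.
by move=> nn dd; have -> : nu = nu' by [apply/funext => n; exact/propext];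
   have -> : de = de' by [apply/funext => n; exact/propext].
Qed.

Lemma index_class_bij i nu de : (1 <= i <= 9)%N -> nu 0%N -> de 0%N ->
  (forall n, nu n -> n = 0%N) -> (forall n, de n -> n = 0%N) -> index_class i nu de.
Proof.
move=> hi n0 d0 nn dd.
have nu1 : ~ nu 1%N by move=> /nn.
have de1 : ~ de 1%N by move=> /dd.
move: hi; case: i => [|[|[|[|[|[|[|[|[|[|i]]]]]]]]]] //= => _.
- by exists 1%N.
- by exists 1%N.
- by split; exists 1%N.
- by split; [exists 1%N|move=> n /nn ->].
- by split; [exists 1%N|move=> n /dd ->].
- by split; [exists 1%N|exists 1%N|move=> n; split=> [/nn ->|/dd ->]].
Qed.

(** Nullity and deficiency drop by the same finite [d]: their finiteness and their comparison are
    unaffected, and monotonicity handles the vanishing conditions. *)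
Lemma index_class_shift i (nu de nu' de' : nat -> Prop) d : nu' 0%N -> de' 0%N ->
  (forall k, nu (d + k)%N <-> nu' k) -> (forall k, de (d + k)%N <-> de' k) ->
  (forall m n, (m <= n)%N -> nu n -> nu m) -> (forall m n, (m <= n)%N -> de n -> de m) ->
  index_class i nu de -> index_class i nu' de'.
Proof.
move=> n0 d0 nn dd num dem.
have nud : nu d by rewrite -[d]addn0 nn.
have ded : de d by rewrite -[d]addn0 dd.
have ex_nu : (exists n, ~ nu n) -> exists n, ~ nu' n.
  move=> [n h]; exists (n - d)%N => /nn; have [dn|nd] := leqP d n; first by rewrite subnKC.
  by move=> _; apply: h; apply: num nud; exact: ltnW.
have ex_de : (exists n, ~ de n) -> exists n, ~ de' n.
  move=> [n h]; exists (n - d)%N => /dd; have [dn|nd] := leqP d n; first by rewrite subnKC.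
  by move=> _; apply: h; apply: dem ded; exact: ltnW.
have nu1 : ~ nu 1%N -> ~ nu' 1%N.
  by move=> h /nn h'; apply: h; apply: num h'; rewrite addn1.
have de1 : ~ de 1%N -> ~ de' 1%N.
  by move=> h /dd h'; apply: h; apply: dem h'; rewrite addn1.
case: i => [|[|[|[|[|[|[|[|[|[|i]]]]]]]]]] //=.
- by move=> [/nu1 ? /de1].
- by move=> [/ex_nu ? /ex_de].
- by move=> [/ex_nu ? h]; split=> // n /nn/h/dd.
- by move=> [/ex_de ? h]; split=> // n /dd/h/nn.
- by move=> [/ex_nu ? /ex_de ? h]; split=> // n; rewrite -nn -dd.
Qed.

Lemma index_class_finite i nu de : index_class i nu de ->
  exists n, ~ nu n \/ ~ de n.
Proof.
case: i => [|[|[|[|[|[|[|[|[|[|i]]]]]]]]]] //=.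
- by exists 1%N; left.
- by exists 1%N; right.
- by case; exists 1%N; left.
- by case=> n; exists n; left.
- by case=> n; exists n; right.
- by case=> -[n]; exists n; left.
- by case=> -[n]; exists n; left.
- by case=> -[n]; exists n; right.
- by case=> -[n]; exists n; left.
Qed.

End IndexClasses.

(** * The classes R_i in terms of nullity and deficiency *)

Section RclsIndex.
Context {R : realType} {X : completeNormedModType R[i]}.
Implicit Types (V W : set X).

Lemma qdim_cases V W : subspace V -> subspace W ->
  (exists2 p : nat, qdim V W = (p : int)%:E & forall n, qdim_ge V W n <-> (n <= p)%N) \/
  (qdim V W = +oo%E /\ forall n, qdim_ge V W n).
Proof.
move=> Vs Ws; rewrite /qdim; case: pselect => [h|nh].
  left; case: (cid h) => p /= /(has_qdimP _ Vs Ws)[h1 h2]; exists p => // n; split.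
    by move=> nV; rewrite leqNgt; apply/negP => pn; apply: h2; exact: qdim_ge_le nV.
  by move=> np; exact: qdim_ge_le h1.
right; split=> // n; apply: contrapT => /(qdim_ge_basis Vs Ws)[m [e [_ Ve ie _ h]]].
by apply: nh; exists m; apply/(has_qdimP _ Vs Ws); split=> //; exists e.
Qed.

Lemma qdim_finite V W : subspace V -> subspace W ->
  (qdim V W < +oo)%E <-> exists n, ~ qdim_ge V W n.
Proof.
move=> Vs Ws; case: (qdim_cases Vs Ws) => [[p -> h]|[-> h]].
  by split=> // _; exists p.+1 => /h; rewrite ltnn.
by split=> // -[n]; case.
Qed.

Variable T : {linear X -> X}.
Hypothesis Tb : opbounded T.

Let N := op_kernel T.

Let NE : setT `&` opker T = N. Proof. by rewrite setTI. Qed.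

Let Ns : subspace N. Proof. exact: subspace_ker. Qed.

Let Is : subspace (range T). Proof. exact: subspace_image. Qed.

Let nulE n : nul_ge T setT n = qdim_ge N [set 0] n.
Proof. by rewrite /nul_ge NE. Qed.

Lemma nul_ge1 V : subspace V -> ~ nul_ge T V 1 <-> forall x, V x -> T x = 0 -> x = 0.
Proof.
move=> Vs; rewrite /nul_ge (qdim_ge1 _ (@subspace0 _ X)); split=> [h x Vx Tx|h x [Vx Tx]].
  by apply: h.
exact: h.
Qed.

Lemma def_ge1 V : subspace V -> ~ def_ge T V 1 <-> V `<=` T @` V.
Proof. by move=> Vs; apply: qdim_ge1; exact: subspace_image. Qed.

Let fredholm_closed n : ~ def_ge T setT n -> seqclosed (range T).
Proof.
move=> /(qdim_ge_basis (@subspaceT _ X) Is)[m [e [_ Ve ie eV _]]].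
by apply: (finite_codim_closed (V := setT) (e := e)).
Qed.

(** A closed range can be demanded in all nine cases: it is part of the definition, or follows from
    a lower bound, from surjectivity, or from finite codimension. *)
Lemma RclsP i : (1 <= i <= 9)%N ->
  Rcls i T <-> seqclosed (range T) /\ index_class i (nul_ge T setT) (def_ge T setT).
Proof.
have cl : closed (range T) <-> seqclosed (range T) by exact: closedP.
have nf : (dimension (op_kernel T) < +oo)%E <-> exists n, ~ nul_ge T setT n.
  by rewrite (qdim_finite Ns (@subspace0 _ X)); split=> -[n h]; exists n; rewrite ?nulE // -nulE.
have df : (codimension (range T) < +oo)%E <-> exists n, ~ def_ge T setT n.
  exact: qdim_finite.
have injP : ~ nul_ge T setT 1 <-> forall x, T x = 0 -> x = 0.
  by rewrite nul_ge1 //; split=> h x; [exact: h|move=> _; exact: h].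
have surjP : ~ def_ge T setT 1 <-> range T = setT.
  by rewrite def_ge1 //; split=> [h|->//]; apply/seteqP; split.
have le_index (p : nat) (P : nat -> Prop) : (forall n, P n <-> (n <= p)%N) ->
    forall q (Q : nat -> Prop), (forall n, Q n <-> (n <= q)%N) ->
    ((p%:Z <= q%:Z)%R <-> forall n, P n -> Q n).
  move=> hP q Q hQ; rewrite lez_nat; split=> [pq n /hP np|h].
    by apply/hQ; exact: leq_trans pq.
  by apply/hQ/h/hP.
(* With finite nullity the index is well defined; infinite deficiency makes it minus infinity, and
   both sides then hold. *)
have indexE : (exists n, ~ nul_ge T setT n) -> (op_index T <= 0)%E <->
    forall n, nul_ge T setT n -> def_ge T setT n.
  move=> [n0 hn0]; rewrite /op_index /dimension /codimension -/N.
  case: (qdim_cases Ns (@subspace0 _ X)) => [[p -> hp]|[_ h]]; last by case: hn0; rewrite nulE; exact: h.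
  case: (qdim_cases (@subspaceT _ X) Is) => [[q -> hq]|[-> hq]].
    rewrite -EFinB lee_fin subr_le0; apply: le_index => // n; by rewrite nulE hp.
  by split=> // _ n _; exact: hq.
have indexE' : (exists n, ~ def_ge T setT n) -> (0 <= op_index T)%E <->
    forall n, def_ge T setT n -> nul_ge T setT n.
  move=> [n0 hn0]; rewrite /op_index /dimension /codimension -/N.
  case: (qdim_cases (@subspaceT _ X) Is) => [[q -> hq]|[_ h]]; last by case: hn0; exact: h.
  case: (qdim_cases Ns (@subspace0 _ X)) => [[p -> hp]|[-> hp]].
    rewrite -EFinB lee_fin subr_ge0; apply: le_index => // n; by rewrite nulE hp.
  by split=> [_ n _|_] //; rewrite nulE; exact: hp.
case: i => [|[|[|[|[|[|[|[|[|[|i]]]]]]]]]] //= => _.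
- split=> [[c c0 hc]|[Tc /injP Ti]].
    have cE : c = (complex.Re c)%:C by rewrite RRe_real // gtr0_real.
    have rc0 : 0 < complex.Re c by rewrite -ltcR -cE.
    have {}hc x : rnorm x <= (complex.Re c)^-1 * rnorm (T x).
      have := hc x; rewrite !rnormE cE -rmorphM lecR => h.
      by rewrite mulrC ler_pdivlMr // mulrC.
    split; last by apply/injP => x Tx; apply/rnorm_eq0/le_anti; rewrite rnorm_ge0 andbT;
      have := hc x; rewrite Tx rnorm0 mulr0.
    apply: (@modulus_closed _ _ _ _ setT (complex.Re c)^-1) => //.
      by rewrite invr_ge0 ltW.
    by move=> x _; exists x; split.
  have [C C0 mT] := open_mapping (@subspaceT _ X) (fun _ _ _ _ => I) Tb Tc.
  exists (C^-1)%:C; first by rewrite ltcR invr_gt0.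
  move=> x; have [x' [_ x'x x'C]] := mT x I.
  have <- : x' = x by apply/eqP; rewrite -subr_eq0; apply/eqP/Ti; rewrite linearB /= x'x subrr.
  by rewrite !rnormE -rmorphM lecR mulrC ler_pdivrMr // mulrC x'x.
- rewrite /surjective_op surjP; split=> [h|[]//]; split=> //.
  by rewrite h => u x _ _.
- split=> [[S [Sc ST TS]]|[Tc [/injP Ti /surjP Ts]]].
    have Tr : range T = setT by apply/seteqP; split=> // x _; exists (S x).
    split; first by rewrite Tr => u x _ _.
    split; [apply/injP|exact/surjP] => x Tx; by rewrite -(ST x) Tx linear0.
  have [C C0 mT] := open_mapping (@subspaceT _ X) (fun _ _ _ _ => I) Tb Tc.
  have /choice[S hS] : forall y, exists x, T x = y.
    by move=> y; have [x _ <-] : range T y by [rewrite Ts]; exists x.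
  have inj x y : T x = T y -> x = y.
    by move=> Txy; apply/eqP; rewrite -subr_eq0; apply/eqP/Ti; rewrite linearB /= Txy subrr.
  have S_linear : linear S by move=> a x y; apply: inj; rewrite linearP /= !hS.
  pose S' : {linear X -> X} := HB.pack S (GRing.isLinear.Build R[i] X X _ S S_linear).
  exists S'; split=> [|x|x]; [|by apply: inj; rewrite hS|by rewrite /= hS].
  apply/continuousP; exists C => // y; have [x [_ xE xC]] := mT (S y) I.
  by move: xC; rewrite (inj _ _ xE) hS.
- by rewrite /upper_semi_Fredholm nf cl; split=> -[].
- rewrite /lower_semi_Fredholm df; split=> [|[]//] h; split=> //.
  by case: h => n; exact: fredholm_closed.
- rewrite /Fredholm /upper_semi_Fredholm /lower_semi_Fredholm nf df cl.
  by split=> [[[? ?] ?]|[? [? ?]]].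
- rewrite /upper_semi_Weyl /upper_semi_Fredholm nf cl.
  by split=> [[[h ?] /(indexE h)]|[? [h /(indexE h)]]].
- rewrite /lower_semi_Weyl /lower_semi_Fredholm df.
  split=> [[h /(indexE' h) ?]|[_ [h /(indexE' h)]]] //.
  by split=> //; case: h => n; exact: fredholm_closed.
- rewrite /Weyl /Fredholm /upper_semi_Fredholm /lower_semi_Fredholm nf df cl.
  split=> [[[[h1 h2] h3] h4]|[h2 [h1 h3 h4]]].
    have h5 : forall n, nul_ge T setT n -> def_ge T setT n by apply/(indexE h1); rewrite h4.
    have h6 : forall n, def_ge T setT n -> nul_ge T setT n by apply/(indexE' h3); rewrite h4.
    by split=> //; split=> // n; split; [exact: h5|exact: h6].
  split=> //; apply/le_anti/andP; split.
    by apply/(indexE h1) => n /h4.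
  by apply/(indexE' h3) => n /h4.
Qed.

End RclsIndex.

(** * Restrictions to closed subspaces, seen in the ambient space *)

Section Restrictions.
Context {R : realType} {X : completeNormedModType R[i]}.
Implicit Types (M : closedSubspace X).

Lemma csub_subspace M : subspace (csub_set M).
Proof.
have [M0 MP] := csub_submod M.
have M0' : csub_set M 0 by exact/set_mem.
have MZ a x : csub_set M x -> csub_set M (a *: x).
  move=> Mx; rewrite -[a *: x]addr0; apply: set_mem; apply: MP; exact: mem_set.
split=> // x y Mx My; rewrite -[x]scale1r; apply: set_mem; apply: MP; exact: mem_set.
Qed.

Lemma csub_seqclosed M : seqclosed (csub_set M).
Proof. by apply/closedP; exact: csub_closed. Qed.

Lemma csub_exists V : subspace V -> seqclosed V -> exists M : closedSubspace X, csub_set M = V.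
Proof.
move=> [V0 VD VZ] /closedP Vc.
have Vs : submod_closed (mem V).
  split; first exact/mem_set.
  by move=> a x y /set_mem Vx /set_mem Vy; apply: mem_set; apply: VD => //; exact: VZ.
by exists (ClosedSubspace Vs Vc).
Qed.

Lemma csub_val_in M (x : M) : csub_set M (val x). Proof. exact/set_mem/(valP x). Qed.

Lemma csub_mk M x : csub_set M x -> exists y : M, val y = x.
Proof. by move=> Mx; exists (CSub (mem_set Mx)). Qed.

Lemma rnorm_val M (x : M) : rnorm x = rnorm (val x). Proof. by []. Qed.

Lemma image_val_setT M : val @` [set: M] = csub_set M.
Proof.
apply/seteqP; split=> [_ [x _ <-]|x Mx]; first exact: csub_val_in.
by have [y <-] := csub_mk Mx; exists y.
Qed.

Lemma seqclosed_val M (A : set M) : seqclosed A <-> seqclosed (val @` A).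
Proof.
split=> Ac u x uA ux.
  have /choice[v hv] : forall n, exists v, A v /\ val v = u n.
    by move=> n; have [v Av <-] := uA n; exists v.
  have [y yx] : exists y : M, val y = x.
    apply: csub_mk; apply: csub_seqclosed ux => n.
    by have [_ <-] := hv n; exact: csub_val_in.
  exists y => //; apply: (Ac v) => [n|e /ux[N hN]]; first by have [] := hv n.
  by exists N => n /hN; rewrite rnorm_val linearB /= (hv n).2 yx.
suff [y Ay /val_inj <-] : (val @` A) (val x) by [].
apply: (Ac (fun n => val (u n))) => [n|]; first by exists (u n).
by move=> e /ux[N hN]; exists N => n /hN; rewrite rnorm_val linearB.
Qed.

Lemma qdim_ge_val M (A W : set M) n : qdim_ge A W n <-> qdim_ge (val @` A) (val @` W) n.
Proof.
have sumE (c : 'rV[R[i]]_n) (e : 'I_n -> M) :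
    val (\sum_i c 0 i *: e i) = \sum_i c 0 i *: val (e i).
  by rewrite linear_sum; apply: eq_bigr => i _; rewrite linearZ.
split=> [[e [Ae ie]]|[e [Ae ie]]].
  exists (fun i => val (e i)); split=> [i|c [w Ww wE]]; first by exists (e i).
  by apply: ie; suff <- : w = \sum_i c 0 i *: e i by []; apply: val_inj; rewrite wE sumE.
have /choice[v hv] : forall i, exists v, A v /\ val v = e i.
  by move=> i; have [v Av <-] := Ae i; exists v.
exists v; split=> [i|c Wc]; first by have [] := hv i.
apply: ie; exists (\sum_i c 0 i *: v i) => //; rewrite sumE.
by apply: eq_bigr => i _; have [_ ->] := hv i.
Qed.

Variables (T : {linear X -> X}) (M : closedSubspace X) (h : invariant_csub T M).

Lemma restr_bounded : opbounded T -> opbounded (restr h).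
Proof. by move=> [B B0 TB]; exists B => // x; rewrite !rnorm_val; exact: TB. Qed.

Lemma val_iter_restr n x : val (iter n (restr h) x) = iter n T (val x).
Proof. by elim: n => //= n <-. Qed.

Lemma val_shift_restr l x : val (shift_op (restr h) l x) = shift_op T l (val x).
Proof. by []. Qed.

Lemma val_iter_shift_restr l n x :
  val (iter n (shift_op (restr h) l) x) = iter n (shift_op T l) (val x).
Proof. by elim: n => // n IHn; rewrite !iterS val_shift_restr IHn. Qed.

Lemma image_val_restr : val @` range (restr h) = T @` csub_set M.
Proof.
apply/seteqP; split=> [_ [_ [x _ <-] <-]|_ [_ /csub_mk[x <-] <-]].
  by exists (val x) => //; exact: csub_val_in.
by exists (restr h x) => //; exists x.
Qed.

Lemma nul_ge_restr n : nul_ge (restr h) setT n <-> nul_ge T (csub_set M) n.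
Proof.
rewrite /nul_ge qdim_ge_val; suff [-> ->] :
    val @` (setT `&` opker (restr h)) = csub_set M `&` opker T /\ val @` [set (0 : M)] = [set 0] by [].
split; apply/seteqP; split.
- move=> _ [x [_ Tx] <-]; split; first exact: csub_val_in.
  by have : val (restr h x) = 0 by rewrite Tx.
- move=> x [/csub_mk[y <-] Ty]; exists y => //; split=> //.
  by apply: val_inj; exact: Ty.
- by move=> _ [_ -> <-].
- by move=> _ ->; exists 0.
Qed.

Lemma def_ge_restr n : def_ge (restr h) setT n <-> def_ge T (csub_set M) n.
Proof. by rewrite /def_ge qdim_ge_val image_val_setT image_val_restr. Qed.

(** This removes the subtype: classes of restrictions are from here on tested on subsets of X. *)
Lemma Rcls_restr i : (1 <= i <= 9)%N -> opbounded T ->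
  Rcls i (restr h) <-> seqclosed (T @` csub_set M) /\
    index_class i (nul_ge T (csub_set M)) (def_ge T (csub_set M)).
Proof.
move=> hi Tb; rewrite (RclsP (restr_bounded Tb) hi) seqclosed_val image_val_restr.
split=> -[Tc Ti]; split=> //; apply: index_class_ext Ti => n;
  by rewrite ?nul_ge_restr ?def_ge_restr.
Qed.

Lemma Kato_restr : Kato (restr h) <-> kato_on T (csub_set M).
Proof.
rewrite /Kato closedP seqclosed_val image_val_restr; split=> -[Tc TK]; split=> // n.
  move=> x /csub_mk[y <-] Ty; have [|z _ zy] := TK n y; first by apply: val_inj; exact: Ty.
  by exists (val z); [exact: csub_val_in|rewrite -val_iter_restr zy].
move=> x Tx; have [||_ /csub_mk[z <-] zx] := TK n (val x); first exact: csub_val_in.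
  by have : val (restr h x) = 0 by rewrite Tx.
by exists z => //; apply: val_inj; rewrite val_iter_restr.
Qed.

End Restrictions.

(** * Kato-meromorphic decompositions *)

Section LinearExt.
Context {K : pzRingType} {U V : lmodType K}.

(** Classes are predicates on bundled linear maps, so composed shifts must agree as bundles; the
    proof components agree by irrelevance. *)
Lemma linear_ext (f g : {linear U -> V}) : f = g :> (U -> V) -> f = g.
Proof.
case: f g => [f [[[f1 f2]] [f3]]] [g [[[g1 g2]] [g3]]] /= fg.
case: _ / fg g1 g2 g3 => g1 g2 g3.
by rewrite (Prop_irrelevance f1 g1) (Prop_irrelevance f2 g2) (Prop_irrelevance f3 g3).
Qed.

End LinearExt.

Section Decompositions.
Context {R : realType} {X : completeNormedModType R[i]}.
Implicit Types (M N : closedSubspace X) (V W F : set X) (T A : {linear X -> X}).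

Lemma shift_op_shift T a b : shift_op (shift_op T a) b = shift_op T (a + b).
Proof. by apply: linear_ext; exact: shift_opD. Qed.

(** The projection bound for the pair M, N restricts to the subspace F of M. *)
Lemma sum_closed M N F : topological_sum M N -> subspace F -> seqclosed F ->
  F `<=` csub_set M -> seqclosed (setadd F (csub_set N)).
Proof.
move=> [MN0 MNT] Fs Fc FM.
have [C C0 hC] : exists2 C : R, 0 < C &
    forall y z, csub_set M y -> csub_set N z -> rnorm y <= C * rnorm (y + z).
  apply: direct_sum_bound; try exact: csub_subspace; try exact: csub_seqclosed.
    suff -> : setadd (csub_set M) (csub_set N) = setT by move=> u x _ _.
    by apply/seteqP; split=> // x _; exact: MNT.
  by move=> x Mx Nx; have : (csub_set M `&` csub_set N) x by []; rewrite MN0.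
apply: (@seqclosed_add _ _ _ _ C) => //; try exact: csub_subspace; try exact: csub_seqclosed.
by move=> y z /FM; exact: hC.
Qed.

Lemma topological_sumE M N : topological_sum M N <->
  (forall x, csub_set M x -> csub_set N x -> x = 0) /\
  setadd (csub_set M) (csub_set N) = setT.
Proof.
split=> [[MN0 MNT]|[MN0 MNT]]; split.
- by move=> x Mx Nx; have : (csub_set M `&` csub_set N) x by []; rewrite MN0.
- by apply/seteqP; split=> // x _; exact: MNT.
- apply/seteqP; split=> [x [Mx Nx]|_ ->]; first exact: MN0.
  by split; [have [] := csub_subspace M|have [] := csub_subspace N].
- by move=> x; have : setadd (csub_set M) (csub_set N) x by rewrite MNT.
Qed.

(** Instance of [meromorphic_nilpotent_sum] with J the inclusion of N in K and P the projection
    along F, bounded by [direct_sum_bound]. *)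
Lemma meromorphic_add A N K F (hN : invariant_csub A N) (hK : invariant_csub A K) q :
  opbounded A -> subspace F -> seqclosed F -> stable A F ->
  (forall x, F x -> iter q A x = 0) -> (forall x, F x -> csub_set N x -> x = 0) ->
  csub_set K = setadd F (csub_set N) -> meromorphic (restr hN) -> meromorphic (restr hK).
Proof.
move=> Ab Fs Fc AF Fq FN0 KE mN.
have Ns := csub_subspace N; have Nc := @csub_seqclosed _ _ N.
have [F0 FD FZ] := Fs; have [N0 ND NZ] := Ns.
have [C C0 hC] : exists2 C : R, 0 < C &
    forall y z, csub_set N y -> F z -> rnorm y <= C * rnorm (y + z).
  apply: direct_sum_bound => //; last by move=> x Nx Fx; exact: FN0.
  suff -> : setadd (csub_set N) F = csub_set K by exact: csub_seqclosed.
  rewrite KE; apply/seteqP; split=> _ [y [z [? ? ->]]]; exists z, y; by rewrite addrC.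
have NK x : csub_set N x -> csub_set K x by rewrite KE => Nx; exact: setaddr.
pose Jf (y : N) : K := CSub (mem_set (NK _ (csub_val_in y))).
have J_linear : linear Jf by move=> a x y; exact: val_inj.
pose J : {linear N -> K} := HB.pack Jf (GRing.isLinear.Build R[i] N K _ Jf J_linear).
(* The projection is characterised by [x - P x] lying in F. Uniqueness then yields its linearity and
   its commutation with A. *)
have /choice[Pf hP] : forall x : K, exists y : N, F (val x - val y).
  have KE' x : csub_set K x -> setadd F (csub_set N) x by rewrite KE.
  move=> x; have [z [_ [Fz /csub_mk[y <-] xE]]] := KE' _ (csub_val_in x).
  by exists y; rewrite xE addrK.
have uniq (y z : N) : F (val y - val z) -> y = z.
  move=> Fyz; apply: val_inj; apply/eqP; rewrite -subr_eq0; apply/eqP/FN0 => //.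
  by apply: subspaceB => //; exact: csub_val_in.
have P_linear : linear Pf.
  move=> a x y; apply: uniq.
  rewrite (_ : _ - _ = a *: (val x - val (Pf x)) + (val y - val (Pf y)) -
    (val (a *: x + y) - val (Pf (a *: x + y)))).
    by apply: subspaceB => //; apply: FD => //; exact: FZ.
  by rewrite !linearP /=; lmod X.
pose P : {linear K -> N} := HB.pack Pf (GRing.isLinear.Build R[i] K N _ Pf P_linear).
apply: (@meromorphic_nilpotent_sum _ _ _ J P (restr hK) (restr hN) _ _ _ _ _ _ q) => //.
- by exists 1 => // x; rewrite mul1r.
- exists C => // x; rewrite !rnorm_val; have := hC _ _ (csub_val_in (Pf x)) (hP x).
  by have -> : val (Pf x) + (val x - val (Pf x)) = val x by lmod X.
- exact: restr_bounded.
- by move=> y; apply: uniq; rewrite -opprB -scaleN1r; apply: FZ; exact: (hP (Jf y)).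
- by move=> y; exact: val_inj.
- move=> x; apply: uniq; have := AF _ (hP x); rewrite linearB /= => h.
  rewrite (_ : _ - _ = (A (val x) - A (val (Pf x))) - (val (restr hK x) - val (Pf (restr hK x)))).
    exact: subspaceB.
  by rewrite /=; lmod X.
- by move=> x; apply: val_inj; rewrite val_iter_restr; apply: Fq; exact: hP.
Qed.

Lemma meromorphic_zero N A (hN : invariant_csub A N) :
  (forall x, csub_set N x -> x = 0) -> meromorphic (restr hN).
Proof.
move=> N0 l sl _; case: sl; exists (idfun : {linear N -> N}).
have z (x y : N) : x = y.
  by apply: val_inj; rewrite (N0 _ (csub_val_in x)) (N0 _ (csub_val_in y)).
by split=> [|x|x]; [move=> x; exact: cvg_id|exact: z|exact: z].
Qed.

Lemma csub_zero : exists N : closedSubspace X, csub_set N = [set 0].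
Proof.
apply: csub_exists; first exact: subspace0.
by move=> u x u0 ux; apply: seqcvg_unique ux _; apply: seqcvg_eq (seqcvg_cst 0) => k; rewrite u0.
Qed.

Lemma meromorphic_nilpotent N A (hN : invariant_csub A N) q : opbounded A ->
  (forall x, csub_set N x -> iter q A x = 0) -> meromorphic (restr hN).
Proof.
move=> Ab Nq; have [Z ZE] := csub_zero.
have hZ : invariant_csub A Z by move=> x; rewrite ZE => ->; rewrite linear0.
apply: (@meromorphic_add A Z N (csub_set N) hZ hN q) => //.
- exact: csub_subspace.
- exact: csub_seqclosed.
- by move=> x _; rewrite ZE.
- rewrite ZE; apply/seteqP; split; first by apply: setaddl; exact: subspace0.
  by move=> _ [x [_ [Nx -> ->]]]; rewrite addr0.
- by apply: meromorphic_zero => x; rewrite ZE.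
Qed.

(* The working form of the decompositions: the Kato part lies in R_i. *)
Definition kato_split i A M N (hN : invariant_csub A N) :=
  [/\ stable A (csub_set M), topological_sum M N, kato_on A (csub_set M),
      index_class i (nul_ge A (csub_set M)) (def_ge A (csub_set M)) &
      meromorphic (restr hN)].

(** The nilpotent part F of M joins N. As F costs the same amount in nullity and deficiency,
    [index_class_shift] keeps the Kato part in the class. *)
Lemma gDMR_kato_split i A : (1 <= i <= 9)%N -> opbounded A -> gDMR i A ->
  exists M N (hN : invariant_csub A N), kato_split i M hN.
Proof.
move=> hi Ab [M [N [hM [hN [MN /(Rcls_restr hM hi Ab)[Mc Mi] mN]]]]].
have Ms := csub_subspace M; have Ns := csub_subspace N.
have Is V : subspace V -> subspace (A @` V) by move=> ?; exact: subspace_image.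
have [n nd] := index_class_finite Mi.
have [M1 [F [[M1s M1c AM1 M1K] [Fs Fc AF [q Fq]] ME M1F0 [d hd]]]] :=
  kato_decomposition Ab Ms (@csub_seqclosed _ _ M) hM Mc nd.
have M1M : M1 `<=` csub_set M by move=> x M1x; rewrite ME; exact: setaddl M1x.
have FM : F `<=` csub_set M by move=> x Fx; rewrite ME; exact: setaddr Fx.
have FNc := sum_closed MN Fs Fc FM.
have [M' M'E] := csub_exists M1s M1c.
have [N' N'E] := csub_exists (subspace_add Fs Ns) FNc.
have hN' : invariant_csub A N'.
  rewrite /invariant_csub N'E => _ [y [z [Fy Nz ->]]]; exists (A y), (A z).
  by split; [exact: AF|exact: (hN _ Nz)|rewrite linearD].
have /topological_sumE[MN0 MNT] := MN.
exists M', N', hN'; split; rewrite ?M'E //.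
- apply/topological_sumE; rewrite M'E N'E; split.
    move=> x M1x [y [z [Fy Nz xE]]].
    have z0 : z = 0.
      apply: MN0 => //; have -> : z = x - y by rewrite xE; lmod X.
      by apply: (subspaceB Ms); [exact: M1M|exact: FM].
    by apply: M1F0 => //; rewrite xE z0 addr0.
  apply/seteqP; split=> // x _; have : setadd (csub_set M) (csub_set N) x by rewrite MNT.
  rewrite ME => -[_ [z [[m [f [M1m Ff ->]]] Nz ->]]]; exists m, (f + z).
  by rewrite addrA; split=> //; exists f, z.
- apply: index_class_shift (fun k => (hd k).1) (fun k => (hd k).2) _ _ Mi.
  + exact: qdim_ge0.
  + exact: qdim_ge0.
  + by move=> m p; apply: qdim_ge_le; exact: subspace0.
  + by move=> m p; apply: qdim_ge_le; exact: Is.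
- apply: (@meromorphic_add A N N' F hN hN' q) => // x Fx Nx.
  by apply: MN0 => //; exact: FM.
Qed.

Lemma kato_split_gDMR i A M N (hN : invariant_csub A N) : (1 <= i <= 9)%N -> opbounded A ->
  kato_split i M hN -> gDMR i A.
Proof.
move=> hi Ab [hM MN MK Mi mN]; exists M, N, hM, hN; split=> //.
by apply/(Rcls_restr _ hi Ab); split=> //; case: MK.
Qed.

Lemma meromorphic_split A N (hN : invariant_csub A N) l : opbounded A ->
  meromorphic (restr hN) -> l <> 0 ->
  let B := shift_op A l in
  exists N1 N2 : set X, [/\ [/\ subspace N1, seqclosed N1, stable B N1 &
      (forall x, N1 x -> B x = 0 -> x = 0) /\ (forall y, N1 y -> (B @` N1) y)],
    [/\ subspace N2, seqclosed N2, stable B N2 & exists m, forall x, N2 x -> iter m B x = 0],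
    forall x, N1 x -> N2 x -> x = 0 & setadd N1 N2 = csub_set N].
Proof.
move=> Ab mN l0 B; have rb := restr_bounded hN Ab.
have [N1 [N2 [[s1 c1 B1 [i1 j1]] [s2 c2 B2 [m n2]] N120 N12T]]] :=
  drazin_split (opbounded_shift l rb) (meromorphic_drazin rb mN l0).
exists (val @` N1), (val @` N2); split.
- split.
  + exact: (@subspace_image _ N X val).
  + exact/seqclosed_val.
  + by move=> _ [x N1x <-]; exists (shift_op (restr hN) l x) => //; exact: B1.
  + split=> [_ [x N1x <-] Bx|_ [y /j1[x N1x <-] <-]].
      by rewrite (i1 x) ?linear0 //; apply: val_inj; exact: Bx.
    by exists (val x) => //; exists x.
- split.
  + exact: (@subspace_image _ N X val).
  + exact/seqclosed_val.
  + by move=> _ [x N2x <-]; exists (shift_op (restr hN) l x) => //; exact: B2.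
  + by exists m => _ [x N2x <-]; rewrite -val_iter_shift_restr n2 ?linear0.
- move=> _ [x N1x <-] [y N2y /val_inj yx]; rewrite (N120 x) ?linear0 //.
  by rewrite -yx.
- apply/seteqP; split=> [_ [_ [_ [[x _ <-] [y _ <-] ->]]]|x /csub_mk[y <-]].
    by apply: (let: And3 _ ND _ := csub_subspace N in ND); exact: csub_val_in.
  have : setadd N1 N2 y by rewrite N12T.
  by move=> [y1 [y2 [? ? ->]]]; exists (val y1), (val y2); split;
    [exists y1|exists y2|rewrite linearD].
Qed.

Lemma meromorphic_small_bij A N (hN : invariant_csub A N) (e : R) : 
  meromorphic (restr hN) -> 0 < e -> exists l, [/\ 0 < rnorm l < e,
    forall x, csub_set N x -> shift_op A l x = 0 -> x = 0 &
    forall y, csub_set N y -> (shift_op A l @` csub_set N) y].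
Proof.
move=> mN e0; have [l le [S [_ US SU]]] := meromorphic_resolvent mN e0.
exists l; split=> //.
  move=> _ /csub_mk[x <-] Bx; suff -> : x = 0 by [].
  by rewrite -[x]US -[0](linear0 S); congr (S _); apply: val_inj; exact: Bx.
move=> _ /csub_mk[y <-]; exists (val (S y)); first exact: csub_val_in.
by rewrite -val_shift_restr SU.
Qed.

(** A summand on which T is bijective adds nothing to kernel or cokernel; the bound [C] keeps the
    sum of the ranges closed. *)
Lemma bij_sum T V W (C : R) : subspace V -> seqclosed V -> stable T V ->
  subspace W -> seqclosed W -> stable T W ->
  (forall x, W x -> T x = 0 -> x = 0) -> (forall y, W y -> (T @` W) y) ->
  (forall y z, V y -> W z -> rnorm y <= C * rnorm (y + z)) -> seqclosed (T @` V) ->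
  [/\ seqclosed (T @` setadd V W),
      forall n, nul_ge T (setadd V W) n <-> nul_ge T V n &
      forall n, def_ge T (setadd V W) n <-> def_ge T V n].
Proof.
move=> Vs Vc TV Ws Wc TW Winj Wsurj hC TVc; have [W0 WD WZ] := Ws.
have VW0 x : V x -> W x -> x = 0.
  move=> Vx Wx; apply/rnorm_eq0/le_anti; rewrite rnorm_ge0 andbT.
  have := hC x (- x) Vx; rewrite subrr rnorm0 mulr0; apply.
  by rewrite -scaleN1r; exact: WZ.
have TVs := subspace_image T Vs.
have TE : T @` setadd V W = setadd (T @` V) W.
  apply/seteqP; split=> [_ [_ [y [z [Vy Wz ->]]] <-]|_ [_ [z [[y Vy <-] /Wsurj[w Ww <-] ->]]]].
    by exists (T y), (T z); split; [exists y|exact: TW|rewrite linearD].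
  by exists (y + w); [exists y, w|rewrite linearD].
split.
- rewrite TE; apply: (@seqclosed_add _ _ _ _ C) => //.
  by move=> _ z [y Vy <-] Wz; apply: hC => //; exact: TV.
- move=> n; rewrite /nul_ge; suff -> : setadd V W `&` opker T = V `&` opker T by [].
  apply/seteqP; split=> [_ [[y [z [Vy Wz ->]]]]|x [Vx Tx]]; last first.
    by split=> //; exact: setaddl Vx.
  rewrite /opker /= linearD => Tyz.
  have Ty : T y = 0.
    apply: VW0; first exact: TV.
    have -> : T y = (T y + T z) - T z by lmod X.
    by rewrite Tyz; apply: subspaceB => //; exact: TW.
  have z0 : z = 0 by apply: Winj => //; move: Tyz; rewrite Ty add0r.
  by rewrite z0 Ty linear0 !addr0.
- move=> n; rewrite /def_ge TE; split=> -[e [Ve ie]].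
    have /choice[v /choice[w hvw]] : forall i, exists v w, [/\ V v, W w & e i = v + w].
      by move=> i; exact: Ve.
    exists v; split=> [i|c cv]; first by have [] := hvw i.
    apply: ie; exists (\sum_i c 0 i *: v i), (\sum_i c 0 i *: w i); split=> //.
      by apply: subspace_sum => // i _; apply: WZ; have [] := hvw i.
    by rewrite -big_split; apply: eq_bigr => i _; have [_ _ ->] := hvw i; rewrite scalerDr.
  exists e; split=> [i|c [y [z [[x Vx <-] Wz ce]]]]; first exact: setaddl (Ve i).
  apply: ie; exists x => //; suff z0 : z = 0 by rewrite ce z0 addr0.
  apply: VW0 => //; have -> : z = \sum_i c 0 i *: e i - T x by rewrite ce; lmod X.
  apply: (subspaceB Vs); last exact: TV.
  by apply: subspace_sum => // i _; case: Vs => _ _ VZ; exact: VZ.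
Qed.

(** Induction: [T^n x] is in the kernel, hence equals [T^(n+1) v], and [x - T v] is killed by a
    smaller power. *)
Lemma kato_ker_iter T V n x : subspace V -> stable T V -> kato_on T V -> V x ->
  iter n T x = 0 -> (T @` V) x.
Proof.
move=> Vs TV [_ TK]; have TVs := subspace_image T Vs; elim: n x => [|n IHn] x Vx.
  by move=> /= ->; case: TVs.
rewrite iterS => Tx; have [v Vv vx] := TK n.+1 _ (stable_iter n TV Vx) Tx.
have -> : x = (x - T v) + T v by lmod X.
have [_ VD _] := TVs; apply: VD; last by exists v.
apply: IHn; first by apply: (subspaceB Vs) => //; exact: TV.
by rewrite linearB /= -iterSr vx subrr.
Qed.

(** The kernel already lies in the range of every power. For the deficiency, [T^k] maps V modulo T V
    onto the corresponding quotient of the k-th range, injectively by [kato_ker_iter]. *)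
Lemma kato_iter T V k : opbounded T -> subspace V -> seqclosed V -> stable T V -> kato_on T V ->
  [/\ seqclosed (iter k T @` V), forall n, nul_ge T (iter k T @` V) n <-> nul_ge T V n &
      forall n, def_ge T (iter k T @` V) n <-> def_ge T V n].
Proof.
move=> Tb Vs Vc TV TK.
have Is j : subspace (iter j T @` V) by exact: subspace_image.
split.
- elim: k => [|k IHk].
    by rewrite (_ : iter 0 T @` V = V) //; apply/seteqP; split=> [_ [x Vx <-]|x Vx] //; exists x.
  rewrite image_iterS; apply: (image_closed Tb Vs) => //; first by case: TK.
    exact: iter_range_sub.
  suff -> : setadd (V `&` opker T) (iter k T @` V) = iter k T @` V by [].
  apply/seteqP; split=> [_ [x [y [[Vx Tx] Vy ->]]]|]; last exact/setaddr/subspace_nul.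
  by have [_ ID _] := Is k; apply: ID => //; apply: TK.2.
- move=> n; rewrite /nul_ge; suff -> : iter k T @` V `&` opker T = V `&` opker T by [].
  apply/seteqP; split=> x [Vx Tx]; split=> //; first exact: iter_range_sub Vx.
  exact: TK.2.
- move=> n; rewrite /def_ge -image_iterS image_iterSr; split.
    exact: (@qdim_ge_image R X (iter k T) V (T @` V) n).
  move=> [e [Ve ie]]; exists (fun i => iter k T (e i)); split=> [i|c]; first by exists (e i).
  move=> [_ [w Vw <-] wE]; apply: ie.
  have -> : \sum_i c 0 i *: e i = (\sum_i c 0 i *: e i - T w) + T w by lmod X.
  have [_ TVD _] := subspace_image T Vs; apply: TVD; last by exists w.
  apply: (@kato_ker_iter T V k) => //.
    apply: (subspaceB Vs); last exact: TV.
    by apply: subspace_sum => // i _; case: Vs => _ _ VZ; exact: VZ.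
  have -> : iter k T (\sum_i c 0 i *: e i - T w) = iter k T (\sum_i c 0 i *: e i) - iter k T (T w).
    exact: linearB.
  by rewrite wE linear_sum -sumrB big1 // => i _; rewrite linearZ subrr.
Qed.

Lemma topological_sum_bound M N : topological_sum M N -> exists2 C : R, 0 < C &
  forall y z, csub_set M y -> csub_set N z -> rnorm y <= C * rnorm (y + z).
Proof.
move=> /topological_sumE[MN0 MNT].
apply: direct_sum_bound => //; try exact: csub_subspace; try exact: csub_seqclosed.
by rewrite MNT => u x _ _.
Qed.

Lemma iter_image_add T V W k : (T @` W = W) ->
  iter k T @` setadd V W = setadd (iter k T @` V) W.
Proof.
move=> TW; have kW : iter k T @` W = W.
  elim: k => [|k IHk]; last by rewrite image_iterS IHk.
  by apply/seteqP; split=> [_ [x Wx <-]|x Wx] //; exists x.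
apply/seteqP; split=> [_ [_ [y [z [Vy Wz ->]]] <-]|_ [_ [z [[y Vy <-] Wz ->]]]].
  exists (iter k T y), (iter k T z); split; [by exists y| |by rewrite linearD].
  by rewrite -[X in X (iter k T z)]kW; exists z.
have [w Ww wz] : (iter k T @` W) z by rewrite kW.
by exists (y + w); [exists y, w|rewrite linearD /= wz].
Qed.

Lemma bij_image T W : stable T W -> (forall y, W y -> (T @` W) y) -> T @` W = W.
Proof.
by move=> TW Ws; apply/seteqP; split=> // _ [x Wx <-]; exact: TW.
Qed.

(** For non-zero l, N splits into N1, where the shift is bijective, and N2, where it is nilpotent.
    N1 joins M; N2 remains as meromorphic summand, or is killed by a power. *)
Lemma kato_split_shift i A M N (hN : invariant_csub A N) : (1 <= i <= 9)%N -> opbounded A ->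
  kato_split i M hN -> exists2 r : R, 0 < r & forall l, rnorm l < r ->
    gDMR i (shift_op A l) /\ (l <> 0 -> BR i (shift_op A l)).
Proof.
move=> hi Ab MNsplit; have [hM MN MK Mi mN] := MNsplit.
have Ms := csub_subspace M; have Ns := csub_subspace N.
have Mc := @csub_seqclosed _ _ M; have Nc := @csub_seqclosed _ _ N.
have [r r0 hr] := kato_stability Ms Mc Ab hM MK.
have [C C0 hC] := topological_sum_bound MN.
have /topological_sumE[MN0 MNT] := MN.
exists r => // l /hr[BK nuE deE].
case: (pselect (l = 0)) => [->|l0].
  split=> //; rewrite (linear_ext (shift_op0 A)).
  exact: kato_split_gDMR MNsplit.
set B := shift_op A l in BK nuE deE *.
have Bb : opbounded B by exact: opbounded_shift.
have BM : stable B (csub_set M) by exact: stable_shift.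
have BN : stable B (csub_set N) by exact: stable_shift.
have [N1 [N2 [[N1s N1c BN1 [inj1 surj1]] [N2s N2c BN2 [m nil2]] N120 N12]]] :=
  meromorphic_split Ab mN l0.
have N1N : N1 `<=` csub_set N by move=> x N1x; rewrite -N12; exact: setaddl N1x.
have N2N : N2 `<=` csub_set N by move=> x N2x; rewrite -N12; exact: setaddr N2x.
have hC1 y z : csub_set M y -> N1 z -> rnorm y <= C * rnorm (y + z).
  by move=> My /N1N; exact: hC.
have Bi : index_class i (nul_ge B (csub_set M)) (def_ge B (csub_set M)).
  by apply: index_class_ext Mi => n; [rewrite nuE|rewrite deE].
split=> [|_].
- have [Sc nu de] := bij_sum Ms Mc BM N1s N1c BN1 inj1 surj1 hC1 BK.1.
  have [M' M'E] := csub_exists (subspace_add Ms N1s) (seqclosed_add Ms N1s Mc N1c hC1).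
  have [N' N'E] := csub_exists N2s N2c.
  have hM' : invariant_csub B M'.
    rewrite /invariant_csub M'E => _ [y [z [My N1z ->]]]; exists (B y), (B z).
    by split; [exact: BM|exact: BN1|rewrite linearD].
  have hN' : invariant_csub B N' by rewrite /invariant_csub N'E.
  exists M', N', hM', hN'; split.
  + apply/topological_sumE; rewrite M'E N'E; split.
      move=> _ [y [z [My N1z ->]]] N2yz.
      have y0 : y = 0.
        apply: MN0 => //; have -> : y = (y + z) - z by lmod X.
        by apply: (subspaceB Ns); [exact: N2N|exact: N1N].
      by rewrite y0 add0r in N2yz *; exact: N120.
    apply/seteqP; split=> // x _; have : setadd (csub_set M) (csub_set N) x by rewrite MNT.
    rewrite -N12 => -[y [_ [My [z [w [N1z N2w ->]]] ->]]]; exists (y + z), w.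
    by rewrite addrA; split=> //; exists y, z.
  + apply/(Rcls_restr hM' hi Bb); rewrite M'E; split=> //.
    by apply: index_class_ext Bi => n; [rewrite nu|rewrite de].
  + by apply: (@meromorphic_nilpotent _ _ hN' m) => // x; rewrite N'E; exact: nil2.
have [Kc Knu Kde] := kato_iter m Bb Ms Mc BM BK.
have Ks : subspace (iter m B @` csub_set M) by exact: subspace_image.
have KM := @iter_range_sub _ _ B (csub_set M) m BM.
have BKs : stable B (iter m B @` csub_set M).
  by move=> _ [x Mx <-]; exists (B x); [exact: BM|rewrite -iterS iterSr].
have hC2 y z : (iter m B @` csub_set M) y -> N1 z -> rnorm y <= C * rnorm (y + z).
  by move=> /KM; exact: hC1.
have BKc : seqclosed (B @` (iter m B @` csub_set M)).
  by rewrite -image_iterS; have [] := kato_iter m.+1 Bb Ms Mc BM BK.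
have [Sc nu de] := bij_sum Ks Kc BKs N1s N1c BN1 inj1 surj1 hC2 BKc.
have [W WE] := csub_exists (subspace_add Ks N1s) (seqclosed_add Ks N1s Kc N1c hC2).
have hW : invariant_csub B W.
  rewrite /invariant_csub WE => _ [y [z [My N1z ->]]]; exists (B y), (B z).
  by split; [exact: BKs|exact: BN1|rewrite linearD].
(* The exponent is the nilpotency degree on N2, so that the range of the power is the m-th range of
   M plus N1. *)
exists m, W, hW; split.
- rewrite WE -(iter_image_add _ _ (bij_image BN1 surj1)).
  apply/seteqP; split=> [_ [x _ <-]|_ [x _ <-]]; first by exists x.
  have : setadd (csub_set M) (csub_set N) x by rewrite MNT.
  rewrite -N12 => -[y [_ [My [z [w [N1z N2w ->]]] ->]]].
  exists (y + z); first by exists y, z.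
  have -> : iter m B (y + (z + w)) = iter m B (y + z) + iter m B w.
    by rewrite addrA; exact: linearD.
  by rewrite (nil2 _ N2w) addr0.
- apply/(Rcls_restr hW hi Bb); rewrite WE; split=> //.
  by apply: index_class_ext Bi => n; [rewrite nu Knu|rewrite de Kde].
Qed.

Lemma kato_split_small i A M N (hN : invariant_csub A N) (e : R) : (1 <= i <= 9)%N ->
  opbounded A -> kato_split i M hN -> 0 < e ->
  exists2 l, rnorm l < e & Rcls i (shift_op A l).
Proof.
move=> hi Ab [hM MN MK Mi mN] e0.
have Ms := csub_subspace M; have Ns := csub_subspace N.
have Mc := @csub_seqclosed _ _ M; have Nc := @csub_seqclosed _ _ N.
have [r r0 hr] := kato_stability Ms Mc Ab hM MK.
have [C C0 hC] := topological_sum_bound MN.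
have /topological_sumE[MN0 MNT] := MN.
have re0 : 0 < Num.min r e by rewrite lt_min r0.
have [l [/andP[_ le] injN surjN]] := meromorphic_small_bij mN re0.
exists l; first by apply: lt_le_trans le _; rewrite ge_min lexx orbT.
have [|BK nuE deE] := hr l; first by apply: lt_le_trans le _; rewrite ge_min lexx.
apply/(RclsP (opbounded_shift l Ab) hi); rewrite -MNT.
have BM : stable (shift_op A l) (csub_set M) by exact: stable_shift.
have BN : stable (shift_op A l) (csub_set N) by exact: stable_shift.
have [Sc nu de] := bij_sum Ms Mc BM Ns Nc BN injN surjN hC BK.1.
split=> //; apply: index_class_ext Mi => n; first by rewrite nu nuE.
by rewrite de deE.
Qed.

Lemma BR_punctured_gDMR i A M N (hN : invariant_csub A N) (r : R) : (1 <= i <= 9)%N ->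
  opbounded A -> stable A (csub_set M) -> topological_sum M N -> kato_on A (csub_set M) ->
  meromorphic (restr hN) -> 0 < r -> (forall l, 0 < rnorm l < r -> BR i (shift_op A l)) ->
  gDMR i A.
Proof.
move=> hi Ab hM MN MK mN r0 hBR.
have Ms := csub_subspace M; have Ns := csub_subspace N.
have Mc := @csub_seqclosed _ _ M; have Nc := @csub_seqclosed _ _ N.
have [s s0 hs] := kato_stability Ms Mc Ab hM MK.
have [C C0 hC] := topological_sum_bound MN.
have /topological_sumE[MN0 MNT] := MN.
(* One [l] must serve three purposes: it lies in the punctured disc of the hypothesis and in the
   stability disc of M, and the shift is bijective on N. *)
have rs0 : 0 < Num.min r s by rewrite lt_min r0.
have [l [/andP[l0 le] injN surjN]] := meromorphic_small_bij mN rs0.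
have [|BK nuE deE] := hs l; first by apply: lt_le_trans le _; rewrite ge_min lexx orbT.
have [|k [W [hW [WE Wi]]]] := hBR l.
  by rewrite l0; apply: lt_le_trans le _; rewrite ge_min lexx.
set B := shift_op A l in BK nuE deE injN surjN W hW WE Wi *.
have Bb : opbounded B by exact: opbounded_shift.
have BM : stable B (csub_set M) by exact: stable_shift.
have BN : stable B (csub_set N) by exact: stable_shift.
have {}WE : csub_set W = setadd (iter k B @` csub_set M) (csub_set N).
  by rewrite WE -(iter_image_add _ _ (bij_image BN surjN)) MNT.
have [Kc Knu Kde] := kato_iter k Bb Ms Mc BM BK.
have Ks : subspace (iter k B @` csub_set M) by exact: subspace_image.
have KM := @iter_range_sub _ _ B (csub_set M) k BM.
have BKs : stable B (iter k B @` csub_set M).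
  by move=> _ [x Mx <-]; exists (B x); [exact: BM|rewrite -iterS iterSr].
have hC2 y z : (iter k B @` csub_set M) y -> csub_set N z -> rnorm y <= C * rnorm (y + z).
  by move=> /KM; exact: hC.
have BKc : seqclosed (B @` (iter k B @` csub_set M)).
  by rewrite -image_iterS; have [] := kato_iter k.+1 Bb Ms Mc BM BK.
have [Sc nu de] := bij_sum Ks Kc BKs Ns Nc BN injN surjN hC2 BKc.
move/(Rcls_restr hW hi Bb): Wi; rewrite WE => -[_ Wi].
exists M, N, hM, hN; split=> //.
apply/(Rcls_restr hM hi Ab); split; first by case: MK.
by apply: index_class_ext Wi => n; [rewrite nu Knu nuE|rewrite de Kde deE].
Qed.

End Decompositions.

(** * Spectra *)

Section ComplexTopology.
Context {R : realType}.
(* [R[i]] carries its topology only through its structure of numFieldType. *)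
Let C : numFieldType := R[i].
Implicit Types (A : set C) (x y : C).

Lemma nbhs_rnorm x A :
  nbhs x A <-> exists2 r : R, 0 < r & forall y, rnorm (y - x) < r -> A y.
Proof.
split=> [/nbhs_ballP[e /= e0 eA]|[r r0 rA]].
  have eE : e = (complex.Re e)%:C by rewrite RRe_real // gtr0_real.
  exists (complex.Re e); first by rewrite -ltcR -eE.
  by move=> y yx; apply: eA; rewrite -ball_normE /= rnormE eE ltcR rnormC.
apply/nbhs_ballP; exists r%:C; first by rewrite /= ltcR.
by move=> y; rewrite -ball_normE /= rnormE ltcR rnormC; exact: rA.
Qed.

Lemma limit_point_rnorm A x : ~ limit_point A x <->
  exists2 r : R, 0 < r & forall y, 0 < rnorm (y - x) < r -> ~ A y.
Proof.
split=> [Ax|[r r0 rA] lAx].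
  apply: contrapT => nr; apply: Ax => U /nbhs_rnorm[r r0 rU]; apply: contrapT => nU.
  apply: nr; exists r => // y /andP[y0 yr] Ay; apply: nU; exists y; split=> //.
    by apply/eqP => yx; move: y0; rewrite yx subrr rnorm0 ltxx.
  exact: rU.
have [|y [/eqP yx Ay yU]] := lAx [set y | rnorm (y - x) < r].
  by apply/nbhs_rnorm; exists r.
apply: (rA y) Ay; rewrite yU andbT; apply: rnorm_gt0 => /eqP.
by rewrite subr_eq0 => /eqP.
Qed.

(** A closed bounded set sits in the continuous image of the compact square with side from -B to
    B. *)
Lemma complex_compact A (B : R) :
  seqclosed A -> (forall x, A x -> rnorm x <= B) -> compact A.
Proof.
move=> Ac AB.
pose f (p : R * R) : C := p.1 +i* p.2.
have fc : continuous f.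
  move=> p U /nbhs_rnorm[r r0 rU].
  have r20 : 0 < r / 2 by rewrite divr_gt0.
  apply: filterS (nbhsx_ballx p _ r20) => q [q1 q2]; apply: rU.
  apply: le_lt_trans (rnorm_ReIm _) _ => /=; rewrite (splitr r) distrC [X in _ + X]distrC.
  exact: ltrD.
apply: (@subclosed_compact _ _ (f @` (`[- B, B] `*` `[- B, B]))).
- exact/closedP.
- apply: continuous_compact; first exact: continuous_subspaceT.
  by apply: compact_setX; exact: segment_compact.
- move=> x /AB xB; exists (complex.Re x, complex.Im x); last by case: (x).
  split; rewrite /= in_itv /= -ler_norml;
    [exact: le_trans (rnorm_Re x) xB|exact: le_trans (rnorm_Im x) xB].
Qed.

(* An isolated point is determined by the cell of a sufficiently fine dyadic
   grid that contains it. *)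
Lemma countable_iso A : countable (iso A).
Proof.
have /choice[k hk] : forall x, exists k : nat, iso A x ->
    forall y, rnorm (y - x) < 2 / 2 ^+ k -> A y -> y = x.
  move=> x; case: (pselect (iso A x)) => [[_ /limit_point_rnorm[r r0 hr]]|nx]; last by exists 0%N.
  have [k kr] := archi_pow2 2 r0; exists k => _ y yx Ay; apply: contrapT => nyx.
  apply: (hr y) Ay; rewrite rnorm_gt0 ?(lt_trans yx) // => /eqP.
  by rewrite subr_eq0 => /eqP.
apply/countable_injP.
(* The code records the fineness of the grid along with the cell, since it varies with the point. *)
pose f x := pickle (k x, Num.floor (complex.Re x * 2 ^+ k x), Num.floor (complex.Im x * 2 ^+ k x)).
exists f => x y /set_mem Ax /set_mem [Ay _] /(pcan_inj pickleK)[kxy].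
rewrite -kxy; set p := 2 ^+ k x => fRe fIm; apply/esym/(hk x Ax) => //.
have p0 : 0 < p by rewrite exprn_gt0.
(* Points of one cell differ by less than [2^(-k)] in each coordinate, so by less than the isolation
   radius [2 / 2^k]. *)
have cell (a b : R) : Num.floor (a * p) = Num.floor (b * p) -> `|b - a| < p^-1.
  move=> ab; rewrite -(ltr_pM2r p0) mulVf ?gt_eqF //.
  rewrite -(gtr0_norm p0) -normrM mulrBl ltr_norml.
  have := floor_itv (a * p); have := floor_itv (b * p); rewrite ab intrD.
  move: (a * p) (b * p) => u v; move: (_%:~R) => w; rewrite /=; lra.
apply: le_lt_trans (rnorm_ReIm _) _; rewrite !raddfB /=.
have := cell _ _ fRe; have := cell _ _ fIm; lra.
Qed.

End ComplexTopology.

(** * The spectra of the decomposed classes *)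

Section Spectra.
Context {R : realType} {X : completeNormedModType R[i]}.
Variables (T : {linear X -> X}) (i : nat).
Hypotheses (Tb : opbounded T) (hi : (1 <= i <= 9)%N).

Let shiftb l : opbounded (shift_op T l) := opbounded_shift l Tb.

Lemma Rcls_gDMR (A : {linear X -> X}) : opbounded A -> Rcls i A -> gDMR i A.
Proof.
move=> Ab /(RclsP Ab hi)[Ac Ai].
have [M ME] : exists M : closedSubspace X, csub_set M = setT by exact: csub_exists.
have [N NE] := @csub_zero R X.
have hM : invariant_csub A M by move=> x; rewrite ME.
have hN : invariant_csub A N by move=> x; rewrite NE => ->; rewrite linear0.
exists M, N, hM, hN; split.
- apply/topological_sumE; rewrite ME NE; split=> [x _ //|].
  by apply/seteqP; split=> // x _; exists x, 0; rewrite addr0.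
- by apply/(Rcls_restr hM hi Ab); rewrite ME.
- by apply: meromorphic_zero => x; rewrite NE.
Qed.

Lemma gDMR_open l : gDMR i (shift_op T l) -> exists2 r : R, 0 < r &
  forall m, rnorm (m - l) < r -> gDMR i (shift_op T m) /\ (m <> l -> BR i (shift_op T m)).
Proof.
move=> /(gDMR_kato_split hi (shiftb l))[M [N [hN MN]]].
have [r r0 hr] := kato_split_shift hi (shiftb l) MN.
exists r => // m /hr; rewrite shift_op_shift subrKC => -[? h]; split=> // ml.
by apply: h => /eqP; rewrite subr_eq0 => /eqP.
Qed.

Lemma gDMR_approx l e : gDMR i (shift_op T l) -> 0 < e ->
  exists2 m, rnorm (m - l) < e & Rcls i (shift_op T m).
Proof.
move=> /(gDMR_kato_split hi (shiftb l))[M [N [hN MN]]] e0.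
have [m me] := kato_split_small hi (shiftb l) MN e0.
by rewrite shift_op_shift => h; exists (l + m); rewrite // addrC addKr.
Qed.

Lemma shift_op_bij_Rcls l :
  (forall x, shift_op T l x = 0 -> x = 0) -> (forall y, exists x, shift_op T l x = y) ->
  Rcls i (shift_op T l).
Proof.
move=> inj surj.
have rT : range (shift_op T l) = setT.
  by apply/seteqP; split=> // y _; have [x <-] := surj y; exists x.
apply/(RclsP (shiftb l) hi); rewrite rT; split=> //.
have n1 : ~ nul_ge (shift_op T l) setT 1 by apply/nul_ge1 => // x _; exact: inj.
have d1 : ~ def_ge (shift_op T l) setT 1 by apply/def_ge1 => //; rewrite rT.
apply: index_class_bij => //; try exact: qdim_ge0.
  by case=> // n h; case: n1; apply: qdim_ge_le h => //; exact: subspace0.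
by case=> // n h; case: d1; apply: qdim_ge_le h => //; exact: subspace_image.
Qed.

(** Beyond twice the bound of T, the shift is bijective: injective by comparing norms, surjective by
    a Neumann series of ratio 1/2, as [geo_series] requires. *)
Lemma sigma_Rcls_bounded : exists B : R, forall l, sigma (Rcls i) T l -> rnorm l <= B.
Proof.
have [B B0 TB] := Tb; exists (2 * B) => l nl; rewrite leNgt; apply/negP => lB.
apply: nl; have l0 : l != 0 by apply: contraTneq lB => ->; rewrite rnorm0 -leNgt; lra.
have rl0 : 0 < rnorm l by apply: rnorm_gt0 => /eqP; exact/negP.
apply: shift_op_bij_Rcls => [x|y].
  move=> /eqP; rewrite shift_opE subr_eq0 => /eqP Tx; apply: rnorm_eq0.
  have := TB x; rewrite Tx rnormZ => h; have := rnorm_ge0 x.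
  nra.
(* The Neumann terms satisfy [T x_k = l x_(k+1)] and [l x_0 = y], so minus their sum solves the
   equation. *)
pose x k := l^-1 ^+ k.+1 *: iter k T y.
have xS k : T (x k) = l *: x k.+1.
  by rewrite /x linearZ scalerA [in RHS]exprS mulrA divff // mul1r.
have x0 : l *: x 0%N = y by rewrite /x expr1 scalerA divff // scale1r.
have rx k : rnorm (x k) <= rnorm (x 0%N) / 2 ^+ k.
  elim: k => [|k IHk]; first by rewrite expr0 divr1.
  have := TB (x k); rewrite xS rnormZ exprS invfM => h.
  have := rnorm_ge0 (x k.+1); have := rnorm_ge0 (x k).
  move: h IHk; set t := (2 ^+ k)^-1; rewrite (mulrCA _ 2^-1).
  nra.
have [s [hs _]] := geo_series (@banach_complete _ X) rx.
exists (- s); apply: (@seqcvg_unique _ _ (fun n => shift_op T l (- \sum_(k < n) x k))).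
  by apply: (opbounded_cvg (shiftb l)); exact: seqcvgN.
have -> : (fun n => shift_op T l (- \sum_(k < n) x k)) = (fun n => y - l *: x n).
  apply/funext => n; rewrite shift_opE linearN scalerN opprK addrC; elim: n => [|n IHn].
    by rewrite big_ord0 (linear0 T) scaler0 subrr x0 subrr.
  rewrite big_ord_recr /= (linearD T) scalerDr xS opprD addrACA IHn addrA subrK.
  by rewrite addrC.
rewrite -[X in seqcvg _ X]subr0; apply: seqcvgB; first exact: seqcvg_cst.
rewrite -[X in seqcvg _ X](scaler0 _ l); apply: seqcvgZ => e e0.
have [N hN] := archi_pow2 (rnorm (x 0%N)) e0; exists N => n Nn; rewrite subr0.
apply: le_lt_trans (rx n) _; apply: le_lt_trans _ hN.
by rewrite ler_wpM2l ?rnorm_ge0 // lef_pV2 ?posrE ?exprn_gt0 // ler_weXn2l //; lra.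
Qed.

Lemma sigma_gDMR_sub : sigma (gDMR i) T `<=` sigma (Rcls i) T.
Proof. by move=> l; apply: contra_not; exact: Rcls_gDMR. Qed.

(** Boundedness is inherited from the spectrum for R_i; closedness holds because [gDMR_open] makes
    the complement open. *)
Lemma sigma_gDMR_compact : compact (sigma (gDMR i) T).
Proof.
have [B hB] := sigma_Rcls_bounded.
apply: (@complex_compact _ _ B) => [u l ul uc /gDMR_open[r r0 hr]|l]; last by move/sigma_gDMR_sub/hB.
by have [N /(_ N (leqnn N)) h] := uc r r0; have [] := hr _ h; move: (ul N).
Qed.

(** By [gDMR_approx], a point outside the smaller spectrum has points outside the larger one
    arbitrarily near. So a disc inside the larger spectrum has its half disc inside the smaller
    one. *)
Lemma interior_sigma_gDMR : interior (sigma (gDMR i) T) = interior (sigma (Rcls i) T).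
Proof.
apply/seteqP; split; first by apply: interiorS; exact: sigma_gDMR_sub.
move=> l /nbhs_rnorm[r r0 hr]; apply/nbhs_rnorm; exists (r / 2); first by rewrite divr_gt0.
move=> m ml mD; have r20 : 0 < r / 2 by rewrite divr_gt0.
have [p pm] := gDMR_approx mD r20; apply: (hr p).
by have := rnorm_tri m p l; lra.
Qed.

Lemma boundary_sigma_gDMR : boundary (sigma (gDMR i) T) `<=` boundary (sigma (Rcls i) T).
Proof.
move=> l [cl]; rewrite interior_sigma_gDMR => nl; split=> //.
exact: closureS sigma_gDMR_sub _ cl.
Qed.

Lemma sigma_BR_diff : sigma (BR i) T `\` sigma (gDMR i) T =
  iso (sigma (BR i) T) `\` sigma gKM T.
Proof.
apply/seteqP; split=> l [].
  move=> lB /contrapT lD; split.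
    split=> //; apply/limit_point_rnorm; have [r r0 hr] := gDMR_open lD.
    exists r => // m /andP[m0 /hr[_ mB]]; apply; apply: mB => ml.
    by move: m0; rewrite ml subrr rnorm0 ltxx.
  apply; have [M [N [hN [hM MN MK _ mN]]]] := gDMR_kato_split hi (shiftb l) lD.
  by exists M, N, hM, hN; split=> //; apply/Kato_restr.
move=> [lB /limit_point_rnorm[r r0 hr]] /contrapT[M [N [hM [hN [MN /Kato_restr MK mN]]]]].
split=> //; apply; apply: (BR_punctured_gDMR hi (shiftb l) hM MN MK mN r0) => m mr.
by rewrite shift_op_shift; apply: contrapT; apply: hr; rewrite addrC addKr.
Qed.

End Spectra.

Theorem corollary3p2 (R : realType) (X : completeNormedModType R[i])
    (dimX : infinite_dimensional X)
    (T : {linear X -> X}) (T_bounded : continuous T)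
    (i : nat) (hi : (1 <= i <= 9)%N) :
  sigma (gDMR i) T `<=` sigma (Rcls i) T /\
  compact (sigma (gDMR i) T) /\
  interior (sigma (gDMR i) T) = interior (sigma (Rcls i) T) /\
  boundary (sigma (gDMR i) T) `<=` boundary (sigma (Rcls i) T) /\
  sigma (BR i) T `\` sigma (gDMR i) T =
    iso (sigma (BR i) T) `\` sigma gKM T /\
  countable (sigma (BR i) T `\` sigma (gDMR i) T).
Proof.
have Tb : opbounded T by exact/continuousP.
split; first exact: sigma_gDMR_sub.
split; first exact: sigma_gDMR_compact.
split; first exact: interior_sigma_gDMR.
split; first exact: boundary_sigma_gDMR.
split; first exact: sigma_BR_diff.
(* By (v) the set consists of isolated points of the BR-spectrum, and [countable_iso] applies. *)
rewrite sigma_BR_diff //; apply: sub_countable (countable_iso (sigma (BR i) T)).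
by apply: subset_card_le; exact: subDsetl.
Qed.
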